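(* Let $(Z,d,\nu)$ be a complete doubling metric measure space with uniformized hyperbolic filling $X_\rho$ (parameters $\alpha,\tau$). Let $p\ge1$, $0<\beta<p$, $\theta=1-\beta/p$, and equip $X_\rho$ with $\mu_\beta$. Let $f\in B^\theta_p(Z)$. Then there is an integer $n_0=n_0(\alpha,\tau)$ such that for each $n\in\mathbb Z$ the upper gradient $g$ of $Pf$ on $X_\rho$ defined in the context satisfies $$\|T_n(Pf)-f\|_{B^\theta_p(Z)}\le C\|g\|_{L^p(X_{\ge n-n_0})}.$$ Consequently $$\|T_n(Pf)\|_{B^\theta_p(Z)}\le C\|f\|_{B^\theta_p(Z)},$$ and $T_n(Pf)\to f$ in $B^\theta_p(Z)$ as $n\to\infty$. Furthermore, if $f\in\check B^\theta_p(Z)$ then $T_n(Pf)\to f$ in $\check B^\theta_p(Z)$ as well. Here $C$ depends only on $\alpha,\tau,C_\nu,\beta,p$.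
   Context: **Metric measure spaces.** A metric measure space is a metric space with a Borel regular measure giving every ball positive finite measure. $(Z,d,\nu)$ is doubling: $\nu(B_Z(z,2r))\le C_\nu\,\nu(B_Z(z,r))$ for all $z,r$. **Hyperbolic filling.** Fix $\alpha>1$ and $\tau>\max\{3,\alpha/(\alpha-1)\}$. For each $n\in\mathbb Z$ choose a maximal $\alpha^{-n}$-separated set $S_n\subset Z$ (distinct points at distance $\ge\alpha^{-n}$). Put $V_n=\{(z,n):z\in S_n\}$, $V=\bigcup_n V_n$, $\pi(z,n)=z$, $h(z,n)=n$, and $B(v)=B_Z(\pi(v),\tau\alpha^{-h(v)})$. Distinct vertices $v,w$ are joined by an edge ($v\sim w$) iff $|h(v)-h(w)|\le 1$ and $B(v)\cap B(w)\ne\emptyset$. $X$ is the resulting (connected) metric graph with unit-length edges; $h$ is extended linearly to edges. $X_{\ge n}=\{x\in X:h(x)\ge n\}$. **Uniformization.** $\rho(x)=\alpha^{-h(x)}$, $d_\rho(x,y)=\inf_\gamma\int_\gamma\rho\,ds$ over curves in $X$ from $x$ to $y$; $X_\rho=(X,d_\rho)$, $\bar X_\rho$ its completion, $\partial X_\rho=\bar X_\rho\setminus X_\rho$. There is a canonical biLipschitz identification (constant depending on $\alpha,\tau$) of $Z$ with $\partial X_\rho$: $z\in Z$ corresponds to $\lim_{n\to\infty}v_n$ in $\bar X_\rho$ for any $v_n\in V_n$ with $d(\pi(v_n),z)<\alpha^{-n}$. After this construction the metric of $Z$ is replaced by the biLipschitz equivalent metric induced by $d_\rho$, so that $Z=\partial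 X_\rho$ isometrically ($S_n$, $B(v)$ and the functions $\psi_v$ below are those coming from the original metric). **Measures.** Let $\mathcal L$ be Lebesgue measure on the unit edges of $X$, $\mu(A)=\sum_{v\in V}\sum_{w\sim v}(\nu(B(v))+\nu(B(w)))\,\mathcal L(A\cap vw)$ where $vw$ is the edge from $v$ to $w$, and $d\mu_\beta=\alpha^{-\beta h}\,d\mu$ on $X_\rho$. **Besov spaces.** $\|u\|_{B^\theta_p(Z)}^p=\int_Z\int_Z\frac{|u(x)-u(y)|^p}{d(x,y)^{p\theta}}\frac{d\nu(x)\,d\nu(y)}{\nu(B(x,d(x,y)))}$; $\tilde B^\theta_p(Z)$ is the set of $u$ that are $p$-integrable on every ball with $\|u\|_{B^\theta_p(Z)}<\infty$, and $B^\theta_p(Z)$ is its quotient by functions of zero seminorm (a.e. constants); elements of $B^\theta_p(Z)$ are not distinguished from representatives. $\check B^\theta_p(Z)=L^p(Z)\cap\tilde B^\theta_p(Z)$ with norm $\|u\|_{L^p(Z)}+\|u\|_{B^\theta_p(Z)}$. **Operators.** For $f$ integrable on balls, $Pf(v)=\frac1{\nu(B(v))}\int_{B(v)}f\,d\nu$ for $v\in V$, and $Pf$ is extended to each edge of $X$ by linear interpolation with respect to $d_\rho$-arclength. The upper gradient $g$ of $Pf$ on $X_\rho$ is $g(x)=\frac{|Pf(v)-Pf(w)|}{d_\rho(v,w)}$ for $x$ in the interior of an edge with endpoints $v,w$, and $g=0$ at vertices. For each $n$ fix a Lipschitz partition of unity $\{\psi_v\}_{v\in V_n}$ on $Z$: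 $\psi_v:Z\to[0,1]$, $\sum_{v\in V_n}\psi_v=1$, $\operatorname{supp}\psi_v\subset B_Z(\pi(v),2\alpha^{-n})$, $\psi_v$ is $C'\alpha^{n}$-Lipschitz with $C'=C'(C_\nu)$. For a function $u$ on $X$, $T_nu(z)=\sum_{v\in V_n}u(v)\psi_v(z)$, $z\in Z$. *)

(* Defs.v *)
From HB Require Import structures.
From mathcomp Require Import all_boot all_order all_algebra.
From mathcomp Require Import all_classical all_reals all_analysis.
Import Order.TTheory GRing.Theory Num.Theory.
Import numFieldNormedType.Exports.

Set Implicit Arguments.
Unset Strict Implicit.
Unset Printing Implicit Defensive.

Local Open Scope classical_set_scope.
Local Open Scope ring_scope.

#[short(type="completeMetricType")]
HB.structure Definition CompleteMetric (R : realType) :=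
  {M of Metric R M & Complete M}.

Section metric_measure_space.
Context {R : realType} {Z : completeMetricType R}.
Variable nu : {outer_measure set Z -> \bar R}.

(* Borel regularity is a property of outer measures; integration with respect
   to nu takes place on the sigma-algebra of its Caratheodory measurable sets,
   that is, on the type [caratheodory_type nu], which is convertible to Z. *)
Definition borel_regular :=
  (forall A : set Z, <<s @open Z >> A -> nu.-cara.-measurable A) /\
  (forall A : set Z, exists B : set Z,
     [/\ <<s @open Z >> B, A `<=` B & nu B = nu A]).

Definition metric_measure_space :=
  borel_regular /\
  forall (z : Z) (r : R), 0 < r -> (0 < nu (ball z r) < +oo)%E.

Definition doubling (Cnu : R) :=
  forall (z : Z) (r : R), 0 < r ->
    (nu (ball z (2 * r)) <= Cnu%:E * nu (ball z r))%E.

Local Notation nu_cara := (nu : {measure set (caratheodory_type nu) -> \bar R}).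

Definition nu_measurable (u : Z -> R) :=
  measurable_fun [set: caratheodory_type nu] (u : caratheodory_type nu -> R).

Definition mean (A : set Z) (u : Z -> R) : R :=
  (\int[nu_cara]_(x in A) u x) / fine (nu A).

Definition Lp_norm (p : R) (u : Z -> R) : \bar R :=
  Lnorm nu_cara p%:E (EFin \o u).

Definition in_Lp (p : R) (u : Z -> R) :=
  nu_measurable u /\ (Lp_norm p u < +oo)%E.

(* The Besov space is taken with respect to an arbitrary distance d on Z. *)
Section besov.
Variable d : Z -> Z -> R.

Definition dball (z : Z) (r : R) : set Z := [set y | d z y < r].

(* On the diagonal the quotient is 0 / 0, which is 0. *)
Definition besov_seminorm (theta p : R) (u : Z -> R) : \bar R :=
  ((\int[nu_cara]_y \int[nu_cara]_x
      (`|u x - u y| `^ p / d x y `^ (p * theta)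
       / fine (nu (dball x (d x y))))%:E) `^ p^-1)%E.

Definition in_besov (theta p : R) (u : Z -> R) :=
  [/\ nu_measurable u,
      forall (z : Z) (r : R), 0 < r ->
        (\int[nu_cara]_(x in dball z r)
           (`|u x| `^ p)%:E < +oo)%E
    & (besov_seminorm theta p u < +oo)%E].

Definition in_check_besov (theta p : R) (u : Z -> R) :=
  in_Lp p u /\ in_besov theta p u.

Definition check_besov_norm (theta p : R) (u : Z -> R) : \bar R :=
  (Lp_norm p u + besov_seminorm theta p u)%E.

End besov.
End metric_measure_space.

Section hyperbolic_filling.
Context {R : realType} {Z : completeMetricType R}.

Definition separated_set (r : R) (A : set Z) :=
  forall x y, A x -> A y -> x <> y -> r <= mdist x y.

Definition maximal_separated (r : R) (A : set Z) :=
  separated_set r A /\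
  forall B : set Z, A `<=` B -> separated_set r B -> B = A.

Variables (alpha tau : R) (S : int -> set Z).

Definition vertex : Type := (Z * int)%type.

Definition vertices : set vertex := [set v | S v.2 v.1].

Definition vball (v : vertex) : set Z := ball v.1 (tau * alpha ^ (- v.2)).

Definition edge (v w : vertex) : Prop :=
  [/\ vertices v, vertices w, v <> w, `|v.2 - w.2| <= 1
    & vball v `&` vball w !=set0].

(* The filling is the geometric realization of the graph: a point is the
   function giving its barycentric coordinates on the vertices. *)
Definition pt : Type := vertex -> R.

Definition vpt (v : vertex) : pt := fun u => (u == v)%:R.

Definition ept (v w : vertex) (t : R) : pt :=
  fun u => (1 - t) * (u == v)%:R + t * (u == w)%:R.

Definition filling : set pt :=
  [set x | (exists2 v, vertices v & x = vpt v) \/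
           (exists v w t, [/\ edge v w, 0 <= t <= 1 & x = ept v w t])].

(* This is the affine extension of v |-> v.2 to the edges. *)
Definition height (x : pt) : R := \sum_(v \in vertices) x v * v.2%:~R.

Definition filling_ge (n : int) : set pt :=
  [set x | filling x /\ n%:~R <= height x].

(* [chain x y l]: a path of length l from x to y, made of finitely many
   segments of edges. The metric of X is the infimum of these lengths. *)
Inductive chain : pt -> pt -> R -> Prop :=
| chain_refl x : chain x x 0
| chain_step v w s t y l :
    edge v w -> 0 <= s <= 1 -> 0 <= t <= 1 ->
    chain (ept v w t) y l -> chain (ept v w s) y (`|s - t| + l).

Definition graph_dist (x y : pt) : R := inf [set l | chain x y l].

Definition curve_length (d : pt -> pt -> R) (gamma : R -> pt) (a b : R) :
    \bar R :=
  ereal_sup [set l | exists (k : nat) (s : nat -> R),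
    [/\ s 0%N = a, s k = b, forall i, (i < k)%N -> s i <= s i.+1
      & l = (\sum_(i < k) d (gamma (s i)) (gamma (s i.+1)))%:E]].

(* A rectifiable curve in X, parametrized by arc length on [0, L]. *)
Definition arc_length_curve (gamma : R -> pt) (L : R) :=
  [/\ 0 <= L, forall s, 0 <= s <= L -> filling (gamma s)
    & forall a b, 0 <= a -> a <= b -> b <= L ->
        curve_length graph_dist gamma a b = (b - a)%:E].

Definition rho (x : pt) : R := alpha `^ (- height x).

Definition rho_dist (x y : pt) : R :=
  inf [set l | exists (gamma : R -> pt) (L : R),
    [/\ arc_length_curve gamma L, gamma 0 = x, gamma L = y
      & l = \int[@lebesgue_measure R]_(s in `[0, L]) rho (gamma s)]].

Definition approximates (v : nat -> vertex) (z : Z) :=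
  forall n : nat, [/\ vertices (v n), (v n).2 = n%:Z
    & mdist (v n).1 z < alpha ^ (- n%:Z)].

(* The metric that Z inherits as the boundary of X_rho. In the completion of
   X_rho the distance between the limits of two Cauchy sequences is the limit
   of their distances, and the boundary point z is the limit of any sequence
   of vertices approximating z; the value 0 is a default for [xget]. *)
Definition boundary_dist (z w : Z) : R :=
  xget 0 [set l | forall v v' : nat -> vertex,
    approximates v z -> approximates v' w ->
    rho_dist (vpt (v n)) (vpt (v' n)) @[n --> \oo] --> l].

Definition filling_open : set (set pt) :=
  [set U | U `<=` filling /\
    forall x, U x -> exists2 r, 0 < r &
      forall y, filling y -> graph_dist x y < r -> U y].

Definition borel_pt : Type := g_sigma_algebraType filling_open.

(* Functions on X are functions on [pt], with irrelevant values outside X. *)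
Definition edge_gradient (u : pt -> R) (x : pt) : R :=
  (* at a vertex no value qualifies, and [xget] returns its default 0 *)
  xget 0 [set r | exists v w t, [/\ edge v w, 0 < t < 1, x = ept v w t
    & r = `|u (vpt v) - u (vpt w)| / rho_dist (vpt v) (vpt w)]].

Definition vertex_trace (psi : vertex -> Z -> R) (n : int) (u : pt -> R)
    (z : Z) : R :=
  \sum_(v \in [set v | vertices v /\ v.2 = n]) u (vpt v) * psi v z.

Definition lipschitz_partition (C : R) (psi : vertex -> Z -> R) :=
  forall n : int,
  [/\ forall v z, vertices v -> v.2 = n -> 0 <= psi v z <= 1,
      forall z, \sum_(v \in [set v | vertices v /\ v.2 = n]) psi v z = 1,
      forall v, vertices v -> v.2 = n ->
        closure [set z | psi v z != 0] `<=` ball v.1 (2 * alpha ^ (- n))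
    & forall v, vertices v -> v.2 = n -> forall x y,
        `|psi v x - psi v y| <= C * alpha ^ n * mdist x y].

Variable nu : {outer_measure set Z -> \bar R}.

Definition filling_measure (A : set borel_pt) : \bar R :=
  (\esum_(v in vertices) \esum_(w in [set w | edge v w])
     ((nu (vball v) + nu (vball w)) *
      lebesgue_measure [set t : R | (0 <= t <= 1)%R /\ A (ept v w t)]))%E.

Definition filling_measure_beta (beta : R) (A : set borel_pt) : \bar R :=
  (\int[filling_measure]_(x in A) (alpha `^ (- beta * height x))%:E)%E.

Definition filling_Lp_norm (beta p : R) (A : set pt) (g : pt -> R) : \bar R :=
  ((\int[filling_measure_beta beta]_(x in (A : set borel_pt))
      (`|g x| `^ p)%:E) `^ p^-1)%E.

Definition poisson (f : Z -> R) (x : pt) : R :=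
  let a v := mean nu (vball v) f in
  let len v w t := fine (curve_length rho_dist (ept v w) 0 t) in
  xget 0 [set r |
    (exists v, [/\ vertices v, x = vpt v & r = a v]) \/
    (exists v w t, [/\ edge v w, 0 < t < 1, x = ept v w t
       & r = a v + (a w - a v) * (len v w t / len v w 1)])].

End hyperbolic_filling.

(* Main.v *)
(* The metric d induced by d_rho on Z is biLipschitz to the original one, and at
   the scale alpha^(-m) of a pair of points the Besov kernel is comparable, up
   to constants, to alpha^(m p theta) / nu(B) for a vertex ball B of level m
   containing both points. The Besov energy of f thus controls the sum over the
   levels k of the oscillations of f over the vertex balls of level k; these
   control |Pf(v) - f| on B(v), hence the energies of the edges descending from
   level k + 1 to level k, whose sum over k >= n is in turn bounded by the norm
   of g over X_{>= n} (so n0 = 0 works). Off a null set T_K f tends to f, so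
   that T_n f - f is the telescoping sum of the increments T_{k+1} f - T_k f
   with k >= n. An increment varies between two points at distance alpha^(-m)
   by at most min(1, alpha^(k - m)) times the jumps of Pf along the edges close
   to these points, and since 0 < theta < 1 the resulting double sum over m and
   k decays geometrically in |m - k|. The boundedness of T_n and the
   convergences follow from the same estimates, the energies of the levels
   k >= n being the tails of a convergent series. *)
Require Import Defs.
From HB Require Import structures.
From mathcomp Require Import all_boot all_order all_algebra finmap.
From mathcomp Require Import all_classical all_reals all_analysis.
From mathcomp Require Import measurable_realfun ring lra zify.
Import Order.TTheory GRing.Theory Num.Theory.
Import numFieldNormedType.Exports.

Set Implicit Arguments.
Unset Strict Implicit.
Unset Printing Implicit Defensive.

Local Open Scope classical_set_scope.
Local Open Scope ring_scope.

(** Neither the measurability of the Besov integrand nor the additivity of [filling_measure] is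
    established, and this shapes the proof. Besov energies are bounded pointwise by majorants that
    are countable sums over net balls, measurable in each variable and integrated term by term.
    Integrals over the filling are only bounded below, by step functions on finitely many disjoint
    open edges. Distances are treated in the same two-sided spirit: [rho_dist] is bounded above by
    explicit curves along columns of vertices, and below by functions on vertices whose affine
    extensions are Lipschitz. In the double sum over scales, half of the available decay is spent in
    the weights of [tail_jump]. A bound on that single quantity at two points of mutual distance
    alpha^(-m) then controls all the increments at once, and the other half of the decay sums them.
    The p-th powers are thus never distributed over an infinite sum. *)

(** * Lower integrals and unordered sums *)

(* Monotonicity of the integral as a supremum over simple functions: unlike
   [ge0_le_integral] it needs no measurability. *)
Lemma le_lower_integral d (T : measurableType d) (R : realType)
    (mu : {measure set T -> \bar R}) (D : set T) (f g : T -> \bar R) :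
  (forall x, D x -> 0 <= f x)%E -> (forall x, D x -> f x <= g x)%E ->
  (\int[mu]_(x in D) f x <= \int[mu]_(x in D) g x)%E.
Proof.
move=> f0 fg; have g0 x : D x -> (0 <= g x)%E.
  by move=> Dx; exact: le_trans (f0 _ Dx) (fg _ Dx).
rewrite !ge0_integralE//; apply: ge_ereal_sup => _ [h/= hf <-].
apply: ereal_sup_ubound; exists h => //= x; apply: le_trans (hf x) _.
by rewrite /patch; case: ifPn => // /[!inE] Dx; exact: fg.
Qed.

(** The enumeration is chosen before the family [a], so that one series represents the sums of a
    whole family of functions [a] depending on a parameter. The predicate [P] marks the codes that
    are attained. *)
Lemma countable_esumE (T : choiceType) (R : realType) (A : set T) :
  countable A -> A !=set0 -> exists (P : pred nat) (g : nat -> T),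
    (forall n, P n -> A (g n)) /\
    forall a : T -> \bar R, (forall i, A i -> 0 <= a i)%E ->
      (\esum_(i in A) a i = \sum_(n <oo) (if P n then a (g n) else 0))%E.
Proof.
move=> /countable_injP[e einj] [x0 Ax0].
pose g n := xget x0 [set i | A i /\ e i = n].
have ge i : A i -> g (e i) = i.
  move=> Ai; rewrite /g; case: xgetP => [y -> [Ay]|/(_ i)[]//].
  by move/einj; apply; rewrite inE.
have gE n : (e @` A) n -> A (g n) /\ e (g n) = n.
  by move=> [i Ai <-]; rewrite ge.
exists (mem (e @` A)), g; split => [n /set_mem /gE[]//|a a0].
have AE : [set g x | x in e @` A] = A.
  apply/seteqP; split=> [_ [n /gE[+ _] <-]//|i Ai].
  by exists (e i); [exists i|exact: ge].
rewrite -[in LHS]AE esum_set_image ?eseries_mkcond//.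
  by move=> n /gE[/a0].
by move=> m n /set_mem/gE[_ h1] /set_mem/gE[_ h2] gmn; rewrite -h1 -h2 gmn.
Qed.

Section integral_esum.
Context d (T : measurableType d) (R : realType) (mu : {measure set T -> \bar R}).
Variables (I : choiceType) (A : set I) (D : set T) (f : I -> T -> \bar R).
Hypothesis cA : countable A.
Hypothesis mD : measurable D.
Hypothesis f0 : forall i x, A i -> (0 <= f i x)%E.
Hypothesis mf : forall i, A i -> measurable_fun D (f i).

Lemma measurable_esum : measurable_fun D (fun x => \esum_(i in A) f i x)%E.
Proof.
have [A0|/set0P nA] := eqVneq A set0.
  rewrite (_ : (fun x => _) = cst 0%E); first exact: measurable_cst.
  by apply/funext => x; rewrite A0 esum_set0.
have [P [g [gA gE]]] := @countable_esumE _ R _ cA nA.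
have mS : measurable_fun D
    (fun x => \sum_(0 <= n <oo) (if P n then f (g n) x else 0))%E.
  have := @ge0_emeasurable_sum _ T R D
    (fun n x => if P n then f (g n) x else 0%E) xpredT; apply.
    by move=> n x _ _ /=; case: ifPn => // /gA; exact: f0.
  move=> n _ /=; case: (P n) (gA n) => [/(_ isT)/mf//|_].
  exact: measurable_cst.
apply: eq_measurable_fun mS => x _; rewrite gE// => i; exact: f0.
Qed.

Lemma integral_esum :
  (\int[mu]_(x in D) (\esum_(i in A) f i x) =
   \esum_(i in A) \int[mu]_(x in D) f i x)%E.
Proof.
have [A0|/set0P nA] := eqVneq A set0.
  rewrite A0 esum_set0; under eq_integral do rewrite esum_set0.
  exact: integral0.
have [P [g [gA gE]]] := @countable_esumE _ R _ cA nA.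
rewrite gE; last by move=> i Ai; apply: integral_ge0 => x _; exact: f0.
transitivity (\int[mu]_(x in D) (\sum_(n <oo) if P n then f (g n) x else 0))%E.
  by apply: eq_integral => x _; rewrite gE// => i; exact: f0.
rewrite integral_nneseries//.
- apply: eq_eseriesr => n _; case: ifPn => // _.
  exact: integral0.
- move=> n; case: (P n) (gA n) => [/(_ isT)/mf//|_].
  exact: measurable_cst.
- by move=> n x _; case: ifPn => // /gA; exact: f0.
Qed.

End integral_esum.

Lemma esumZl (R : realType) (I : choiceType) (A : set I) (a : I -> \bar R)
    (c : R) : 0 <= c -> (forall i, A i -> 0 <= a i)%E ->
  (\esum_(i in A) (c%:E * a i) = c%:E * \esum_(i in A) a i)%E.
Proof.
rewrite le_eqVlt => /predU1P[<- a0|c0 a0].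
  by rewrite mul0e esum1// => i _; rewrite mul0e.
have bE i : A i -> a i = (a \_ A) i by move=> Ai; rewrite patchE mem_set.
rewrite (eq_esum bE) (eq_esum (b := fun i => c%:E * (a \_ A) i)%E); last first.
  by move=> i Ai; rewrite -bE.
have b0 i : (0 <= (a \_ A) i)%E.
  by rewrite patchE; case: ifPn => // /set_mem/a0.
rewrite /esum -(ereal_sup_pZl _ c0); congr ereal_sup.
apply/seteqP; split => [_ [X [fX XA] <-]|_ [_ [X [fX XA] <-] <-]]/=.
  exists (\sum_(x \in X) (a \_ A) x)%E; first by exists X.
  by rewrite ge0_mule_fsumr.
by exists X => //; rewrite ge0_mule_fsumr.
Qed.

(** Stated on finite subsets, the bound includes finiteness and applies directly to the finite
    partial sums defining [esum]. *)
Definition card_bounded (T : choiceType) (N : nat) (A : set T) :=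
  forall F : {fset T}, [set` F] `<=` A -> (#|` F| <= N)%N.

Lemma card_bounded_sub (T : choiceType) N (A B : set T) :
  A `<=` B -> card_bounded N B -> card_bounded N A.
Proof. by move=> AB hB F FA; apply: hB; exact: subset_trans AB. Qed.

Lemma card_bounded_finite (T : choiceType) N (A : set T) :
  card_bounded N A -> finite_set A.
Proof.
move=> hA; apply: contrapT => /(@infinite_set_fset _ _ N.+1)[F FA].
by rewrite leqNgt ltnS hA.
Qed.

Lemma esum_card_bounded (R : realType) (T : choiceType) N (A : set T)
    (a : T -> \bar R) (c : R) : 0 <= c -> card_bounded N A ->
  (forall i, A i -> a i <= c%:E)%E ->
  (\esum_(i in A) a i <= (N%:R * c)%:E)%E.
Proof.
move=> c0 hA ac; apply: ge_ereal_sup => _ [X [fX XA] <-].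
rewrite fsbig_finite//=.
apply: (@le_trans _ _ (\sum_(i <- fset_set X) c%:E)%E).
  rewrite big_seq [leRHS]big_seq; apply: lee_sum => i.
  by rewrite in_fset_set// => /set_mem/XA /ac.
rewrite sumEFin big_const_seq iter_addr_0 lee_fin count_predT -[leLHS]mulr_natl.
apply: ler_wpM2r => //; rewrite ler_nat; apply: hA => i /=.
by rewrite in_fset_set// => /set_mem/XA.
Qed.

Section geometric_int.
Variables (R : realType) (q : R).
Hypothesis q01 : 0 < q < 1.

Let q0 : 0 < q. Proof. by case/andP: q01. Qed.
Let q1 : q < 1. Proof. by case/andP: q01. Qed.

Lemma esum_geometric_nat : (\esum_(i in [set: nat]) (q ^+ i)%:E <= (1 - q)^-1%:E)%E.
Proof.
have h i : true -> true -> (0 <= (q ^+ i)%:E)%E by rewrite lee_fin exprn_ge0// ltW.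
rewrite -nneseries_esumT//; last by move=> n; exact: h.
apply: lime_le; first by apply: is_cvg_nneseries => n _ _; exact: h.
apply: nearW => n; rewrite sumEFin lee_fin.
have := @geometric_le_lim R n 1 q ler01 q0; rewrite gtr0_norm// div1r => /(_ q1).
by apply: le_trans; rewrite /series/= le_eqVlt; apply/orP/or_introl/eqP/eq_bigr => i _;
  rewrite mul1r.
Qed.

(** An upper bound for the sum of q^|k| over the integers, whose exact value is (1 + q) / (1 - q);
    each half-line contributes at most one geometric series. *)
Definition two_sided_sum : R := 2 * (1 - q)^-1.

Lemma two_sided_sum_ge0 : 0 <= two_sided_sum.
Proof. by rewrite mulr_ge0// invr_ge0 subr_ge0 ltW. Qed.

Lemma esum_geometric_int (m : int) :
  (\esum_(k in [set: int]) (q ^+ `|(m - k)%R|)%:E <= two_sided_sum%:E)%E.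
Proof.
have h (i : nat) : (0 <= (q ^+ i)%:E)%E by rewrite lee_fin exprn_ge0// ltW.
rewrite (esumID [set k | m <= k]); last by move=> i _; exact: h.
rewrite !setTI (_ : [set k | m <= k] = (fun i : nat => m + i%:Z) @` setT); last first.
  apply/seteqP; split=> [k/= mk|_ [i _ <-]/=]; last by rewrite lerDl.
  by exists `|k - m|%N => //=; lia.
rewrite (_ : ~` _ = (fun i : nat => m - i.+1%:Z) @` setT); last first.
  apply/seteqP; split=> [/= k mk|_ [i _ <-] [j _] /=]; last by lia.
  have km : (k : int) < m.
    by rewrite ltNge; apply/negP => km; apply: mk; exists `|k - m|%N => //=; lia.
  by exists `|(m - k - 1)%R|%N => //=; lia.
rewrite !esum_image; first last.
- by move=> i j _ _ /=; lia.
- by move=> i j _ _ /=; lia.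
rewrite /two_sided_sum mulrDl mul1r EFinD; apply: leeD.
  apply: le_trans esum_geometric_nat; apply: le_esum => i _.
  by rewrite (_ : `|_|%N = i)//; lia.
apply: le_trans esum_geometric_nat; apply: le_esum => i _.
rewrite (_ : `|_|%N = i.+1); last by lia.
by rewrite lee_fin exprS ger_pMl ?exprn_gt0// ltW.
Qed.

Lemma sum_geometric_int (m n : int) (K : nat) :
  \sum_(i < K) q ^+ `|(m - (n + i%:Z))%R| <= two_sided_sum.
Proof.
rewrite -lee_fin; apply: le_trans (esum_geometric_int m).
apply: esum_ge; exists [set n + i%:Z | i in `I_K].
  by split => //; apply: finite_image; exact: finite_II.
rewrite fsbig_image//=; last by apply: in2W => i j /=; lia.
by rewrite -fsbig_ord sumEFin.
Qed.

End geometric_int.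

(** * Doubling metric measure spaces *)

Section doubling_space.
Context {R : realType} {Z : completeMetricType R}.
Variable nu : {outer_measure set Z -> \bar R}.
Variable Cnu : R.
Hypothesis hnu : metric_measure_space nu.
Hypothesis dnu : doubling nu Cnu.

Local Notation nu_cara := (nu : {measure set (caratheodory_type nu) -> \bar R}).

Lemma mem_ball (x y : Z) r : ball x r y = (mdist x y < r).
Proof. by rewrite ballEmdist. Qed.

Lemma measurable_open (U : set Z) : open U -> nu.-cara.-measurable U.
Proof. by move=> oU; apply: hnu.1.1; exact: sub_sigma_algebra. Qed.

Lemma measurable_mball (x : Z) r : nu.-cara.-measurable (ball x r).
Proof.
apply: measurable_open; rewrite openE => y; rewrite mem_ball => xy.
apply/nbhs_ballP; exists (r - mdist x y) => /=; first by rewrite subr_gt0.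
move=> z; rewrite !mem_ball ltrBrDl; apply: le_lt_trans.
exact: metric_triangle.
Qed.

Definition vol (x : Z) (r : R) : R := fine (nu (ball x r)).

Lemma volE x r : 0 < r -> nu (ball x r) = (vol x r)%:E.
Proof.
by move=> r0; have /andP[h1 h2] := hnu.2 x r r0; rewrite fineK// ge0_fin_numE// ltW.
Qed.

Lemma vol_gt0 x r : 0 < r -> 0 < vol x r.
Proof. by move=> r0; rewrite -lte_fin -volE//; case/andP: (hnu.2 x r r0). Qed.

Lemma vol_ge0 x r : 0 <= vol x r.
Proof. by rewrite fine_ge0. Qed.

Lemma subset_mball (x y : Z) r s : mdist x y + s <= r -> ball y s `<=` ball x r.
Proof.
move=> h z; rewrite !mem_ball => yz; apply: lt_le_trans h.
by rewrite (le_lt_trans (metric_triangle x y z))// ltrD2l.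
Qed.

Lemma subset_vol (x y : Z) r s : 0 < r -> 0 < s -> ball x r `<=` ball y s ->
  vol x r <= vol y s.
Proof. by move=> r0 s0 h; rewrite -lee_fin -!volE// le_outer_measure. Qed.

(* [1 <= Cnu] holds for a nonempty space; the maximum spares a case analysis. *)
Definition dbl (M : R) : R := Num.max 1 Cnu ^+ (Num.truncn M).+1.

Lemma dbl_ge1 M : 1 <= dbl M.
Proof. by rewrite exprn_ege1// le_max lexx. Qed.

Lemma dbl_gt0 M : 0 < dbl M.
Proof. exact: lt_le_trans (dbl_ge1 M). Qed.

Lemma vol_iter x r n : 0 < r -> vol x (2 ^+ n * r) <= Num.max 1 Cnu ^+ n * vol x r.
Proof.
move=> r0; elim: n => [|n ih]; first by rewrite !expr0 !mul1r.
have rn : 0 < 2 ^+ n * r by rewrite mulr_gt0// exprn_gt0.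
have := dnu x rn; rewrite mulrA -exprS !volE// ?mulr_gt0// ?exprn_gt0//.
rewrite -EFinM lee_fin => /le_trans; apply.
rewrite exprS -mulrA (@le_trans _ _ (Num.max 1 Cnu * vol x (2 ^+ n * r)))//.
  by rewrite ler_wpM2r ?vol_ge0// le_max lexx orbT.
by rewrite ler_wpM2l// le_max ler01.
Qed.

(** The ball at [y] lies in the ball of radius M r at [x], and 2^(floor M + 1) >= M doublings of
    radius r cover the latter. *)
Lemma vol_le_dbl (x y : Z) r s M : 0 < r -> 0 < s -> mdist x y + s <= M * r ->
  vol y s <= dbl M * vol x r.
Proof.
move=> r0 s0 h; apply: le_trans (vol_iter x (Num.truncn M).+1 r0).
have M2 : M <= 2 ^+ (Num.truncn M).+1.
  apply: (@le_trans _ _ (Num.truncn M).+1%:R); first by rewrite ltW// truncnS_gt.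
  by rewrite -natrX ler_nat ltnW// ltn_expl.
apply: subset_vol => //; first by rewrite mulr_gt0// exprn_gt0.
by apply: subset_mball; apply: le_trans h _; rewrite ler_wpM2r// ltW.
Qed.

Definition packing_number (M : R) : nat := Num.truncn (dbl (4 * M + 2)).

(** The balls of radius r/2 at the points of [A] are disjoint and lie in the ball of radius (M + 1)
    r at [x]. That ball is contained in the dilation by 4 M + 2 of each small one, since M r + (M +
    1) r = (4 M + 2)(r / 2), so each small ball carries a fixed share of its volume. *)
Lemma packing (x : Z) (A : set Z) (r M : R) : 0 < r -> 0 <= M ->
  separated_set r A -> (forall s, A s -> mdist x s <= M * r) ->
  card_bounded (packing_number M) A.
Proof.
move=> r0 M0 sA Ax F FA.
have r20 : 0 < r / 2 by rewrite divr_gt0.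
have MM : 0 < (M + 1) * r by rewrite mulr_gt0// addrC ltr_wpDr.
have tF : trivIset [set` F] (fun s => ball s (r / 2)).
  apply/trivIsetP => s t sF tF /eqP st; rewrite -subset0 => z [].
  rewrite !mem_ball => sz tz; have := sA _ _ (FA _ sF) (FA _ tF) st.
  have := metric_triangle s z t; rewrite (metric_sym z t); lra.
have mF s : [set` F] s -> nu.-cara.-measurable (ball s (r / 2)).
  by move=> _; exact: measurable_mball.
have fF : finite_set [set` F] by exact: finite_fset.
have := @measure_fin_bigcup _ _ _ nu_cara _ _ _ fF tF mF.
set U := \bigcup_(i in _) _ => UE.
have UB : U `<=` ball x ((M + 1) * r).
  move=> z [s sF]; apply: subset_mball; rewrite mulrDl mul1r lerD ?Ax//; last lra.
  exact: FA.
have : (nu U <= (vol x ((M + 1) * r))%:E)%E by rewrite -volE// le_outer_measure.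
rewrite [nu U]UE => h.
have : ((\sum_(s \in [set` F]) (vol x ((M + 1) * r) / dbl (4 * M + 2))%:E)
     <= (vol x ((M + 1) * r))%:E)%E.
  apply: le_trans h; apply: lee_fsum => // s sF /=.
  rewrite volE// lee_fin ler_pdivrMr ?dbl_gt0// [leRHS]mulrC.
  apply: vol_le_dbl => //; rewrite metric_sym.
  have := Ax _ (FA _ sF); lra.
rewrite fsbig_finite//= sumEFin big_const_seq iter_addr_0 lee_fin count_predT.
rewrite set_fsetK -[leLHS]mulr_natl mulrCA ger_pMr ?vol_gt0//.
rewrite ler_pdivrMr ?dbl_gt0// mul1r => hF.
by rewrite /packing_number truncn_ge_nat// ltW// dbl_gt0.
Qed.

End doubling_space.

(** * Integrals against set functions *)

Section lower_integral_zero.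
Context d (T : measurableType d) (R : realType) (mu : set T -> \bar R).
Hypothesis mu0 : mu set0 = 0%E.

Import HBNNSimple.

(** [integral] is a difference of two such suprema. For a set function that only satisfies
    [mu set0 = 0], this evaluates the negative part of a nonnegative function. *)
Lemma lower_integral0 :
  (ereal_sup [set sintegral mu h |
     h in [set h : {nnsfun T >-> R} | forall x, (h x)%:E <= (cst 0 : T -> \bar R) x]])%E = 0%E.
Proof.
apply/eqP; rewrite eq_le; apply/andP; split.
  apply: ge_ereal_sup => _ [k /= kF <-].
  rewrite /sintegral fsbig1// => y _.
  have [->|y0] := eqVneq y 0; first by rewrite mul0e.
  rewrite (_ : _ @^-1` _ = set0) ?mu0 ?mule0//.
  rewrite -subset0 => x /= kx; move/eqP: y0; apply.
  have := kF x; rewrite lee_fin => k0.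
  by apply/eqP; rewrite eq_le -{1}kx k0 -kx fun_ge0.
apply: ereal_sup_ubound; exists nnsfun0 => //=.
rewrite /sintegral fsbig1// => y _.
have [->|y0] := eqVneq y 0; first by rewrite mul0e.
rewrite (_ : _ @^-1` _ = set0) ?mu0 ?mule0//.
by rewrite -subset0 => x /= kx; move/eqP: y0; apply; rewrite -kx.
Qed.

Lemma integral_set0_fun (F : T -> \bar R) : (\int[mu]_(x in set0) F x)%E = 0%E.
Proof.
have F0 : F \_ set0 = cst 0%E by apply/funext => x; rewrite patchE in_set0.
rewrite /integral F0.
have -> : (cst 0 : T -> \bar R)^\+%E = cst 0%E.
  by apply/funext => x; rewrite (@ge0_funeposE _ _ setT)// in_setT.
have -> : (cst 0 : T -> \bar R)^\-%E = cst 0%E.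
  by apply/funext => x; rewrite (@ge0_funenegE _ _ setT)// in_setT.
by rewrite lower_integral0 sube0.
Qed.

End lower_integral_zero.

Section lower_integral_bound.
Context d (T : measurableType d) (R : realType) (I : eqType).
Variables (mu : set T -> \bar R) (e : I -> set T) (s : seq I) (m c : I -> R).
Hypothesis mu0 : mu set0 = 0%E.
Hypothesis me : forall i, measurable (e i).
Hypothesis uniqs : uniq s.
Hypothesis te : forall i j x, i \in s -> j \in s -> e i x -> e j x -> i = j.
Hypothesis c0 : forall i, 0 <= c i.
Hypothesis mue : forall P : pred I,
  ((\sum_(i <- s | P i) m i)%:E <=
    mu [set x | exists2 i, (i \in s) && P i & e i x])%E.

Import HBNNSimple.

Lemma step_nnsfun : exists h : {nnsfun T >-> R},
  forall x, h x = \sum_(i <- s) c i * \1_(e i) x.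
Proof.
elim: s => [|i r [h hE]]; first by exists nnsfun0 => x; rewrite big_nil.
exists (add_nnsfun (scale_nnsfun (indic_nnsfun R (me i)) (c0 i)) h) => x.
by rewrite big_cons -hE.
Qed.

(* [mu] is an arbitrary set function here: [filling_measure] need not be known
   to be a measure, superadditivity on the sets [e i] is enough. *)
Lemma integral_ge_step (A : set T) (F : T -> \bar R) :
  (forall x, A x -> 0 <= F x)%E ->
  (forall i x, i \in s -> e i x -> A x /\ ((c i)%:E <= F x)%E) ->
  ((\sum_(i <- s) c i * m i)%:E <= \int[mu]_(x in A) F x)%E.
Proof.
move=> F0 cF; have [h hE] := step_nnsfun.
have F0' : forall x, (0 <= (F \_ A) x)%E.
  by move=> x; rewrite patchE; case: ifPn => // /set_mem/F0.
have hin i x : i \in s -> e i x -> h x = c i.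
  move=> si ex; rewrite hE (bigD1_seq i)//= indicE mem_set// mulr1.
  rewrite big_seq_cond big1 ?addr0// => j /andP[sj ji].
  rewrite indicE memNset ?mulr0// => ejx; move/eqP: ji; apply.
  exact: te ejx ex.
have hout x : (forall i, i \in s -> ~ e i x) -> h x = 0.
  move=> hx; rewrite hE big_seq big1// => i si.
  by rewrite indicE memNset ?mulr0//; exact: hx.
have hval x : h x = 0 \/ exists2 i, i \in s & e i x.
  have [h'|h'] := pselect (exists2 i, i \in s & e i x); first by right.
  by left; apply: hout => i si ex; apply: h'; exists i.
rewrite /integral.
have -> : (F \_ A)^\-%E = cst 0%E.
  by apply/funext => x; rewrite (@ge0_funenegE _ _ setT)// in_setT.
rewrite lower_integral0//; rewrite sube0; apply: ereal_sup_ge; exists (sintegral mu h).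
  exists h => //= x; rewrite (@ge0_funeposE _ _ setT)// ?in_setT//.
  have [->//|[i si ex]] := hval x.
  by have [Ax cx] := cF _ _ si ex; rewrite (hin i)// patchE mem_set.
rewrite /sintegral.
(* The values of the step function; 0 accounts for the points outside all the sets [e i]. *)
pose r := undup (0 :: map c s).
rewrite -(fsbig_widen [set` r] setT)//; last first.
  move=> y [_ /= /negP yr]; rewrite (_ : _ @^-1` _ = set0) ?mu0 ?mule0//.
  rewrite -subset0 => x /= hx; apply: (negP yr); rewrite /r mem_undup inE.
  have [h0|[i si ex]] := hval x; first by rewrite -hx h0 eqxx.
  by apply/orP; right; apply/mapP; exists i; rewrite // -hx (hin i).
rewrite -fsbig_seq ?undup_uniq//.
(* The indices are grouped by the value of [c], since a level set of the step function is the union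
   of the corresponding [e i], to which [mue] applies. *)
apply: (@le_trans _ _ (\sum_(y <- r) (y * \sum_(i <- s | c i == y) m i)%:E)%E).
  rewrite sumEFin lee_fin le_eqVlt; apply/orP; left; apply/eqP.
  transitivity (\sum_(y <- r) \sum_(i <- s | c i == y) c i * m i); last first.
    by apply: eq_bigr => y _; rewrite mulr_sumr; apply: eq_bigr => i /eqP ->.
  rewrite (exchange_big_dep xpredT)//= big_seq [RHS]big_seq.
  apply: eq_bigr => i si; rewrite big_mkcond (bigD1_seq (c i)) ?undup_uniq//=.
    by rewrite eqxx big1 ?addr0// => y; rewrite eq_sym => /negbTE ->.
  by rewrite /r mem_undup inE map_f ?orbT.
apply: lee_sum => y _; have [->|y0] := eqVneq y 0; first by rewrite mul0r mul0e.
have [yneg|ypos] := ltP y 0.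
  rewrite big_pred0 ?mulr0; last first.
    by move=> i; apply/negbTE; rewrite gt_eqF// (lt_le_trans yneg).
  rewrite (_ : _ @^-1` _ = set0) ?mu0 ?mule0//.
  by rewrite -subset0 => x /= hx; move: yneg; rewrite -hx ltNge fun_ge0.
rewrite EFinM lee_wpmul2l ?lee_fin//; apply: le_trans (mue (fun i => c i == y)) _.
rewrite (_ : [set x | _] = h @^-1` [set y])//; apply/seteqP; split => x /=.
  by move=> [i /andP[si /eqP <-] ex]; exact: hin.
move=> hx; have [h0|[i si ex]] := hval x; first by rewrite -hx h0 eqxx in y0.
by exists i; rewrite ?si//= -hx (hin i) ?eqxx.
Qed.

End lower_integral_bound.

(** * The hyperbolic filling and its uniformization *)

Section segment_integral.
Variable R : realType.
Implicit Types (f : R -> R) (a b c : R).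
Local Notation leb := (@lebesgue_measure R).
Local Notation I f a b := (\int[leb]_(s in `[a, b]) f s).

Lemma continuous_integrable_segment f a b : continuous f ->
  leb.-integrable `[a, b] (EFin \o f).
Proof.
move=> cf; apply: continuous_compact_integrable; first exact: segment_compact.
exact: continuous_subspaceT.
Qed.

Lemma Rintegral_segmentD f a b c : continuous f -> a <= b -> b <= c ->
  I f a c = I f a b + I f b c.
Proof.
move=> cf ab bc.
have := @Rintegral_itvB R f (BLeft a) (BRight c) b.
rewrite !bnd_simp => /(_ (continuous_integrable_segment _ _ cf) ab bc).
rewrite Rintegral_itv_obnd_cbnd => [<-|]; first by rewrite addrC subrK.
apply: integrableS (continuous_integrable_segment b c cf) => //.
by apply: subset_itvr; rewrite bnd_simp.
Qed.

Lemma Rintegral_segment_ge f a b m : continuous f -> a <= b ->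
  (forall s, a <= s <= b -> m <= f s) -> m * (b - a) <= I f a b.
Proof.
move=> cf ab mf.
have <- : \int[leb]_(s in `[a, b]) (cst m) s = m * (b - a).
  rewrite Rintegral_cst//= lebesgue_measure_itv/= lte_fin.
  by move: ab; rewrite le_eqVlt => /predU1P[->|ab]; rewrite ?ltxx ?subrr// ab.
apply: le_Rintegral => //; apply: continuous_integrable_segment => // x.
exact: cst_continuous.
Qed.

Lemma Rintegral_segment_le f a b m : continuous f -> a <= b ->
  (forall s, a <= s <= b -> f s <= m) -> I f a b <= m * (b - a).
Proof.
move=> cf ab mf.
have <- : \int[leb]_(s in `[a, b]) (cst m) s = m * (b - a).
  rewrite Rintegral_cst//= lebesgue_measure_itv/= lte_fin.
  by move: ab; rewrite le_eqVlt => /predU1P[->|ab]; rewrite ?ltxx ?subrr// ab.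
apply: le_Rintegral => //; apply: continuous_integrable_segment => // x.
exact: cst_continuous.
Qed.

(** The image of Lebesgue measure under the translation agrees with it on half-open intervals, hence
    everywhere by uniqueness. *)
Lemma Rintegral_shift f a b c : continuous f -> (forall s, 0 <= f s) ->
  I (fun s => f (s + c)) a b = I f (a + c) (b + c).
Proof.
move=> cf f0; congr fine.
have cs : continuous (fun x : R => x + c).
  by move=> x; apply: cvgD; [exact: cvg_id|exact: cvg_cst].
have mphi : measurable_fun setT (fun x : R => x + c).
  exact: continuous_measurable_fun.
have mf : measurable_fun (`[a + c, b + c] : set (measurableTypeR R)) (EFin \o f).
  by apply/measurable_EFinP; apply: measurable_funTS; exact: continuous_measurable_fun.
have f0' : {in `[a + c, b + c]%classic, forall y, (0 <= (EFin \o f) y)%E}.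
  by move=> y _ /=; rewrite lee_fin.
have := @ge0_integral_pushforward _ _ (measurableTypeR R) (measurableTypeR R) R _ mphi leb
  `[a + c, b + c]%classic (EFin \o f) (measurable_itv _) mf f0'.
rewrite (_ : _ @^-1` _ = `[a, b]%classic); last first.
  by apply/seteqP; split => s /=; rewrite !in_itv/= !lerD2r.
move=> <-; apply: eq_measure_integral => A mA _ /=; apply/esym.
apply: lebesgue_measure_unique => // _ [[x y]] _ <- /=.
rewrite /pushforward/=.
rewrite (_ : _ @^-1` _ = `]x - c, y - c]%classic); last first.
  by apply/seteqP; split => s /=; rewrite !in_itv/= ltrBlDr lerBrDr.
rewrite !lebesgue_measure_itv/= !lte_fin ltrD2r -!EFinB.
by case: ifP => // _; congr EFin; lra.
Qed.

End segment_integral.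

Section scales.
Variables (R : realType) (alpha : R).
Hypothesis alpha1 : 1 < alpha.

Lemma alpha_gt0 : 0 < alpha. Proof. exact: lt_trans alpha1. Qed.
Local Hint Resolve alpha_gt0 : core.

Lemma scale_gt0 (n : int) : 0 < alpha ^ n.
Proof. by rewrite exprz_gt0. Qed.

Lemma scaleD (m n : int) : alpha ^ (m + n) = alpha ^ m * alpha ^ n.
Proof. by rewrite expfzDr// gt_eqF. Qed.

Lemma scaleS (n : int) : alpha ^ (- n) = alpha * alpha ^ (- (n + 1)).
Proof. by rewrite -{2}[alpha]expr1z -scaleD; congr (_ ^ _); lia. Qed.

Lemma scale_le (m n : int) : m <= n -> alpha ^ m <= alpha ^ n.
Proof. by move=> mn; rewrite ler_eXz2l. Qed.

Lemma scale_floor (t : R) : 0 < t ->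
  exists n : int, alpha ^ (- (n + 1)) <= t < alpha ^ (- n).
Proof.
move=> t0; have lna : 0 < ln alpha by rewrite ln_gt0.
pose x := ln t / ln alpha.
have tE : t = alpha `^ x.
  by rewrite /powR gt_eqF// /x divfK ?gt_eqF// lnK.
exists (- Num.floor x - 1); rewrite addrNK opprK opprB opprK addrC.
have /andP[h1 h2] := floor_itv x.
rewrite tE -!(powR_intmul _ (ltW alpha_gt0)); apply/andP; split.
  by rewrite ler_powR ?(ltW alpha1).
by rewrite /powR gt_eqF// ltr_expR ltr_pM2r.
Qed.

Lemma scale_unbounded (M : R) : exists n : int, M <= alpha ^ (- n).
Proof.
have M1 : 0 < Num.max 1 M by rewrite lt_max ltr01.
have [n /andP[_ h]] := scale_floor M1.
by exists n; rewrite (le_trans _ (ltW h))// le_max lexx orbT.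
Qed.

End scales.

Section filling_graph.
Context {R : realType} {Z : completeMetricType R}.
Variables (alpha tau : R) (S : int -> set Z).
Hypothesis alpha1 : 1 < alpha.
Hypothesis htau : Num.max 3 (alpha / (alpha - 1)) < tau.
Hypothesis hS : forall n : int, maximal_separated (alpha ^ (- n)) (S n).

Local Notation V := (vertices S).
Local Notation edge := (edge alpha tau S).
Local Notation chain := (chain alpha tau S).
Local Notation gdist := (graph_dist alpha tau S).
Local Notation X := (filling alpha tau S).

Lemma tau_gt3 : 3 < tau. Proof. by move: htau; rewrite gt_max => /andP[]. Qed.

(** Otherwise [z] could be added to [S n], against maximality. *)
Lemma net (n : int) (z : Z) : exists2 s, S n s & mdist s z < alpha ^ (- n).
Proof.
apply: contrapT => hn; have [sepS maxS] := hS n.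
have far s : S n s -> alpha ^ (- n) <= mdist s z.
  by move=> Ss; rewrite leNgt; apply/negP => h; apply: hn; exists s.
have : S n `|` [set z] = S n.
  apply: maxS => [s Ss|x y [Sx|->] [Sy|->]]; [by left|exact: sepS|by move=> _; exact: far| |by []].
  by move=> _; rewrite metric_sym; exact: far.
move=> SE; have Sz : S n z by rewrite -SE; right.
by have := far _ Sz; rewrite mdistxx leNgt scale_gt0.
Qed.

Lemma edge_sym v w : edge v w -> edge w v.
Proof.
move=> [Vv Vw vw h [z [vz wz]]]; split => //; [exact: nesym|by rewrite distrC|].
by exists z.
Qed.

Lemma ept0 (v w : @vertex R Z) : ept v w 0 = vpt v.
Proof. by apply/funext => u; rewrite /ept /vpt subr0 mul1r mul0r addr0. Qed.

Lemma ept1 (v w : @vertex R Z) : ept v w 1 = vpt w.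
Proof. by apply/funext => u; rewrite /ept /vpt subrr mul1r mul0r add0r. Qed.

Lemma eptC (v w : @vertex R Z) t : ept v w t = ept w v (1 - t).
Proof. by apply/funext => u; rewrite /ept; ring. Qed.

Lemma filling_vpt v : V v -> X (vpt v).
Proof. by move=> Vv; left; exists v. Qed.

Lemma filling_ept v w t : edge v w -> 0 <= t <= 1 -> X (ept v w t).
Proof. by move=> e t01; right; exists v, w, t. Qed.

(** The height, the barycentric coordinates and the test functions used to bound distances from
    below are all of this form. *)
Definition affine_ext (a : @vertex R Z -> R) (x : @pt R Z) : R :=
  \sum_(v \in V) x v * a v.

Lemma affine_ext_ept a v w t : edge v w ->
  affine_ext a (ept v w t) = (1 - t) * a v + t * a w.
Proof.
move=> [Vv Vw vw _ _]; rewrite /affine_ext.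
rewrite -(fsbig_widen [set v; w]); last 2 first.
- by move=> u [->|->].
- move=> u [Vu /= /not_orP[/eqP/negbTE uv /eqP/negbTE uw]].
  by rewrite /ept uv uw !mulr0 addr0 mul0r.
rewrite fsbigU//=; last by move=> u [-> /vw].
rewrite !fsbig_set1 /ept !eqxx (negbTE (introN eqP vw)).
rewrite (negbTE (introN eqP (nesym vw))) /= !mulr0 !mulr1 addr0 add0r; congr (_ * _ + _).
Qed.

Lemma affine_ext_vpt a v : V v -> affine_ext a (vpt v) = a v.
Proof.
move=> Vv; rewrite /affine_ext -(fsbig_widen [set v]); last 2 first.
- by move=> u ->.
- by move=> u [Vu /= /eqP/negbTE uv]; rewrite /vpt uv mul0r.
by rewrite fsbig_set1 /vpt eqxx mul1r.
Qed.

Lemma heightE x : height S x = affine_ext (fun v => v.2%:~R) x.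
Proof. by []. Qed.

Lemma height_ept v w t : edge v w ->
  height S (ept v w t) = (1 - t) * v.2%:~R + t * w.2%:~R.
Proof. by move=> e; rewrite heightE affine_ext_ept. Qed.

Lemma edge_height_le v w : edge v w -> `|v.2%:~R - w.2%:~R| <= 1 :> R.
Proof. by move=> [_ _ _ h _]; rewrite -intrB -intr_norm -[1]/(1%:~R) ler_int. Qed.

Lemma chain_ge0 x y l : chain x y l -> 0 <= l.
Proof. by elim=> // *; rewrite addr_ge0. Qed.

Lemma chain_trans x y z l l' : chain x y l -> chain y z l' -> chain x z (l + l').
Proof.
elim=> [u|v w s t u k e s01 t01 _ ih] h; first by rewrite add0r.
by rewrite -addrA; apply: chain_step => //; exact: ih.
Qed.

Lemma chain_edge v w s t : edge v w -> 0 <= s <= 1 -> 0 <= t <= 1 ->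
  chain (ept v w s) (ept v w t) `|s - t|.
Proof.
move=> e s01 t01; rewrite -(addr0 `|s - t|); apply: chain_step => //.
exact: chain_refl.
Qed.

Lemma chain_sym x y l : chain x y l -> chain y x l.
Proof.
elim=> [u|v w s t u k e s01 t01 _ ih]; first exact: chain_refl.
by rewrite addrC; apply: chain_trans ih _; rewrite distrC; exact: chain_edge.
Qed.

(** Lower bounds for [graph_dist] come from here: a function on vertices with controlled variation
    along edges is a test function for every chain at once. *)
Lemma chain_affine_ext a K x y l :
  (forall v w, edge v w -> `|a v - a w| <= K) -> chain x y l ->
  `|affine_ext a x - affine_ext a y| <= K * l.
Proof.
move=> aK; elim=> [u|v w s t u k e s01 t01 _ ih]; first by rewrite subrr normr0 mulr0.
apply: le_trans (ler_distD (affine_ext a (ept v w t)) _ _) _.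
rewrite mulrDr lerD// !affine_ext_ept//.
rewrite (_ : _ - _ = (a v - a w) * (t - s)); last ring.
by rewrite normrM distrC; rewrite (distrC t) ler_wpM2r// distrC aK.
Qed.

(* The slope on an edge is compared with the value of [rho] at the starting
   point, hence the loss of [alpha `^ (l + 1)]. *)
Lemma chain_affine_ext_rho a K x y l : 0 <= K ->
  (forall v w, edge v w -> `|a v - a w| <= K * alpha ^ (- v.2)) -> chain x y l ->
  `|affine_ext a x - affine_ext a y| <= K * alpha `^ (l + 1 - height S x) * l.
Proof.
move=> K0 aK; elim=> [u|v w s t u k e s01 t01 c ih].
  by rewrite subrr normr0 mulr0.
have al := alpha_gt0 alpha1.
apply: le_trans (ler_distD (affine_ext a (ept v w t)) _ _) _.
rewrite mulrDr; apply: lerD.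
  rewrite !affine_ext_ept// (_ : _ - _ = (a v - a w) * (t - s)); last ring.
  rewrite normrM (distrC t) ler_wpM2r//; apply: le_trans (aK _ _ e) _.
  rewrite ler_wpM2l// -(powR_intmul _ (ltW al)) ler_powR ?(ltW alpha1)//.
  rewrite height_ept// mulrNz.
  have := edge_height_le e; have := chain_ge0 c; have := normr_ge0 (s - t).
  by move: s01 => /andP[s0 s1] h1 h2; rewrite ler_norml => /andP[h3 h4]; nra.
(* The rest of the chain starts at a point whose height differs by at most [|s - t|], exactly the
   length gained in the exponent. *)
apply: le_trans ih _; rewrite ler_wpM2r ?(chain_ge0 c)// ler_wpM2l//.
rewrite ler_powR ?(ltW alpha1)// !height_ept//.
have := edge_height_le e.
move: (v.2%:~R) (w.2%:~R) => p q pq.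
have : `|(s - t) * (p - q)| <= `|s - t| by rewrite normrM ler_piMr.
by rewrite ler_norml => /andP[h1 h2]; lra.
Qed.

Definition near v (z : Z) := V v /\ mdist v.1 z < alpha ^ (- v.2).

Lemma near_exists n z : exists2 v, near v z & v.2 = n.
Proof. by have [s Ss sz] := net n z; exists (s, n). Qed.

Lemma near_vertex v : V v -> near v v.1.
Proof. by move=> Vv; split => //; rewrite mdistxx scale_gt0. Qed.

(** The point z' witnesses that the two vertex balls meet: 1 + (tau - 1) = tau for [v], and tau > 1
    for [w]. *)
Lemma near_adjacent v w z z' : near v z -> near w z' -> `|v.2 - w.2| <= 1 ->
  mdist z z' <= (tau - 1) * alpha ^ (- v.2) -> v = w \/ edge v w.
Proof.
move=> [Vv vz] [Vw wz] h zz'.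
have [->|/eqP vw] := eqVneq v w; [by left|right; split => //; exists z'].
have t1 : 1 < tau by have := tau_gt3; lra.
split; rewrite /vball ballEmdist/=.
  apply: le_lt_trans (metric_triangle _ z _) _.
  rewrite (_ : tau = 1 + (tau - 1)); last ring.
  by rewrite mulrDl mul1r ltr_leD.
by apply: lt_le_trans wz _; rewrite ler_peMl ?ltW// scale_gt0.
Qed.

Section columns.
(** [P v w c] stands for a connection from [v] to [w] of cost at most [c]. It is used twice: for the
    existence of a chain, with the cost ignored, and for curves of rho-length at most [c]. *)
Variable P : @vertex R Z -> @vertex R Z -> R -> Prop.
Hypothesis Prefl : forall v, V v -> P v v 0.
Hypothesis Pedge : forall v w, edge v w -> P v w (alpha * alpha ^ (- v.2)).
Hypothesis Ptrans : forall u v w c c', P u v c -> P v w c' -> P u w (c + c').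
Hypothesis Pmono : forall v w c c', c <= c' -> P v w c -> P v w c'.

(** The geometric series of the edge costs alpha * alpha^(-j), j >= 0. The induction on columns uses
    it as the solution of c = alpha + c / alpha. *)
Definition column_cst := alpha ^+ 2 / (alpha - 1).

Lemma Padjacent v w z z' : near v z -> near w z' -> `|v.2 - w.2| <= 1 ->
  mdist z z' <= (tau - 1) * alpha ^ (- v.2) -> P v w (alpha * alpha ^ (- v.2)).
Proof.
move=> vz wz h zz'; have [<-|/Pedge//] := near_adjacent vz wz h zz'.
apply: Pmono (Prefl vz.1); apply: mulr_ge0; apply: ltW.
  exact: alpha_gt0.
exact: scale_gt0.
Qed.

Lemma column_cstE : column_cst = alpha + column_cst / alpha.
Proof.
rewrite /column_cst; field.
by rewrite subr_eq0 !gt_eqF// alpha_gt0.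
Qed.

Lemma column_cst_ge : alpha <= column_cst.
Proof.
have al := ltW (alpha_gt0 alpha1).
by rewrite column_cstE lerDl !divr_ge0// ?exprn_ge0// subr_ge0 ltW.
Qed.

(** One level is crossed at a time, through vertices near [z]. Both directions are carried along
    because [P] is not assumed symmetric. *)
Lemma column (k : nat) v w z : near v z -> near w z -> w.2 = v.2 + k%:Z ->
  P v w (column_cst * alpha ^ (- v.2)) /\ P w v (column_cst * alpha ^ (- v.2)).
Proof.
have t1 : 0 <= tau - 1 by have := tau_gt3; lra.
have zz u : mdist z z <= (tau - 1) * alpha ^ (- u).
  by rewrite mdistxx mulr_ge0// ltW// scale_gt0.
elim: k v => [|k ih] v vz wz wv.
  have h : `|v.2 - w.2| <= 1 by rewrite wv addr0 subrr normr0.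
  split; apply: Pmono (Padjacent _ _ _ (zz _)) => //; last by rewrite distrC.
    by rewrite ler_wpM2r ?column_cst_ge// ltW// scale_gt0.
  by rewrite wv addr0 ler_wpM2r ?column_cst_ge// ltW// scale_gt0.
have [u uz u2] := near_exists (v.2 + 1) z.
have [wu uw] := ih u uz wz ltac:(rewrite wv u2; lia).
have E : column_cst * alpha ^ (- v.2) =
    alpha * alpha ^ (- v.2) + column_cst * alpha ^ (- u.2).
  rewrite u2 (scaleS alpha1 v.2) {1}column_cstE; field.
  by rewrite gt_eqF// alpha_gt0.
split; rewrite E.
  by apply: Ptrans wu; apply: Padjacent (zz _) => //; rewrite u2; lia.
rewrite addrC; apply: Ptrans uw _.
apply: Pmono (Padjacent uz vz _ (zz _)); last by rewrite u2; lia.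
rewrite ler_wpM2l ?(ltW (alpha_gt0 _))// scale_le// u2; lia.
Qed.

Definition bridge_cst := 2 * column_cst + alpha.

(** The path descends the column over [z] to the coarse level [n], crosses one edge (or none), and
    climbs the column over z'. This gives two column costs and one edge cost. *)
Lemma bridge v w z z' n : near v z -> near w z' -> n <= v.2 -> n <= w.2 ->
  mdist z z' <= (tau - 1) * alpha ^ (- n) -> P v w (bridge_cst * alpha ^ (- n)).
Proof.
move=> vz wz nv nw zz'.
have [v' vz' v'2] := near_exists n z; have [w' wz' w'2] := near_exists n z'.
have [_ vv'] := @column `|v.2 - n|%N _ _ _ vz' vz ltac:(lia).
have [ww' _] := @column `|w.2 - n|%N _ _ _ wz' wz ltac:(lia).
have v'w' := @Padjacent v' w' z z' vz' wz' ltac:(lia) ltac:(by rewrite v'2).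
have := Ptrans vv' (Ptrans v'w' ww').
by apply: Pmono; rewrite v'2 w'2 /bridge_cst; lra.
Qed.

End columns.

End filling_graph.

Section filling_curves.
Context {R : realType} {Z : completeMetricType R}.
Variables (alpha tau : R) (S : int -> set Z).
Hypothesis alpha1 : 1 < alpha.
Hypothesis htau : Num.max 3 (alpha / (alpha - 1)) < tau.
Hypothesis hS : forall n : int, maximal_separated (alpha ^ (- n)) (S n).

Local Notation V := (vertices S).
Local Notation edge := (edge alpha tau S).
Local Notation chain := (chain alpha tau S).
Local Notation gdist := (graph_dist alpha tau S).
Local Notation X := (filling alpha tau S).
Local Notation leb := (@lebesgue_measure R).

Lemma common_scale (v w : @vertex R Z) (t : R) :
  exists n : int, [/\ n <= v.2, n <= w.2 & t <= (tau - 1) * alpha ^ (- n)].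
Proof.
have t1 : 0 < tau - 1 by have := tau_gt3 htau; lra.
have [n hn] := scale_unbounded alpha1 (t / (tau - 1)).
exists (Num.min n (Num.min v.2 w.2)); split.
- by rewrite !ge_min lexx orbT.
- by rewrite !ge_min lexx !orbT.
rewrite mulrC -ler_pdivrMr//; apply: le_trans hn _.
by rewrite scale_le// lerN2 ge_min lexx.
Qed.

Lemma vertices_connected v w : V v -> V w -> exists l, chain (vpt v) (vpt w) l.
Proof.
move=> Vv Vw; have [n [nv nw h]] := common_scale v w (mdist v.1 w.1).
have vz := near_vertex alpha1 Vv; have wz := near_vertex alpha1 Vw.
apply: (@bridge _ _ alpha tau S alpha1 htau hS
  (fun v w _ => exists l, chain (vpt v) (vpt w) l) _ _ _ _ _ _ _ _ _ vz wz nv nw h).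
- by move=> u _; exists 0; exact: chain_refl.
- move=> u u' e; exists `|0 - 1|; rewrite -(ept0 u u') -(ept1 u u').
  by apply: chain_edge => //; rewrite ?lexx ?ler01.
- by move=> a b c _ _ [l h1] [l' h2]; exists (l + l'); exact: chain_trans h1 h2.
- by [].
Qed.

Lemma filling_chain x : X x -> exists2 v, V v & exists l, chain x (vpt v) l.
Proof.
move=> [[v Vv ->]|[v [w [t [e t01 ->]]]]].
  by exists v => //; exists 0; exact: chain_refl.
exists v; first by case: e.
exists `|t - 0|; rewrite -[vpt v](ept0 v w); apply: chain_edge => //.
by rewrite lexx ler01.
Qed.

Lemma filling_connected x y : X x -> X y -> exists l, chain x y l.
Proof.
move=> /filling_chain[v Vv [l xv]] /filling_chain[w Vw [l' yw]].
have [m vw] := vertices_connected Vv Vw.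
exists (l + (m + l')); apply: chain_trans xv _; apply: chain_trans vw _.
exact: chain_sym.
Qed.

Lemma gdist_le x y l : chain x y l -> gdist x y <= l.
Proof.
move=> c; apply: ge_inf => //; exists 0 => k; exact: chain_ge0.
Qed.

Lemma gdist_ge x y c : X x -> X y -> (forall l, chain x y l -> c <= l) ->
  c <= gdist x y.
Proof.
move=> Xx Xy h; apply: lb_le_inf; last by move=> l; exact: h.
exact: filling_connected.
Qed.

Lemma gdist_lt x y c : X x -> X y -> gdist x y < c -> exists2 l, chain x y l & l < c.
Proof.
move=> Xx Xy h; apply: contrapT => hn; move: h; apply/negP; rewrite -leNgt.
apply: gdist_ge => // l xyl; rewrite leNgt; apply/negP => lc; apply: hn.
by exists l.
Qed.

Lemma gdist_triangle x y z : X x -> X y -> X z ->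
  gdist x z <= gdist x y + gdist y z.
Proof.
move=> Xx Xy Xz; rewrite -lerBlDr; apply: gdist_ge => // l xy.
rewrite lerBlDr -lerBlDl; apply: gdist_ge => // l' yz.
by rewrite lerBlDl; apply: gdist_le; exact: chain_trans xy yz.
Qed.

Lemma affine_ext_gdist a x y : X x -> X y ->
  (forall v w, edge v w -> `|a v - a w| <= 1) ->
  `|affine_ext S a x - affine_ext S a y| <= gdist x y.
Proof.
move=> Xx Xy h; apply: gdist_ge => // l c.
by have := chain_affine_ext h c; rewrite mul1r.
Qed.

Lemma height_gdist x y : X x -> X y ->
  `|height S x - height S y| <= gdist x y.
Proof.
by move=> Xx Xy; apply: affine_ext_gdist => // v w; exact: edge_height_le.
Qed.

Lemma gdist_ept v w s t : edge v w -> 0 <= s <= 1 -> 0 <= t <= 1 ->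
  gdist (ept v w s) (ept v w t) = `|s - t|.
Proof.
move=> e s01 t01; apply/eqP; rewrite eq_le; apply/andP; split.
  exact: gdist_le (chain_edge e s01 t01).
have [Vv Vw vw _ _] := e.
(* The coordinate at [v] varies by at most 1 along every edge and moves at unit speed along the edge
   [v w]. *)
pose a (u : @vertex R Z) : R := (u == v)%:R.
have -> : `|s - t| = `|affine_ext S a (ept v w s) - affine_ext S a (ept v w t)|.
  rewrite !(affine_ext_ept _ _ e) /a eqxx (negbTE (introN eqP (nesym vw))) -normrN.
  by congr `|_|; rewrite /=; ring.
apply: affine_ext_gdist; [exact: filling_ept|exact: filling_ept|].
move=> u u' _; rewrite /a; case: eqP; case: eqP => _ _ /=;
  by rewrite ?subrr ?subr0 ?sub0r ?normrN ?normr0 ?normr1 ?lexx ?ler01.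
Qed.

Local Notation clength := (curve_length gdist).

Lemma curve_length_le gamma a b :
  (forall s t, a <= s -> s <= t -> t <= b -> gdist (gamma s) (gamma t) <= t - s) ->
  (clength gamma a b <= (b - a)%:E)%E.
Proof.
move=> h; apply: ge_ereal_sup => _ [k [s [s0 sk mono ->]]].
rewrite lee_fin.
have mon i j : (i <= j)%N -> (j <= k)%N -> s i <= s j.
  move=> ij; rewrite -(subnKC ij); elim: (j - i)%N => [|m ih]; first by rewrite addn0.
  by rewrite addnS => h'; apply: le_trans (ih (ltnW h')) _; exact: mono.
apply: (@le_trans _ _ (\sum_(i < k) (s i.+1 - s i))).
  apply: ler_sum => i _; have ik := ltn_ord i.
  apply: h; [rewrite -s0|exact: mono|rewrite -sk]; apply: mon => //.
  exact: ltnW.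
by rewrite -(big_mkord xpredT (fun i => s i.+1 - s i)) telescope_sumr// s0 sk.
Qed.

Lemma curve_length_ge gamma a b : a <= b ->
  ((gdist (gamma a) (gamma b))%:E <= clength gamma a b)%E.
Proof.
move=> ab; apply: ereal_sup_ubound; exists 1%N, (fun i => if i is 0%N then a else b).
by split => //; [case|rewrite big_ord1].
Qed.

(** Partitions of the two intervals are concatenated, and the two suprema are then taken in turn.
    This subtracts from the length over [a, c], so its infinite values are handled apart. *)
Lemma curve_length_cat gamma a b c : a <= b -> b <= c ->
  ((b - a)%:E <= clength gamma a b)%E -> ((c - b)%:E <= clength gamma b c)%E ->
  ((c - a)%:E <= clength gamma a c)%E.
Proof.
move=> ab bc hab hbc.
have key k1 s1 k2 s2 : s1 0%N = a -> s1 k1 = b ->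
   (forall i, (i < k1)%N -> s1 i <= s1 i.+1) ->
   s2 0%N = b -> s2 k2 = c -> (forall i, (i < k2)%N -> s2 i <= s2 i.+1) ->
   ((\sum_(i < k1) gdist (gamma (s1 i)) (gamma (s1 i.+1)) +
    \sum_(i < k2) gdist (gamma (s2 i)) (gamma (s2 i.+1)))%:E <= clength gamma a c)%E.
  move=> s10 s1k m1 s20 s2k m2; apply: ereal_sup_ubound.
  pose s i := if (i <= k1)%N then s1 i else s2 (i - k1)%N.
  have sl i : (i <= k1)%N -> s i = s1 i by rewrite /s => ->.
  have sr i : s (k1 + i)%N = s2 i.
    rewrite /s addKn; case: leqP => //; rewrite -{2}(addn0 k1) leq_add2l leqn0.
    by move=> /eqP ->; rewrite addn0 s1k s20.
  exists (k1 + k2)%N, s; split.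
  - by rewrite sl.
  - by rewrite sr.
  - move=> i ik; case: (ltnP i k1) => ik1; first by rewrite (sl _ (ltnW ik1)) (sl _ ik1) m1.
    by rewrite -(subnKC ik1) -addnS !sr m2// -(ltn_add2l k1) subnKC.
  congr EFin; rewrite big_split_ord/=; congr (_ + _); apply: eq_bigr => i _.
    by rewrite (sl _ (ltn_ord i)) (sl _ (ltnW (ltn_ord i))).
  by rewrite -addnS !sr.
move: hab hbc; case E : (clength gamma a c) => [x| |]; last 2 first.
- by rewrite leey.
- by have := curve_length_ge gamma (le_trans ab bc); rewrite E leeNy_eq.
move=> hab hbc; rewrite lee_fin.
suff : b - a <= x - (c - b) by lra.
rewrite -lee_fin; apply: le_trans hab _.
apply: ge_ereal_sup => _ [k1 [s1 [s10 s1k m1 ->]]]; rewrite lee_fin lerBrDr -lerBrDl -lee_fin.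
apply: le_trans hbc _; apply: ge_ereal_sup => _ [k2 [s2 [s20 s2k m2 ->]]].
rewrite lee_fin lerBrDl -lee_fin -E; exact: key.
Qed.

Lemma eq_curve_length gamma gamma' a b :
  (forall s, a <= s <= b -> gamma s = gamma' s) ->
  clength gamma a b = clength gamma' a b.
Proof.
have aux g g' : (forall s, a <= s <= b -> g s = g' s) ->
    (clength g a b <= clength g' a b)%E.
  move=> gg'; apply: le_ereal_sup => _ [k [s [s0 sk m ->]]].
  exists k, s; split => //; congr EFin; apply: eq_bigr => i _.
  have mon p q : (p <= q)%N -> (q <= k)%N -> s p <= s q.
    move=> ij; rewrite -(subnKC ij); elim: (q - p)%N => [|n ih]; first by rewrite addn0.
    by rewrite addnS => h'; apply: le_trans (ih (ltnW h')) _; exact: m.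
  have ik := ltn_ord i.
  by rewrite !gg'// -{1}s0 -{1}sk !mon// ltnW.
by move=> gg'; apply/eqP; rewrite eq_le !aux// => s /gg'.
Qed.

Lemma curve_length_shift gamma a b c :
  (clength gamma a b <= clength (fun s => gamma (s - c)%R) (a + c)%R (b + c)%R)%E.
Proof.
apply: le_ereal_sup => _ [k [s [s0 sk m ->]]].
exists k, (fun i => s i + c); rewrite s0 sk; split => //.
  by move=> i ik; rewrite lerD2r m.
by congr EFin; apply: eq_bigr => i _; rewrite !addrK.
Qed.

End filling_curves.

Section uniformized_curves.
Context {R : realType} {Z : completeMetricType R}.
Variables (alpha tau : R) (S : int -> set Z).
Hypothesis alpha1 : 1 < alpha.
Hypothesis htau : Num.max 3 (alpha / (alpha - 1)) < tau.
Hypothesis hS : forall n : int, maximal_separated (alpha ^ (- n)) (S n).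

Local Notation V := (vertices S).
Local Notation edge := (edge alpha tau S).
Local Notation chain := (chain alpha tau S).
Local Notation gdist := (graph_dist alpha tau S).
Local Notation X := (filling alpha tau S).
Local Notation leb := (@lebesgue_measure R).
Local Notation clength := (curve_length gdist).
Local Notation arc := (arc_length_curve alpha tau S).
Local Notation rho := (rho alpha S).
Implicit Types (x y : @pt R Z) (gamma : R -> @pt R Z).

Lemma arc_gdist gamma L s t : arc gamma L -> 0 <= s -> s <= t -> t <= L ->
  gdist (gamma s) (gamma t) <= t - s.
Proof.
move=> [_ _ h] s0 st tL; rewrite -lee_fin -(h s t)//; exact: curve_length_ge.
Qed.

(** The 1-Lipschitz bound already yields that lengths are at most b - a, so that only the opposite
    inequality has to be supplied. *)
Lemma arc_intro gamma L : 0 <= L -> (forall s, 0 <= s <= L -> X (gamma s)) ->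
  (forall s t, 0 <= s -> s <= t -> t <= L -> gdist (gamma s) (gamma t) <= t - s) ->
  (forall a b, 0 <= a -> a <= b -> b <= L -> ((b - a)%:E <= clength gamma a b)%E) ->
  arc gamma L.
Proof.
move=> L0 Xg glip glen; split => // a b a0 ab bL.
apply/eqP; rewrite eq_le glen// andbT; apply: curve_length_le => s t as_ st tb.
by apply: glip => //; [exact: le_trans as_|exact: le_trans tb bL].
Qed.

Lemma arc_cst x : X x -> arc (cst x) 0.
Proof.
move=> Xx; have g0 : gdist x x = 0.
  apply/eqP; rewrite eq_le; apply/andP; split; first exact: gdist_le (chain_refl _ _ _ _).
  by apply: gdist_ge => // l; exact: chain_ge0.
apply: arc_intro => // [s t s0 st t0|a b a0 ab b0]; first by rewrite g0 subr_ge0.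
apply: le_trans (curve_length_ge _ _ _ _ ab); rewrite /= g0 lee_fin subr_le0.
exact: le_trans b0 a0.
Qed.

Lemma arc_ept v w : edge v w -> arc (ept v w) 1.
Proof.
move=> e; have h s t : 0 <= s -> s <= t -> t <= 1 ->
    gdist (ept v w s) (ept v w t) = t - s.
  move=> s0 st t1; rewrite (gdist_ept alpha1 htau hS)// ?s0 ?t1 ?(le_trans st t1) ?(le_trans s0 st)//.
  by rewrite distrC ger0_norm// subr_ge0.
apply: arc_intro => // [s s01|s t s0 st t1|a b a0 ab b1]; first exact: filling_ept.
  by rewrite h.
by rewrite -h//; exact: curve_length_ge.
Qed.

Definition curve_cat gamma gamma' (L : R) (s : R) :=
  if s <= L then gamma s else gamma' (s - L).

Section cat.
Variables (gamma gamma' : R -> @pt R Z) (L L' : R).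
Hypothesis ag : arc gamma L.
Hypothesis ag' : arc gamma' L'.
Hypothesis gg' : gamma L = gamma' 0.

Local Notation cat := (curve_cat gamma gamma' L).

Lemma curve_cat_l s : s <= L -> cat s = gamma s.
Proof. by rewrite /curve_cat => ->. Qed.

Lemma curve_cat_r s : L <= s -> cat s = gamma' (s - L).
Proof.
move=> Ls; rewrite /curve_cat; case: (leP s L) => // sL.
have -> : s = L by apply/eqP; rewrite eq_le sL.
by rewrite subrr gg'.
Qed.

Lemma arc_cat : arc cat (L + L').
Proof.
have [L0 X1 len1] := ag; have [L'0 X2 len2] := ag'.
have Xc s : 0 <= s <= L + L' -> X (cat s).
  move=> /andP[s0 sL]; have [sl|/ltW sr] := leP s L.
    by rewrite curve_cat_l//; apply: X1; rewrite s0.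
  by rewrite curve_cat_r//; apply: X2; rewrite subr_ge0 sr lerBlDl.
apply: arc_intro => //; first exact: addr_ge0.
- move=> s t s0 st tL; have [tl|/ltW tr] := leP t L.
    rewrite !curve_cat_l ?(le_trans st tl)//; exact: arc_gdist ag _ _ _.
  have [sl|/ltW sr] := leP s L; last first.
    rewrite !curve_cat_r// (_ : t - s = (t - L) - (s - L)); last ring.
    by apply: arc_gdist ag' _ _ _; rewrite ?subr_ge0 ?lerB// lerBlDl.
  apply: le_trans (gdist_triangle alpha1 htau hS _ (y := cat L) _ _) _.
  + by apply: Xc; rewrite s0 (le_trans st tL).
  + by apply: Xc; rewrite L0 lerDl.
  + by apply: Xc; rewrite (le_trans s0 st) tL.
  rewrite (_ : t - s = (L - s) + (t - L - 0)); last ring.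
  apply: lerD; first by rewrite !curve_cat_l//; exact: arc_gdist ag _ _ _.
  rewrite !curve_cat_r// subrr; apply: arc_gdist ag' _ _ _ => //.
    by rewrite subr_ge0.
  by rewrite lerBlDl.
have left a b : 0 <= a -> a <= b -> b <= L -> ((b - a)%:E <= clength cat a b)%E.
  move=> a0 ab bL; rewrite (@eq_curve_length _ _ _ _ _ _ gamma) ?len1// => s /andP[_ sb].
  by rewrite curve_cat_l// (le_trans sb bL).
have right a b : L <= a -> a <= b -> b <= L + L' -> ((b - a)%:E <= clength cat a b)%E.
  move=> La ab bL; rewrite (@eq_curve_length _ _ _ _ _ _ (fun s => gamma' (s - L))).
    have := @curve_length_shift _ _ alpha tau S gamma' (a - L) (b - L) L.
    rewrite !subrK; apply: le_trans; rewrite len2 ?subr_ge0 ?lerB// ?lerBlDl//.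
    by rewrite lee_fin opprB addrA subrK.
  by move=> s /andP[as_ _]; rewrite curve_cat_r// (le_trans La as_).
move=> a b a0 ab bL; have [bl|/ltW br] := leP b L; first exact: left.
have [al|/ltW ar] := leP a L; last exact: right.
exact: curve_length_cat al br (left _ _ a0 al (lexx _)) (right _ _ (lexx _) br bL).
Qed.

End cat.

(** A curve is arbitrary outside [0, L]. Freezing it at the endpoints makes [rho_along] continuous
    on the whole line, as the lemmas on segment integrals require. *)
Definition clamp (L s : R) := Num.min (Num.max s 0) L.

Lemma clamp_itv L s : 0 <= L -> 0 <= clamp L s <= L.
Proof. by move=> L0; rewrite /clamp le_min L0 le_max lexx orbT/= ge_min lexx orbT. Qed.

Lemma clamp_id L s : 0 <= s <= L -> clamp L s = s.
Proof. by move=> /andP[s0 sL]; rewrite /clamp max_l// min_l. Qed.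

Lemma clamp_lip L s t : 0 <= L -> `|clamp L s - clamp L t| <= `|s - t|.
Proof.
move=> L0; wlog st : s t / s <= t.
  by move=> h; case: (leP s t) => [/h//|/ltW/h]; rewrite distrC (distrC t).
rewrite distrC [leRHS]distrC [leRHS]ger0_norm ?subr_ge0// ler_norml /clamp.
case: (leP s 0) => ?; case: (leP t 0) => ?; rewrite ?(min_l L0);
  (try case: (leP s L) => ?); (try case: (leP t L) => ?); lra.
Qed.

Definition rho_along gamma L s := rho (gamma (clamp L s)).

Lemma rho_along_ge0 gamma L s : 0 <= rho_along gamma L s.
Proof. exact: powR_ge0. Qed.

Lemma height_arc gamma L s t : arc gamma L -> 0 <= s <= L -> 0 <= t <= L ->
  `|height S (gamma s) - height S (gamma t)| <= `|s - t|.
Proof.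
move=> ag; wlog st : s t / s <= t.
  by move=> h sL tL; case: (leP s t) => [/h|/ltW/h]; [|rewrite distrC (distrC t)]; exact.
move=> sL tL; have [_ Xg _] := ag.
apply: le_trans (height_gdist alpha1 htau hS (Xg _ sL) (Xg _ tL)) _.
rewrite distrC ger0_norm ?subr_ge0//; case/andP: sL => ? ?; case/andP: tL => ? ?.
exact: arc_gdist ag _ _ _.
Qed.

Lemma continuous_rho_along gamma L : arc gamma L -> continuous (rho_along gamma L).
Proof.
move=> ag; have [L0 _ _] := ag.
have cg : continuous (fun s => height S (gamma (clamp L s))).
  move=> s; apply/cvgrPdist_lt => e e0; near=> t.
  apply: le_lt_trans (height_arc ag (clamp_itv _ L0) (clamp_itv _ L0)) _.
  apply: le_lt_trans (clamp_lip _ _ L0) _.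
  by near: t; apply/nbhs_ballP; exists e.
have -> : rho_along gamma L =
    (fun s => expR (- height S (gamma (clamp L s)) * ln alpha)).
  by apply/funext => s; rewrite /rho_along /Defs.rho /powR gt_eqF// alpha_gt0.
move=> s; apply: continuous_comp; last exact: continuous_expR.
by apply: cvgM; [apply: cvgN; exact: cg|exact: cvg_cst].
Unshelve. all: by end_near. Qed.

Definition rho_length gamma L := \int[leb]_(s in `[0, L]) rho (gamma s).

Lemma rho_lengthE gamma L :
  rho_length gamma L = \int[leb]_(s in `[0, L]) rho_along gamma L s.
Proof.
apply: eq_Rintegral => s; rewrite inE/= in_itv/= => sL.
by rewrite /rho_along clamp_id.
Qed.

Lemma rho_length_ge0 gamma L : 0 <= rho_length gamma L.
Proof. by apply: Rintegral_ge0 => s _; exact: powR_ge0. Qed.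

Lemma rho_length_cat gamma gamma' L L' : arc gamma L -> arc gamma' L' ->
  gamma L = gamma' 0 ->
  rho_length (curve_cat gamma gamma' L) (L + L') =
    rho_length gamma L + rho_length gamma' L'.
Proof.
move=> ag ag' gg'; have ac := arc_cat ag ag' gg'.
have cc := continuous_rho_along ac.
have [L0 _ _] := ag; have [L'0 _ _] := ag'.
have LL : L <= L + L' by rewrite lerDl.
apply: etrans (rho_lengthE _ _) _; apply: etrans (Rintegral_segmentD cc L0 LL) _.
apply: (f_equal2 +%R).
  apply: eq_Rintegral => s; rewrite inE/= in_itv/= => /andP[s0 sL].
  rewrite /rho_along clamp_id ?s0 ?(le_trans sL) ?lerDl//.
  by rewrite curve_cat_l.
have := @Rintegral_shift _ _ 0 L' L cc (rho_along_ge0 _ _).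
rewrite add0r [L' + L]addrC => <-; apply: eq_Rintegral => s.
rewrite inE/= in_itv/= => /andP[s0 sL].
rewrite /rho_along clamp_id; last by rewrite addr_ge0//= addrC lerD2l.
by rewrite curve_cat_r ?addrK// lerDr.
Qed.

Definition joined x y (c : R) := exists gamma L,
  [/\ arc gamma L, gamma 0 = x, gamma L = y & rho_length gamma L <= c].

Lemma joined_refl x : X x -> joined x x 0.
Proof.
move=> Xx; exists (cst x), 0; split => //; first exact: arc_cst.
by rewrite /rho_length set_itv1 Rintegral_set1.
Qed.

Lemma joined_edge v w : edge v w -> joined (vpt v) (vpt w) (alpha * alpha ^ (- v.2)).
Proof.
move=> e; have ae := arc_ept e.
exists (ept v w), 1; split => //; [exact: ept0|exact: ept1|].
rewrite rho_lengthE (_ : alpha * _ = alpha * alpha ^ (- v.2) * (1 - 0)); last by rewrite subr0 mulr1.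
apply: Rintegral_segment_le => //; first exact: continuous_rho_along.
move=> s s01; rewrite /rho_along clamp_id// /Defs.rho (height_ept _ e).
have al := ltW (alpha_gt0 alpha1).
rewrite -(powR_intmul _ al) -{2}(powRr1 al) -powRD; last by apply/implyP => _; rewrite gt_eqF// alpha_gt0.
rewrite ler_powR ?(ltW alpha1)// mulrNz.
have := edge_height_le e; move: s01 => /andP[s0 s1]; rewrite ler_norml => /andP[h3 h4].
nra.
Qed.

Lemma joined_trans x y (z : @pt R Z) c c' : joined x y c -> joined y z c' -> joined x z (c + c').
Proof.
move=> [g [L [ag g0 gL gc]]] [g' [L' [ag' g'0 g'L gc']]].
have gg' : g L = g' 0 by rewrite gL.
have [L0 _ _] := ag; have [L'0 _ _] := ag'.
exists (curve_cat g g' L), (L + L'); split; first exact: arc_cat.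
- by rewrite curve_cat_l.
- by rewrite (curve_cat_r gg') ?lerDl// addrC addKr.
by rewrite rho_length_cat// lerD.
Qed.

Lemma joined_mono x y c c' : c <= c' -> joined x y c -> joined x y c'.
Proof.
by move=> cc' [g [L [ag g0 gL gc]]]; exists g, L; split => //; exact: le_trans cc'.
Qed.

Lemma joined_bridge v w (z z' : Z) n : near alpha S v z -> near alpha S w z' ->
  n <= v.2 -> n <= w.2 -> mdist z z' <= (tau - 1) * alpha ^ (- n) ->
  joined (vpt v) (vpt w) (bridge_cst alpha * alpha ^ (- n)).
Proof.
apply: (@bridge _ _ alpha tau S alpha1 htau hS (fun v w => joined (vpt v) (vpt w))).
- by move=> u Vu; apply: joined_refl; exact: filling_vpt.
- exact: joined_edge.
- by move=> u u' u'' c c'; exact: joined_trans.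
- by move=> u u' c c'; exact: joined_mono.
Qed.

Lemma joined_vertices v w : V v -> V w -> exists c, joined (vpt v) (vpt w) c.
Proof.
move=> Vv Vw; have [n [nv nw h]] := common_scale alpha1 htau v w (mdist v.1 w.1).
exists (bridge_cst alpha * alpha ^ (- n)).
by apply: joined_bridge h => //; exact: near_vertex.
Qed.

Local Notation rdist := (rho_dist alpha tau S).

Lemma rdist_le x y c : joined x y c -> rdist x y <= c.
Proof.
move=> [g [L [ag g0 gL]]]; apply: le_trans; apply: ge_inf; last by exists g, L.
by exists 0 => _ [g1 [L1 [_ _ _ ->]]]; exact: rho_length_ge0.
Qed.

(** The existence of a joining curve keeps the infimum away from the empty set, where [inf] returns
    a default value. *)
Lemma rdist_ge x y c : (exists c, joined x y c) -> (forall c', joined x y c' -> c <= c') ->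
  c <= rdist x y.
Proof.
move=> [c0 [g [L [ag g0 gL gc]]]] h; apply: lb_le_inf.
  by exists (rho_length g L), g, L.
by move=> _ [g1 [L1 [ag1 g10 g1L ->]]]; apply: h; exists g1, L1.
Qed.

Lemma rdist_triangle x y (z : @pt R Z) : (exists c, joined x y c) -> (exists c, joined y z c) ->
  rdist x z <= rdist x y + rdist y z.
Proof.
move=> xy yz; rewrite -lerBlDr; apply: rdist_ge => // c jc.
rewrite lerBlDr -lerBlDl; apply: rdist_ge => // c' jc'.
by rewrite lerBlDl; apply: rdist_le; exact: joined_trans jc jc'.
Qed.

Section rho_lipschitz.
Variables (a : @vertex R Z -> R) (K : R).
Hypothesis K0 : 0 <= K.
Hypothesis aK : forall v w, edge v w -> `|a v - a w| <= K * alpha ^ (- v.2).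

(** The arc is replaced by a chain of length less than 2 (t - s) <= 2. The factor 2 is the excess of
    this length; alpha^3 bounds alpha^(l + 1), and the last alpha is the variation of rho on an arc
    of length at most 1. *)
Lemma affine_ext_arc_short gamma L s t : arc gamma L -> 0 <= s -> s <= t ->
  t <= s + 1 -> t <= L ->
  `|affine_ext S a (gamma s) - affine_ext S a (gamma t)| <=
    2 * K * alpha ^+ 4 * \int[leb]_(u in `[s, t]) rho_along gamma L u.
Proof.
move=> ag s0 st ts tL; have al := alpha_gt0 alpha1.
have sL : 0 <= s <= L by rewrite s0 (le_trans st tL).
have tL' : 0 <= t <= L by rewrite (le_trans s0 st).
have [L0 Xg _] := ag.
move: (st); rewrite le_eqVlt => /predU1P[->|st'].
  by rewrite subrr normr0 set_itv1 Rintegral_set1 mulr0.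
have : gdist (gamma s) (gamma t) < 2 * (t - s).
  by apply: le_lt_trans (arc_gdist ag s0 st tL) _; lra.
move=> /(gdist_lt alpha1 htau hS (Xg _ sL) (Xg _ tL'))[l cl ll].
have l0 := chain_ge0 cl.
apply: le_trans (chain_affine_ext_rho alpha1 K0 aK cl) _.
apply: (@le_trans _ _ (2 * K * alpha ^+ 4 * (rho (gamma s) / alpha * (t - s)))).
  rewrite (_ : _ * (_ / _ * _) = K * (alpha ^+ 3 * rho (gamma s)) * (2 * (t - s))); last first.
    by field; exact: lt0r_neq0.
  apply: ler_pM => //; last exact: ltW.
    by rewrite mulr_ge0// powR_ge0.
  rewrite ler_wpM2l// -(powR_mulrn _ (ltW al)) /Defs.rho -powRD; last by apply/implyP => _; rewrite gt_eqF.
  by rewrite ler_powR ?(ltW alpha1)//; lra.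
rewrite ler_wpM2l ?mulr_ge0 ?exprn_ge0 ?(ltW al)//.
apply: Rintegral_segment_ge => //; first exact: continuous_rho_along.
move=> u /andP[su ut]; have uL : 0 <= u <= L by rewrite (le_trans s0 su) (le_trans ut tL).
rewrite /rho_along clamp_id// ler_pdivrMr// /Defs.rho -{3}(powRr1 (ltW al)) -powRD; last by apply/implyP => _; rewrite gt_eqF.
rewrite ler_powR ?(ltW alpha1)//.
have := height_arc ag sL uL; rewrite [leRHS]distrC [leRHS]ger0_norm ?subr_ge0//.
rewrite ler_norml => /andP[h1 h2]; lra.
Qed.

(** The curve is cut into arcs of length at most 1, on which rho is almost constant; [n] counts the
    arcs. *)
Lemma affine_ext_arc gamma L : arc gamma L ->
  `|affine_ext S a (gamma 0) - affine_ext S a (gamma L)| <=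
    2 * K * alpha ^+ 4 * rho_length gamma L.
Proof.
move=> ag; have [L0 _ _] := ag; rewrite rho_lengthE.
have cr := continuous_rho_along ag; have al := alpha_gt0 alpha1.
suff main (n : nat) b : 0 <= b -> b <= L -> b <= n%:R ->
    `|affine_ext S a (gamma 0) - affine_ext S a (gamma b)| <=
    2 * K * alpha ^+ 4 * \int[leb]_(u in `[0, b]) rho_along gamma L u.
  by apply: (main (Num.truncn L).+1) => //; rewrite ltW// truncnS_gt.
elim: n b => [|n ih] b b0 bL bn.
  by apply: affine_ext_arc_short => //; lra.
have [b1|b1] := leP b 1; first by apply: affine_ext_arc_short => //; rewrite add0r.
apply: le_trans (ler_distD (affine_ext S a (gamma (b - 1))) _ _) _.
have h0 : 0 <= b - 1 by lra.
have h1 : b - 1 <= b by lra.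
rewrite (Rintegral_segmentD cr h0 h1) mulrDr lerD//.
  by apply: ih => //; [lra|rewrite lerBlDr -natr1 in bn *].
by apply: affine_ext_arc_short => //; lra.
Qed.

Lemma affine_ext_rdist v w : V v -> V w ->
  `|a v - a w| <= 2 * K * alpha ^+ 4 * rdist (vpt v) (vpt w).
Proof.
move=> Vv Vw; have al := alpha_gt0 alpha1.
move: K0; rewrite le_eqVlt => /predU1P[K0'|Kgt0].
  have [c jc] := joined_vertices Vv Vw; have [g [L [ag g0 gL gc]]] := jc.
  have := affine_ext_arc ag; rewrite g0 gL !affine_ext_vpt// -K0'.
  by rewrite mulr0 !mul0r.
have c0 : 0 < 2 * K * alpha ^+ 4 by rewrite !mulr_gt0// exprn_gt0.
rewrite mulrC -ler_pdivrMr//; apply: rdist_ge; first exact: joined_vertices.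
move=> c [g [L [ag g0 gL gc]]]; rewrite ler_pdivrMr// mulrC.
apply: le_trans (ler_wpM2l (ltW c0) gc).
by have := affine_ext_arc ag; rewrite g0 gL !affine_ext_vpt.
Qed.

End rho_lipschitz.

End uniformized_curves.

(** * The boundary metric is biLipschitz to the original one *)

Section boundary.
Context {R : realType} {Z : completeMetricType R}.
Variables (alpha tau : R) (S : int -> set Z).
Hypothesis alpha1 : 1 < alpha.
Hypothesis htau : Num.max 3 (alpha / (alpha - 1)) < tau.
Hypothesis hS : forall n : int, maximal_separated (alpha ^ (- n)) (S n).

Local Notation V := (vertices S).
Local Notation edge := (edge alpha tau S).
Local Notation joined := (joined alpha tau S).
Local Notation rdist := (rho_dist alpha tau S).
Local Notation bdist := (boundary_dist alpha tau S).
Local Notation approximates := (approximates alpha S).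

Lemma edge_mdist v w : edge v w -> mdist v.1 w.1 <= tau * (1 + alpha) * alpha ^ (- v.2).
Proof.
move=> [_ _ _ h [z []]]; rewrite /vball !ballEmdist/= => vz wz.
apply: le_trans (metric_triangle _ z _) _; rewrite (metric_sym z).
rewrite -mulrA mulrDl mul1r mulrDr lerD ?(ltW vz)// (le_trans (ltW wz))//.
have t0 : 0 <= tau by have := tau_gt3 htau; lra.
rewrite ler_wpM2l// -[X in _ <= X * _]expr1z -scaleD// scale_le//; lia.
Qed.

Lemma edge_scale v w : edge v w ->
  `|alpha ^ (- v.2) - alpha ^ (- w.2)| <= alpha * alpha ^ (- v.2).
Proof.
move=> [_ _ _ h _]; have al := alpha_gt0 alpha1.
have sv := scale_gt0 alpha1 (- v.2); have sw := scale_gt0 alpha1 (- w.2).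
have : alpha ^ (- w.2) <= alpha * alpha ^ (- v.2).
  by rewrite -[X in _ <= X * _]expr1z -scaleD// scale_le//; lia.
have : alpha ^ (- v.2) <= alpha * alpha ^ (- v.2) by rewrite ler_peMl ?(ltW alpha1) ?(ltW sv).
by move=> h1 h2; rewrite ler_norml; lra.
Qed.

Definition mdist_cst := 2 * (tau * (1 + alpha)) * alpha ^+ 4.

Lemma mdist_cst_gt0 : 0 < mdist_cst.
Proof.
have al := alpha_gt0 alpha1; have t0 : 0 < tau by have := tau_gt3 htau; lra.
by rewrite !mulr_gt0// ?exprn_gt0// addr_gt0.
Qed.

(** The test function is the distance to [v.1]: it varies along an edge by at most a multiple of the
    scale of the edge. *)
Lemma mdist_rdist v w : V v -> V w ->
  mdist v.1 w.1 <= mdist_cst * rdist (vpt v) (vpt w).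
Proof.
move=> Vv Vw; have al := alpha_gt0 alpha1.
have t0 : 0 < tau by have := tau_gt3 htau; lra.
have K0 : 0 <= tau * (1 + alpha) by rewrite mulr_ge0 ?ltW// addr_gt0.
have aK u u' : edge u u' ->
    `|mdist v.1 u.1 - mdist v.1 u'.1| <= tau * (1 + alpha) * alpha ^ (- u.2).
  move=> e; apply: le_trans (edge_mdist e); rewrite ler_norml.
  have := metric_triangle v.1 u.1 u'.1; have := metric_triangle v.1 u'.1 u.1.
  by rewrite (metric_sym u'.1) => *; lra.
have := affine_ext_rdist alpha1 htau hS K0 aK Vv Vw.
by rewrite mdistxx sub0r normrN ger0_norm ?mdist_ge0.
Qed.

(** The edge gradient divides by this distance. If the two centers coincide then the levels differ,
    and the test function alpha^(-h) replaces the distance in [Z]. *)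
Lemma edge_rdist_gt0 v w : edge v w -> 0 < rdist (vpt v) (vpt w).
Proof.
move=> e; have [Vv Vw vw _ _] := e; have al := alpha_gt0 alpha1.
have [vw1|vw1] := eqVneq v.1 w.1; last first.
  by rewrite -(pmulr_rgt0 _ mdist_cst_gt0) (lt_le_trans _ (mdist_rdist Vv Vw))// mdist_gt0.
have vw2 : v.2 != w.2.
  by apply/eqP => vw2; apply: vw; case: v w vw1 vw2 {e Vv Vw} => ? ? [? ?] /= -> ->.
have := affine_ext_rdist alpha1 htau hS (ltW al) edge_scale Vv Vw.
have c0 : 0 < 2 * alpha * alpha ^+ 4 by rewrite !mulr_gt0// exprn_gt0.
rewrite -(pmulr_rgt0 _ c0); apply: lt_le_trans.
rewrite normr_gt0 subr_eq0; apply: contra vw2 => /eqP h.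
have : - v.2 = - w.2 by apply: (ieexprIz al _ h); rewrite gt_eqF.
by move=> /oppr_inj ->.
Qed.

Lemma edge_rdist_le v w : edge v w -> rdist (vpt v) (vpt w) <= alpha * alpha ^ (- v.2).
Proof. by move=> e; apply: rdist_le; exact: joined_edge. Qed.

Local Notation B := (bridge_cst alpha).

Lemma bridge_cst_gt0 : 0 < B.
Proof.
have al := alpha_gt0 alpha1; have := column_cst_ge alpha1.
rewrite /bridge_cst; lra.
Qed.

Lemma rdist_near v w z : near alpha S v z -> near alpha S w z -> forall n,
  n <= v.2 -> n <= w.2 -> rdist (vpt v) (vpt w) <= B * alpha ^ (- n).
Proof.
move=> vz wz n nv nw; apply: rdist_le; apply: (joined_bridge alpha1 htau hS vz wz) => //.
rewrite mdistxx mulr_ge0 ?(ltW (scale_gt0 _ _))//.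
by have := tau_gt3 htau; lra.
Qed.

Lemma rdist_near_sub v w v' w' z z' (n : int) :
  near alpha S v z -> near alpha S w z -> near alpha S v' z' -> near alpha S w' z' ->
  n <= v.2 -> n <= w.2 -> n <= v'.2 -> n <= w'.2 ->
  rdist (vpt v) (vpt v') <= rdist (vpt w) (vpt w') + 2 * B * alpha ^ (- n).
Proof.
move=> vz wz vz' wz' nv nw nv' nw'.
have jv u u' : V u -> V u' -> exists c, joined (vpt u) (vpt u') c.
  exact: joined_vertices.
have Vv := vz.1; have Vw := wz.1; have Vv' := vz'.1; have Vw' := wz'.1.
have := rdist_triangle alpha1 htau hS (jv _ _ Vv Vw) (jv _ _ Vw Vv').
have := rdist_triangle alpha1 htau hS (jv _ _ Vw Vw') (jv _ _ Vw' Vv').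
have := rdist_near vz wz nv nw; have := rdist_near wz' vz' nw' nv'.
by move=> h1 h2 h3 h4; lra.
Qed.

Lemma approximates_near v z n : approximates v z -> near alpha S (v n) z /\ (v n).2 = n%:Z.
Proof. by move=> /(_ n)[Vv v2 vz]; split => //; split => //; rewrite v2. Qed.

Lemma approximates_exists z : exists v, approximates v z.
Proof.
have /choice[v hv] : forall n : nat, exists v, near alpha S v z /\ v.2 = n%:Z.
  by move=> n; have [v vz v2] := near_exists alpha1 hS n%:Z z; exists v.
by exists v => n; have [[Vv vz] v2] := hv n; split => //; rewrite -v2.
Qed.

Lemma scale_cvg0 : alpha ^ (- n%:Z) @[n --> \oo] --> (0 : R).
Proof.
have al := alpha_gt0 alpha1.
rewrite (_ : (fun n : nat => alpha ^ (- n%:Z)) = (fun n => (alpha^-1) ^+ n)); last first.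
  by apply/funext => n; rewrite -exprnN exprVn.
by apply: cvg_expr; rewrite gtr0_norm ?invr_gt0// invf_lt1.
Qed.

Lemma cvg_scaleM (c : R) : c * alpha ^ (- n%:Z) @[n --> \oo] --> (0 : R).
Proof. by rewrite -(mulr0 c); apply: cvgM; [exact: cvg_cst|exact: scale_cvg0]. Qed.

Lemma rdist_approximates_cvg v v' z z' : approximates v z -> approximates v' z' ->
  exists l : R, rdist (vpt (v n)) (vpt (v' n)) @[n --> \oo] --> l.
Proof.
move=> vz vz'; apply/cvg_ex; apply: cauchy_cvg; apply/cauchy_exP => e e0.
have [N _ hN] : \forall n \near \oo, 2 * B * alpha ^ (- n%:Z) < e.
  have := @cvgr_lt _ _ _ _ _ _ (cvg_scaleM (2 * B)) e e0.
  by apply.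
have NN : 2 * B * alpha ^ (- N%:Z) < e by apply: (hN N) => /=.
exists (rdist (vpt (v N)) (vpt (v' N))); exists N => // n /= Nn.
rewrite /ball/=; apply: le_lt_trans NN.
have [h1 e1] := approximates_near N vz; have [h2 e2] := approximates_near n vz.
have [h3 e3] := approximates_near N vz'; have [h4 e4] := approximates_near n vz'.
have := @rdist_near_sub _ _ _ _ _ _ N h1 h2 h3 h4.
have := @rdist_near_sub _ _ _ _ _ _ N h2 h1 h4 h3.
rewrite e1 e2 e3 e4 !lez_nat leqnn => /(_ Nn isT Nn isT) k1 /(_ isT Nn isT Nn) k2.
by rewrite ler_norml; lra.
Qed.

(** The limit exists and is the same for all approximating sequences, two of which are at distance
    O(alpha^(-n)) at level n. Hence the default of [xget] in [boundary_dist] never occurs. *)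
Lemma boundary_dist_cvg v v' z z' : approximates v z -> approximates v' z' ->
  rdist (vpt (v n)) (vpt (v' n)) @[n --> \oo] --> bdist z z'.
Proof.
move=> vz vz'; have [l hl] := rdist_approximates_cvg vz vz'.
have hP : forall w w', approximates w z -> approximates w' z' ->
    rdist (vpt (w n)) (vpt (w' n)) @[n --> \oo] --> l.
  move=> w w' wz wz'.
  have h0 : (rdist (vpt (w n)) (vpt (w' n)) - rdist (vpt (v n)) (vpt (v' n)))
      @[n --> \oo] --> (0 : R).
    apply: (@squeeze_cvgr _ _ _ _ (fun n : nat => - (2 * B) * alpha ^ (- n%:Z))
      (fun n : nat => 2 * B * alpha ^ (- n%:Z))); [|exact: cvg_scaleM|exact: cvg_scaleM].
    apply: nearW => n.
    have [h1 e1] := approximates_near n vz; have [h2 e2] := approximates_near n wz.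
    have [h3 e3] := approximates_near n vz'; have [h4 e4] := approximates_near n wz'.
    have := @rdist_near_sub _ _ _ _ _ _ n h1 h2 h3 h4.
    have := @rdist_near_sub _ _ _ _ _ _ n h2 h1 h4 h3.
    rewrite e1 e2 e3 e4 lexx => /(_ isT isT isT isT) k1 /(_ isT isT isT isT) k2; lra.
  rewrite -[l]add0r; apply: cvg_trans (cvgD h0 hl).
  by apply: near_eq_cvg; apply: nearW => n /=; rewrite subrK.
rewrite /boundary_dist; case: xgetP => [l' _ /(_ v v' vz vz')//|/(_ l)]; exact.
Qed.

Lemma boundary_dist_ge z z' : mdist z z' <= mdist_cst * bdist z z'.
Proof.
have [v vz] := approximates_exists z; have [v' vz'] := approximates_exists z'.
have h : mdist_cst * rdist (vpt (v n)) (vpt (v' n)) + 2 * alpha ^ (- n%:Z)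
    @[n --> \oo] --> mdist_cst * bdist z z' + 0.
  apply: cvgD; last exact: cvg_scaleM.
  by apply: cvgM; [exact: cvg_cst|exact: boundary_dist_cvg].
rewrite -[leRHS]addr0 -(cvg_lim _ h)//.
apply: limr_ge; first by apply/cvg_ex; eexists; exact: h.
apply: nearW => n.
have [[V1 h1] e1] := approximates_near n vz; have [[V2 h2] e2] := approximates_near n vz'.
have := mdist_rdist V1 V2; rewrite e1 in h1; rewrite e2 in h2.
have := metric_triangle z (v n).1 z'; have := metric_triangle (v n).1 (v' n).1 z'.
by rewrite (metric_sym z (v n).1); lra.
Qed.

(** If alpha^(-(m + 1)) <= mdist z z' < alpha^(-m), vertices of all fine enough levels are bridged
    through level m. Coinciding points have no such scale and are treated by letting the bridge
    level tend to infinity. *)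
Lemma boundary_dist_le z z' : bdist z z' <= B * alpha * mdist z z'.
Proof.
have [v vz] := approximates_exists z; have [v' vz'] := approximates_exists z'.
have h := boundary_dist_cvg vz vz'.
have [E|/eqP zz'] := eqVneq z z'.
  subst z'; rewrite mdistxx mulr0 -(cvg_lim (@Rhausdorff R) (cvg_scaleM B)).
  rewrite -(cvg_lim (@Rhausdorff R) h).
  apply: ler_lim; [by apply/cvg_ex; eexists; exact: h|by apply/cvg_ex; eexists; exact: (cvg_scaleM B)|].
  apply: nearW => n; have [h1 e1] := approximates_near n vz.
  have [h2 e2] := approximates_near n vz'.
  by apply: (rdist_near h1 h2); rewrite ?e1 ?e2.
have zz0 : 0 < mdist z z' by rewrite mdist_gt0; exact/eqP.
have [m /andP[m1 m2]] := scale_floor alpha1 zz0.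
rewrite -(cvg_lim _ h)//; apply: limr_le; first by apply/cvg_ex; eexists; exact: h.
exists `|m|%N => // n /= mn.
have [h1 e1] := approximates_near n vz; have [h2 e2] := approximates_near n vz'.
have hm : mdist z z' <= (tau - 1) * alpha ^ (- m).
  apply: le_trans (ltW m2) _; rewrite ler_peMl ?(ltW (scale_gt0 _ _))//.
  by have := tau_gt3 htau; lra.
have mn' : m <= n%:Z by lia.
have := joined_bridge alpha1 htau hS h1 h2; rewrite e1 e2 => /(_ _ mn' mn' hm).
move=> /rdist_le /le_trans; apply.
rewrite -mulrA ler_wpM2l// ?(ltW bridge_cst_gt0)// scaleS// ler_wpM2l//.
exact: ltW (alpha_gt0 alpha1).
Qed.

End boundary.

(** * Edge energies and the upper gradient *)

Section filling_energy.
Context {R : realType} {Z : completeMetricType R}.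
Variables (alpha tau : R) (S : int -> set Z).
Hypothesis alpha1 : 1 < alpha.
Hypothesis htau : Num.max 3 (alpha / (alpha - 1)) < tau.
Hypothesis hS : forall n : int, maximal_separated (alpha ^ (- n)) (S n).
Variable nu : {outer_measure set Z -> \bar R}.
Hypothesis hnu : metric_measure_space nu.

Local Notation V := (vertices S).
Local Notation edge := (edge alpha tau S).
Local Notation X := (filling alpha tau S).
Local Notation gdist := (graph_dist alpha tau S).
Local Notation rdist := (rho_dist alpha tau S).
Local Notation vertex := (@vertex R Z).

(** At a vertex [u] this is just [x u]; the form as an affine extension gives the Lipschitz bound
    with respect to [graph_dist]. *)
Definition coord (u : vertex) (x : @pt R Z) : R :=
  affine_ext S (fun v => (v == u)%:R) x.

Lemma coord_vpt u v : V v -> coord u (vpt v) = (v == u)%:R.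
Proof. by move=> Vv; rewrite /coord affine_ext_vpt. Qed.

Lemma coord_ept u v w t : edge v w ->
  coord u (ept v w t) = (1 - t) * (v == u)%:R + t * (w == u)%:R.
Proof. by move=> e; rewrite /coord (affine_ext_ept _ _ e). Qed.

Lemma coord_gdist u x y : X x -> X y -> `|coord u x - coord u y| <= gdist x y.
Proof.
move=> Xx Xy; apply: affine_ext_gdist => // v w _.
by do 2 case: eqP => _ /=; rewrite ?subrr ?subr0 ?sub0r ?normrN ?normr0 ?normr1 ?lexx ?ler01.
Qed.

(** A point of an edge has no positive coordinate outside the two endpoints, so two positive
    coordinates identify the edge up to orientation. *)
Lemma coord_edge v w v' w' t : edge v' w' -> 0 <= t <= 1 -> v <> w ->
  0 < coord v (ept v' w' t) -> 0 < coord w (ept v' w' t) ->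
  0 < t < 1 /\ ((v' = v /\ w' = w) \/ (v' = w /\ w' = v)).
Proof.
move=> e /andP[t0 t1] vw; have [_ _ vw' _ _] := e.
rewrite !coord_ept//.
have h (b b' : bool) : 0 < (1 - t) * b%:R + t * b'%:R -> (0 < 1 - t /\ b) \/ (0 < t /\ b').
  case: b b' => [] [] /=; rewrite ?mulr1 ?mulr0 ?addr0 ?add0r ?ltxx// => h; last by right.
    by case: (ltP 0 t) => ht; [right|left; split => //; lra].
  by left.
move=> /h[[h1 /eqP e1]|[h1 /eqP e1]] /h[[h2 /eqP e2]|[h2 /eqP e2]].
- by exfalso; apply: vw; rewrite -e1 -e2.
- by split; [apply/andP; split; lra|left].
- by split; [apply/andP; split; lra|right].
- by exfalso; apply: vw; rewrite -e1 -e2.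
Qed.

Definition open_edge (i : vertex * vertex) : set (@pt R Z) :=
  [set x | edge i.1 i.2 /\ exists2 t, 0 < t < 1 & x = ept i.1 i.2 t].

Lemma coord_open_edge v w t : edge v w -> 0 < t < 1 ->
  0 < coord v (ept v w t) /\ 0 < coord w (ept v w t).
Proof.
move=> e /andP[t0 t1]; have [_ _ vw _ _] := e.
rewrite !coord_ept// !eqxx (negbTE (introN eqP vw)) (negbTE (introN eqP (nesym vw))) /=.
by rewrite !mulr0 !mulr1 addr0 add0r subr_gt0.
Qed.

Lemma ept_inj v w v' w' t t' : edge v w -> edge v' w' -> 0 < t < 1 -> 0 <= t' <= 1 ->
  ept v w t = ept v' w' t' -> (v' = v /\ w' = w) \/ (v' = w /\ w' = v).
Proof.
move=> e e' t01 t'01 E; have [h1 h2] := coord_open_edge e t01.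
rewrite E in h1 h2; have [_ _ vw _ _] := e.
by have [] := coord_edge e' t'01 vw h1 h2.
Qed.

Lemma vpt_ept v v' w' t : V v -> edge v' w' -> 0 < t < 1 -> vpt v <> ept v' w' t.
Proof.
move=> Vv e t01 E; have [h1 h2] := coord_open_edge e t01; have [_ _ vw _ _] := e.
move: h1 h2; rewrite -E !coord_vpt//; case: eqP => [E1 _|_]; last by rewrite ltxx.
by case: eqP => [E2 _|_]; [apply: vw; rewrite -E1 -E2|rewrite ltxx].
Qed.

(** Both end coordinates stay positive within a distance smaller than their minimum, and this
    characterizes the open edge. *)
Lemma filling_open_edge i : filling_open alpha tau S (open_edge i).
Proof.
case: i => v w; split => [x [e [t /andP[t0 t1] ->]]|x [e [t t01 ->]]] /=.
  by apply: filling_ept => //; rewrite !ltW.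
have [h1 h2] := coord_open_edge e t01; have [Vv Vw vw _ _] := e.
have Xt : X (ept v w t) by case/andP: (t01) => ? ?; apply: filling_ept => //; rewrite !ltW.
exists (Num.min (coord v (ept v w t)) (coord w (ept v w t))); first by rewrite lt_min h1.
move=> y Xy; rewrite lt_min => /andP[dv dw].
have yv : 0 < coord v y.
  have := le_lt_trans (coord_gdist v Xt Xy) dv; rewrite ltr_norml; lra.
have yw : 0 < coord w y.
  have := le_lt_trans (coord_gdist w Xt Xy) dw; rewrite ltr_norml; lra.
split => //; case: Xy => [[u Vu E]|[v' [w' [t' [e' t'01 E]]]]].
  move: yv yw; rewrite E !coord_vpt//; case: eqP => [E1 _|_]; last by rewrite ltxx.
  by case: eqP => [E2 _|_]; [exfalso; apply: vw; rewrite -E1 -E2|rewrite ltxx].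
rewrite E in yv yw; have [t'0 [[E1 E2]|[E1 E2]]] := coord_edge e' t'01 vw yv yw.
  by exists t'; rewrite // E E1 E2.
exists (1 - t'); first by case/andP: t'0 => ? ?; apply/andP; split; lra.
by rewrite E E1 E2 eptC.
Qed.

(** The increments between consecutive traces compare vertices of consecutive levels. Orienting
    these edges downwards lists each of them once, which makes their open edges disjoint. *)
Definition descending (n : int) : set (vertex * vertex) :=
  [set i | [/\ edge i.1 i.2, i.1.2 = i.2.2 + 1 & n <= i.2.2]].

Lemma open_edge_disjoint n i j x : descending n i -> descending n j ->
  open_edge i x -> open_edge j x -> i = j.
Proof.
case: i j => [v w] [v' w'] [/= _ h _] [/= _ h' _] [/= e [t t01 ->]] [/= e' [t' t'01 E]].
have t'c : 0 <= t' <= 1 by case/andP: t'01 => ? ?; rewrite !ltW.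
have [[-> ->]//|[E1 E2]] := ept_inj e e' t01 t'c E.
by exfalso; subst v' w'; lia.
Qed.

Local Notation mu := (@filling_measure R Z alpha tau S nu).
Definition edge_mass (i : vertex * vertex) : R :=
  fine (nu (vball alpha tau i.1) + nu (vball alpha tau i.2))%E.

Lemma vballE v : nu (vball alpha tau v) = (fine (nu (vball alpha tau v)))%:E.
Proof.
have t0 : 0 < tau by have := tau_gt3 htau; lra.
by rewrite /vball -/(vol nu v.1 _) -volE// mulr_gt0// scale_gt0.
Qed.

Lemma edge_massE i :
  (nu (vball alpha tau i.1) + nu (vball alpha tau i.2))%E = (edge_mass i)%:E.
Proof. by rewrite /edge_mass vballE [X in (_ + X)%E]vballE -EFinD. Qed.

Lemma edge_mass_ge0 i : 0 <= edge_mass i.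
Proof. by rewrite fine_ge0// adde_ge0. Qed.

(** [filling_measure] counts every edge in both orientations; keeping only the terms of the listed
    orientation gives the lower bound. *)
Lemma filling_measure_open_edges n (s : seq (vertex * vertex)) (P : pred (vertex * vertex)) :
  uniq s -> (forall i, i \in s -> descending n i) ->
  ((\sum_(i <- s | P i) edge_mass i)%:E <=
   mu [set x | exists2 i, (i \in s) && P i & open_edge i x])%E.
Proof.
move=> us sd; rewrite /filling_measure esum_esum; last first.
  by move=> i j _ _; rewrite mule_ge0// adde_ge0.
apply: esum_ge; exists [set` [seq i <- s | P i]].
  split; first exact: finite_seq.
  move=> [v w] /=; rewrite mem_filter => /andP[_ /sd[/= e _ _]].
  by split => //=; case: e.
rewrite -fsbig_seq ?filter_uniq// big_filter -sumEFin big_seq_cond [leRHS]big_seq_cond.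
apply: lee_sum => -[v w] /andP[si Pi]; have [/= e _ _] := sd _ si.
rewrite [X in (_ <= X * _)%E](edge_massE (v, w)).
(* The endpoints 0 and 1 drop out because a vertex lies on no open edge; the remaining interval
   still has full measure. *)
rewrite (_ : [set t | _] = `]0, 1[%classic); last first.
  apply/seteqP; split => t /=; rewrite in_itv/=; last first.
    move=> t01; split; first by case/andP: t01 => ? ?; rewrite !ltW.
    by exists (v, w); [rewrite si|split => //; exists t].
  move=> [t01 [[v' w'] /andP[/sd[/= e' _ _] _] [_ [t' t'01 /=]]]].
  case/andP: t01 => t0 t1 E.
  move: t0; rewrite le_eqVlt => /predU1P[t0|t0].
    by exfalso; rewrite -t0 ept0 in E; case: e => Vv *; exact: vpt_ept E.
  move: t1; rewrite le_eqVlt => /predU1P[t1|t1]; last by rewrite t0.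
  by exfalso; rewrite t1 ept1 in E; case: e => _ Vw *; exact: vpt_ept E.
by rewrite lebesgue_measure_itv/= lte_fin ltr01 oppr0 adde0 mule1.
Qed.

Lemma filling_measure0 : mu set0 = 0%E.
Proof.
rewrite /filling_measure esum1// => v _; rewrite esum1// => w _.
rewrite (_ : [set t | _] = set0) ?measure0 ?mule0//.
by rewrite -subset0 => t [].
Qed.

Lemma measurable_open_edge i : measurable (open_edge i : set (borel_pt alpha tau S)).
Proof. by apply: sub_sigma_algebra; exact: filling_open_edge. Qed.

Variables (p beta : R).
Hypothesis p1 : 1 <= p.
Hypothesis beta0 : 0 < beta.

Local Notation mub := (@filling_measure_beta R Z alpha tau S nu beta).

Lemma descending_height n i x : descending n i -> open_edge i x ->
  (i.2.2%:~R : R) <= height S x <= i.2.2%:~R + 1.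
Proof.
move=> [e h _] [_ [t /andP[t0 t1] ->]]; rewrite (height_ept _ e) h intrD.
by apply/andP; split; nra.
Qed.

Lemma filling_measure_beta0 : mub set0 = 0%E.
Proof. by apply: integral_set0_fun; exact: filling_measure0. Qed.

(** The density alpha^(-beta h) is at least its value at the upper end of the edge, of height
    [i.2.2 + 1]. *)
Lemma filling_measure_beta_open_edges n (s : seq (vertex * vertex)) (P : pred (vertex * vertex)) :
  uniq s -> (forall i, i \in s -> descending n i) ->
  ((\sum_(i <- s | P i) alpha `^ (- beta * (i.2.2%:~R + 1)) * edge_mass i)%:E <=
   mub [set x | exists2 i, (i \in s) && P i & open_edge i x])%E.
Proof.
move=> us sd; rewrite -big_filter /filling_measure_beta.
apply: (@integral_ge_step _ (borel_pt alpha tau S) R (vertex * vertex)%type mu open_edge).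
- exact: filling_measure0.
- exact: measurable_open_edge.
- exact: filter_uniq.
- move=> i j x; rewrite !mem_filter => /andP[_ /sd si] /andP[_ /sd sj].
  exact: open_edge_disjoint si sj.
- by move=> i; exact: powR_ge0.
- move=> Q; apply: (@filling_measure_open_edges n); first exact: filter_uniq.
  by move=> i; rewrite mem_filter => /andP[_ /sd].
- by move=> x _; rewrite lee_fin powR_ge0.
move=> i x; rewrite mem_filter => /andP[Pi si] ix; split.
  by exists i; rewrite ?si.
rewrite lee_fin ler_powR ?(ltW alpha1)// !mulNr lerN2 ler_wpM2l ?(ltW beta0)//.
by case/andP: (descending_height (sd _ si) ix).
Qed.

Variable u : @pt R Z -> R.

Local Notation g := (edge_gradient alpha tau S u).

(** [xget] may select either orientation of the edge containing [x], so [key] is proved for both.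
    The factor is the inverse of the bound alpha * alpha^(-k) on the rho-length, with k the lower
    level. *)
Lemma edge_gradient_ge n i x : descending n i -> open_edge i x ->
  `|u (vpt i.1) - u (vpt i.2)| * alpha `^ (i.2.2%:~R - 1) <= g x.
Proof.
case: i => v w [/= e h _] [/= _ [t t01 xE]].
have key v' w' : edge v' w' -> w.2 <= v'.2 ->
    `|u (vpt v') - u (vpt w')| * alpha `^ (w.2%:~R - 1) <=
    `|u (vpt v') - u (vpt w')| / rdist (vpt v') (vpt w').
  move=> e' hv'; have al := alpha_gt0 alpha1.
  rewrite ler_wpM2l// -[X in X <= _]invrK lef_pV2 ?posrE ?invr_gt0 ?powR_gt0 ?edge_rdist_gt0//.
  apply: le_trans (edge_rdist_le alpha1 htau hS e') _.
  rewrite -powRN opprB powRD; last by apply/implyP => _; rewrite gt_eqF.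
  rewrite powRr1 ?(ltW al)// ler_wpM2l ?(ltW al)// -mulrNz powR_intmul ?(ltW al)//.
  by rewrite scale_le// lerN2.
rewrite /edge_gradient; case: xgetP => [r _ [v' [w' [t' [e' t'01 xE' ->]]]]|].
  have t'c : 0 <= t' <= 1 by case/andP: t'01 => ? ?; rewrite !ltW.
  have [[E1 E2]|[E1 E2]] := ept_inj e e' t01 t'c (etrans (esym xE) xE').
    by rewrite E1 E2; apply: key => //; rewrite h lerDl.
  by rewrite distrC E1 E2; apply: key => //; exact: edge_sym.
by move=> /(_ (`|u (vpt v) - u (vpt w)| / rdist (vpt v) (vpt w)))[]; exists v, w, t.
Qed.

(** Up to constants, the integral of g^p over the edge: g^p contributes alpha^(p k) and the density
    alpha^(-beta k), whence the exponent p - beta, which is p theta. *)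
Definition edge_energy (i : vertex * vertex) : R :=
  alpha `^ ((p - beta) * i.2.2%:~R) * `|u (vpt i.1) - u (vpt i.2)| `^ p * edge_mass i.

(** The factor alpha^p comes from the bound on the edge length and alpha^beta from the height at the
    upper end of the edge. Finite sets of edges suffice, an [esum] being a supremum of finite
    sums. *)
Lemma edge_energy_le_filling n :
  (\esum_(i in descending n) (edge_energy i)%:E <=
   (alpha `^ (p + beta))%:E *
   \int[mub]_(x in (filling_ge alpha tau S n : set (borel_pt alpha tau S)))
     (`|g x| `^ p)%:E)%E.
Proof.
have al := alpha_gt0 alpha1; have p0 : 0 <= p by exact: le_trans p1.
apply: ge_ereal_sup => _ [A [fA Ad] <-].
rewrite fsbig_finite//=; set s : seq _ := fset_set A.
have sd i : i \in s -> descending n i by rewrite in_fset_set// => /set_mem/Ad.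
pose c (i : vertex * vertex) :=
  (`|u (vpt i.1) - u (vpt i.2)| * alpha `^ (i.2.2%:~R - 1)) `^ p.
pose m (i : vertex * vertex) := alpha `^ (- beta * (i.2.2%:~R + 1)) * edge_mass i.
have -> : (\sum_(i <- s) (edge_energy i)%:E =
    (alpha `^ (p + beta))%:E * (\sum_(i <- s) c i * m i)%R%:E)%E.
  rewrite sumEFin -EFinM mulr_sumr; congr EFin; apply: eq_bigr => i _.
  rewrite /edge_energy /c /m powRM ?powR_ge0//.
  rewrite (_ : (p - beta) * i.2.2%:~R =
    (p + beta) + ((i.2.2%:~R - 1) * p + - beta * (i.2.2%:~R + 1))); last ring.
  rewrite powRD; last by apply/implyP => _; rewrite gt_eqF.
  rewrite [alpha `^ ((_ - 1) * p + _)]powRD; last by apply/implyP => _; rewrite gt_eqF.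
  rewrite -[(alpha `^ _) `^ _]powRrM; ring.
rewrite lee_wpmul2l ?lee_fin ?powR_ge0//.
apply: (@integral_ge_step _ (borel_pt alpha tau S) R (vertex * vertex)%type mub open_edge).
- exact: filling_measure_beta0.
- exact: measurable_open_edge.
- exact: fset_uniq.
- by move=> i j x /sd si /sd sj; exact: open_edge_disjoint si sj.
- by move=> i; exact: powR_ge0.
- by move=> P; exact: filling_measure_beta_open_edges (fset_uniq _) sd.
- by move=> x _; rewrite lee_fin powR_ge0.
move=> i x /sd si ix; split; last first.
  have h := edge_gradient_ge si ix.
  rewrite lee_fin ge0_ler_powR// ?nnegrE// ?mulr_ge0 ?powR_ge0//.
  exact: le_trans h (ler_norm _).
split; first by case: (filling_open_edge i) => + _; exact.
(* The whole edge lies above its lower end, of level at least [n], so that the integral need not be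
   extended below height [n]. *)
have /andP[h _] := descending_height si ix; apply: le_trans h.
by case: si => _ _; rewrite ler_int.
Qed.

End filling_energy.

(** * The Besov kernel as a sum over the nets *)

Section net_kernel.
Context {R : realType} {Z : completeMetricType R}.
Variable nu : {outer_measure set Z -> \bar R}.
Variable Cnu : R.
Hypothesis hnu : metric_measure_space nu.
Hypothesis dnu : doubling nu Cnu.
Variables (alpha lam : R) (S : int -> set Z).
Hypothesis alpha1 : 1 < alpha.
Hypothesis lam2 : 2 <= lam.
Hypothesis hS : forall n : int, maximal_separated (alpha ^ (- n)) (S n).

Implicit Types (x y s : Z) (k m : int).

Let sc (k : int) : 0 < alpha ^ (- k). Proof. exact: scale_gt0. Qed.
Let lam0 : 0 < lam. Proof. exact: lt_le_trans lam2. Qed.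

Let lam1 : 1 <= lam. Proof. by apply: le_trans lam2; rewrite ler1n. Qed.

Lemma net_bounded (k : int) (x : Z) (M : R) : 0 <= M ->
  card_bounded (packing_number Cnu M) [set s | S k s /\ mdist x s <= M * alpha ^ (- k)].
Proof.
move=> M0; apply: (packing hnu dnu (x := x) (sc k) M0); last by move=> s [].
by move=> s s' [Ss _] [Ss' _]; exact: (hS k).1.
Qed.

Lemma countable_net (k : int) : countable (S k).
Proof.
have -> : S k = \bigcup_n [set s | S k s /\ mdist point s <= n%:R * alpha ^ (- k)].
  apply/seteqP; split=> [s Ss|s [n _ []]//].
  exists (Num.truncn (mdist point s / alpha ^ (- k))).+1 => //; split => //.
  by rewrite -ler_pdivrMr// ltW// truncnS_gt.
apply: bigcup_countable => // n _; apply: finite_set_countable.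
by apply: card_bounded_finite; exact: net_bounded.
Qed.

(** The dilation will be 3 tau, so that a ball of level [k] contains the vertex balls of the
    neighbours one level up. *)
Definition nball (k : int) (s : Z) : set Z := ball s (lam * alpha ^ (- k)).

Definition nvol (k : int) (s : Z) : R := vol nu s (lam * alpha ^ (- k)).

Lemma nball_r (k : int) : 0 < lam * alpha ^ (- k). Proof. by rewrite mulr_gt0. Qed.

Lemma nvol_gt0 k s : 0 < nvol k s.
Proof. by rewrite vol_gt0// nball_r. Qed.

Lemma nballE k s : nu (nball k s) = (nvol k s)%:E.
Proof. by rewrite /nball volE// nball_r. Qed.

Lemma measurable_nball k s : nu.-cara.-measurable (nball k s).
Proof. exact: measurable_mball. Qed.

Definition overlap := packing_number Cnu lam.

Lemma nball_overlap k x : card_bounded overlap [set s | S k s /\ nball k s x].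
Proof.
apply: card_bounded_sub (@net_bounded k x _ (ltW lam0)) => s [Ss] hs /=; split => //; move: hs.
by rewrite /nball mem_ball metric_sym => /ltW.
Qed.

Lemma esum_net_le (k : int) (x : Z) (c : \bar R) : (0 <= c)%E ->
  (\esum_(s in S k) ((\1_(nball k s) x)%:E * c) <= overlap%:R%:E * c)%E.
Proof.
move=> c0; have -> : (\esum_(s in S k) ((\1_(nball k s) x)%:E * c) =
    \esum_(s in S k `&` [set s | nball k s x]) c)%E.
  rewrite esum_mkcondr; apply: eq_esum => s _; rewrite indicE.
  rewrite (_ : (s \in _) = (x \in nball k s)); last first.
    by apply/idP/idP => /set_mem h; apply/mem_set.
  by case: ifP => _; rewrite ?mul1e ?mul0e.
move: c c0 => [c| |]//; rewrite ?lee_fin => c0.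
  by apply: esum_card_bounded => //; exact: nball_overlap.
(* Here [c] is infinite, and 0 * +oo = 0 would be too small a bound; but a zero overlap means that
   no ball contains [x]. *)
have [/eqP|N0] := posnP overlap; last first.
  by rewrite gt0_muley ?lte_fin ?ltr0n// leey.
rewrite -[_ == _]/(overlap == 0%N) => /eqP N0.
rewrite (_ : _ `&` _ = set0) ?esum_set0 ?N0 ?mul0e// -subset0 => s hs.
suff : (#|` [fset s]%fset| <= overlap)%N by rewrite cardfs1 N0.
by apply: (@nball_overlap k x) => t /=; rewrite inE => /eqP ->.
Qed.

Variable d : Z -> Z -> R.
Variables (K1 K2 : R).
Hypothesis K1gt0 : 0 < K1.
Hypothesis K2gt0 : 0 < K2.
Hypothesis d_ge : forall x y, mdist x y <= K1 * d x y.
Hypothesis d_le : forall x y, d x y <= K2 * mdist x y.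

Lemma d_gt0 x y : x <> y -> 0 < d x y.
Proof.
move=> /eqP; rewrite -mdist_gt0 => xy; rewrite -(pmulr_rgt0 _ K1gt0).
exact: lt_le_trans (d_ge x y).
Qed.

Lemma dball_vol x r : 0 < r ->
  vol nu x (r / K2) <= fine (nu (dball d x r)) <= vol nu x (K1 * r).
Proof.
move=> r0; have rK : 0 < r / K2 by rewrite divr_gt0.
have Kr : 0 < K1 * r by rewrite mulr_gt0.
have h1 : (nu (ball x (r / K2)) <= nu (dball d x r))%E.
  apply: le_outer_measure => y; rewrite mem_ball /dball/= => xy.
  by apply: le_lt_trans (d_le x y) _; rewrite mulrC -ltr_pdivlMr.
have h2 : (nu (dball d x r) <= nu (ball x (K1 * r)))%E.
  apply: le_outer_measure => y; rewrite mem_ball /dball/= => xy.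
  by apply: le_lt_trans (d_ge x y) _; rewrite ltr_pM2l.
rewrite volE// in h1; rewrite volE// in h2.
have fin : nu (dball d x r) \is a fin_num.
  by rewrite ge0_fin_numE// (le_lt_trans h2)// ltry.
rewrite -(fineK fin) lee_fin in h1; rewrite -(fineK fin) lee_fin in h2.
by rewrite h1 h2.
Qed.

Variable e : R.
Hypothesis e0 : 0 < e.

Definition kernel x y : R := (d x y `^ e)^-1 / fine (nu (dball d x (d x y))).

Definition weight (k : int) : R := alpha `^ (k%:~R * e).

Lemma weight_gt0 k : 0 < weight k.
Proof. by rewrite powR_gt0// alpha_gt0. Qed.

Lemma weightE k : weight k = ((alpha ^ (- k)) `^ e)^-1.
Proof.
have al := ltW (alpha_gt0 alpha1).
by rewrite -powR_intmul// -powRrM mulrNz mulNr powRN invrK.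
Qed.

Lemma dball_gt0 x y : x <> y -> 0 < fine (nu (dball d x (d x y))).
Proof.
move=> xy; have /andP[h _] := dball_vol x (d_gt0 xy).
by apply: lt_le_trans h; rewrite vol_gt0// divr_gt0// d_gt0.
Qed.

Lemma kernel_gt0 x y : x <> y -> 0 < kernel x y.
Proof. by move=> xy; rewrite divr_gt0 ?dball_gt0// invr_gt0 powR_gt0// d_gt0. Qed.

(** The power comes from alpha^(-m) <= K1 alpha d(x, y) at the scale m of the pair; the doubling
    factor compares the net ball with the ball of radius d(x, y) / K2 inside [dball]. *)
Definition kernel_ub_cst :=
  (K1 * alpha) `^ e * dbl Cnu ((1 + lam) * (K1 * K2 * alpha)).

Lemma kernel_ub_cst_gt0 : 0 < kernel_ub_cst.
Proof. by rewrite mulr_gt0 ?dbl_gt0// powR_gt0// mulr_gt0// alpha_gt0. Qed.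

Lemma kernel_ub x y : x <> y -> exists m s,
  [/\ S m s, nball m s x, nball m s y,
      mdist x y < alpha ^ (- m) & kernel x y <= kernel_ub_cst * weight m / nvol m s].
Proof.
move=> xy; have al := alpha_gt0 alpha1.
have t0 : 0 < mdist x y by rewrite mdist_gt0; exact/eqP.
have [m /andP[m1 m2]] := scale_floor alpha1 t0.
have [s Ss sx] := net alpha1 hS m x.
exists m, s; split => //.
- by rewrite /nball mem_ball (lt_le_trans sx)// ler_peMl ?(ltW (sc m)) ?lam1.
- rewrite /nball mem_ball (le_lt_trans (metric_triangle s x y))//.
  by apply: (lt_le_trans (ltrD sx m2)); have := ler_wpM2r (ltW (sc m)) lam2; lra.
have d0 := d_gt0 xy.
have dm : alpha ^ (- m) <= K1 * alpha * d x y.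
  rewrite (scaleS alpha1) [K1 * _]mulrC -mulrA ler_wpM2l ?(ltW al)//.
  exact: le_trans m1 (d_ge x y).
have h1 : (d x y `^ e)^-1 <= (K1 * alpha) `^ e * weight m.
  rewrite weightE -[X in X <= _]mul1r ler_pdivrMr ?powR_gt0// mulrAC ler_pdivlMr ?powR_gt0//.
  rewrite mul1r -powRM ?mulr_ge0 ?(ltW K1gt0) ?(ltW al) ?(ltW d0)//.
  by rewrite ge0_ler_powR ?nnegrE ?(ltW e0) ?(ltW (sc m)) ?mulr_ge0 ?(ltW K1gt0) ?(ltW al) ?(ltW d0).
have h2 : nvol m s <= dbl Cnu ((1 + lam) * (K1 * K2 * alpha)) * fine (nu (dball d x (d x y))).
  have /andP[h _] := dball_vol x d0.
  apply: (@le_trans _ _ (dbl Cnu ((1 + lam) * (K1 * K2 * alpha)) * vol nu x (d x y / K2))).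
    apply: (vol_le_dbl hnu dnu); [by rewrite divr_gt0|exact: nball_r|].
    have -> : (1 + lam) * (K1 * K2 * alpha) * (d x y / K2) = (1 + lam) * (K1 * alpha * d x y).
      by field; rewrite gt_eqF.
    apply: (@le_trans _ _ ((1 + lam) * alpha ^ (- m))).
      by rewrite mulrDl mul1r lerD2r metric_sym ltW.
    by rewrite ler_wpM2l ?addr_ge0 ?(ltW lam0).
  by rewrite ler_wpM2l ?(ltW (dbl_gt0 _ _)).
have F0 := dball_gt0 xy; have n0 := nvol_gt0 m s.
rewrite /kernel /kernel_ub_cst -[leRHS]mulrA [_ * dbl _ _ * _]mulrACA.
apply: ler_pM => //; [by rewrite invr_ge0 powR_ge0|by rewrite invr_ge0 ltW|].
by rewrite ler_pdivlMr// mulrC ler_pdivrMr.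
Qed.

Definition kernel_ratio : R := alpha `^ (- e).

Lemma kernel_ratio01 : 0 < kernel_ratio < 1.
Proof.
rewrite /kernel_ratio powR_gt0 ?alpha_gt0//= -(powRr0 alpha).
by rewrite /powR gt_eqF ?alpha_gt0// ltr_expR mul0r pmulr_llt0 ?oppr_lt0// ln_gt0.
Qed.

Lemma exprV_powR (j : nat) : ((alpha^-1) ^+ j) `^ e = kernel_ratio ^+ j.
Proof.
have al := ltW (alpha_gt0 alpha1).
rewrite -(powR_inv1 al) -[_ ^+ j]powR_mulrn ?powR_ge0// -2!powRrM.
by rewrite /kernel_ratio -[RHS]powR_mulrn ?powR_ge0// -[RHS]powRrM; congr (_ `^ _); ring.
Qed.

Definition kernel_lb_cst :=
  overlap%:R * (dbl Cnu (1 + 2 * (K1 * K2)) * (K2 * (4 * lam ^+ 2 * alpha)) `^ e) *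
    two_sided_sum kernel_ratio.

(** Let m be the scale of the pair. At coarser levels the weights decay geometrically, at much finer
    ones no ball contains both points, and each level has at most [overlap] balls containing [x].
    All levels are treated together through the decay [dec] in |m - k|. *)
Lemma kernel_lb x y : x <> y ->
  (\esum_(k in [set: int]) \esum_(s in S k)
     (weight k / nvol k s * (\1_(nball k s) x * \1_(nball k s) y))%:E
   <= (kernel_lb_cst * kernel x y)%:E)%E.
Proof.
move=> xy; have al := alpha_gt0 alpha1.
have t0 : 0 < mdist x y by rewrite mdist_gt0; exact/eqP.
have [m /andP[m1 m2]] := scale_floor alpha1 t0.
have d0 := d_gt0 xy; have F0 := dball_gt0 xy; have k0 := kernel_gt0 xy.
have [q0 q1] := andP kernel_ratio01.
rewrite /kernel_lb_cst; set D := dbl Cnu _; set B := K2 * (4 * lam ^+ 2 * alpha).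
have B0 : 0 < B by rewrite !mulr_gt0// exprn_gt0.
have D0 : 0 < D by exact: dbl_gt0.
pose c k := D * B `^ e * kernel_ratio ^+ `|(m - k)%R| * kernel x y.
have c0 k : 0 <= c k.
  apply: mulr_ge0 (ltW k0); apply: mulr_ge0 (exprn_ge0 _ (ltW q0)).
  exact: mulr_ge0 (ltW D0) (powR_ge0 _ _).
have dec k : mdist x y < 2 * (lam * alpha ^ (- k)) ->
    alpha ^ k * mdist x y <= 4 * lam ^+ 2 * alpha * (alpha^-1) ^+ `|(m - k)%R|.
  move=> kt; have L1 : 1 <= 4 * lam ^+ 2 * alpha.
    by have := exprn_ege1 2 lam1; have := alpha1; nra.
  have u0 := scale_gt0 alpha1 k.
  have u1 : alpha ^ k * mdist x y < 2 * lam.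
    have E : alpha ^ k * alpha ^ (- k) = 1 by rewrite -scaleD// addrN expr0z.
    rewrite -(ltr_pM2l u0) in kt; apply: lt_le_trans kt _.
    by rewrite (mulrCA _ 2) (mulrCA _ lam) E mulr1.
  have [km|mk] := leP k m.
    apply: (@le_trans _ _ ((alpha^-1) ^+ `|(m - k)%R|)); last first.
      by rewrite ler_peMl// exprn_ge0// invr_ge0 ltW.
    apply: (@le_trans _ _ (alpha ^ k * alpha ^ (- m))); first by rewrite ler_wpM2l// ltW.
    rewrite -scaleD// exprVn exprnN.
    by rewrite gez0_abs ?subr_ge0// opprB lexx.
  (* For k > m put u = alpha^k d(x, y) and v = alpha^(k - m - 1), so that v <= u < 2 lam. Then u <=
     u^2 / v turns the absence of very fine levels into a decay. *)
  have u2 : alpha ^ k * alpha ^ (- (m + 1)) <= alpha ^ k * mdist x y by rewrite ler_wpM2l// ltW.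
  set u := alpha ^ k * mdist x y in u1 u2 *; set w := alpha^-1 ^+ _.
  have vw : alpha ^ k * alpha ^ (- (m + 1)) * w * alpha = 1.
    rewrite /w exprVn exprnN -scaleD// -scaleD// -{2}[alpha]expr1z -scaleD//.
    by rewrite ltz0_abs ?subr_lt0// -[RHS](expr0z alpha); congr (alpha ^ _); ring.
  have w0 : 0 < w by rewrite exprn_gt0// invr_gt0.
  have v0 : 0 < alpha ^ k * alpha ^ (- (m + 1)) by rewrite mulr_gt0// scale_gt0.
  move: u1 u2 vw w0 v0 al; set v := alpha ^ k * _; move=> u1 u2 vw w0 v0 al.
  have uu : u * u <= 4 * lam ^+ 2 by nra.
  have wa : 0 < w * alpha by rewrite mulr_gt0.
  apply: (@le_trans _ _ (u * u * (w * alpha))); last first.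
    by rewrite [leRHS](_ : _ = 4 * lam ^+ 2 * (w * alpha)) ?ler_wpM2r ?(ltW wa)//; ring.
  rewrite -[X in X <= _]mulr1 -vw (_ : u * _ = u * v * (w * alpha)); last ring.
  have u0' : 0 < u by exact: lt_le_trans u2.
  by rewrite ler_wpM2r ?(ltW wa)// ler_wpM2l// ltW.
have term k s : S k s ->
    weight k / nvol k s * (\1_(nball k s) x * \1_(nball k s) y) <= \1_(nball k s) x * c k.
  move=> Ss; rewrite [in leRHS]indicE [X in X * (_ * _)]mulrC.
  rewrite !indicE; case: (asboolP (nball k s x)) => hx; last first.
    by rewrite memNset// !mul0r mulr0.
  rewrite [x \in _]mem_set// !mul1r.
  case: (asboolP (nball k s y)) => hy; last by rewrite memNset// mulr0.
  rewrite [y \in _]mem_set// mulr1.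
  have kt : mdist x y < 2 * (lam * alpha ^ (- k)).
    move: hx hy; rewrite /nball !mem_ball => hx hy.
    have := metric_triangle x s y; rewrite (metric_sym x s); lra.
  have n0 := nvol_gt0 k s.
  have h1 : (nvol k s)^-1 <= D / fine (nu (dball d x (d x y))).
    rewrite ler_pdivlMr// mulrC ler_pdivrMr//.
    have /andP[_ h] := dball_vol x d0; apply: le_trans h _.
    apply: (vol_le_dbl hnu dnu); [exact: nball_r|by rewrite mulr_gt0|].
    rewrite mulrDl mul1r lerD//; first by move: hx; rewrite /nball mem_ball => /ltW.
    apply: (@le_trans _ _ (K1 * (K2 * mdist x y))).
      by rewrite ler_wpM2l ?(ltW K1gt0).
    by rewrite [2 * _]mulrC -!mulrA !ler_wpM2l ?(ltW K1gt0) ?(ltW K2gt0) ?(ltW kt).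
  have h2 : weight k <= (d x y `^ e)^-1 * (B * (alpha^-1) ^+ `|(m - k)%R|) `^ e.
    rewrite mulrC ler_pdivlMr ?powR_gt0// /weight powRrM powR_intmul ?(ltW al)//.
    have uk := scale_gt0 alpha1 k.
    have h0 : 0 <= alpha ^ k * d x y by rewrite mulr_ge0 ?ltW.
    rewrite -powRM ?(ltW d0) ?(ltW uk)//; apply: ge0_ler_powR; rewrite ?nnegrE ?(ltW e0)//.
      by rewrite mulr_ge0 ?exprn_ge0 ?invr_ge0 ?ltW.
    apply: (@le_trans _ _ (alpha ^ k * (K2 * mdist x y))); first by rewrite ler_wpM2l ?(ltW uk) ?d_le.
    by rewrite mulrCA /B -mulrA ler_wpM2l ?(ltW K2gt0) ?dec.
  have h3 : (B * (alpha^-1) ^+ `|(m - k)%R|) `^ e = B `^ e * kernel_ratio ^+ `|(m - k)%R|.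
    rewrite powRM ?exprn_ge0 ?invr_ge0 ?(ltW al) ?(ltW B0)//; congr (_ * _).
    by rewrite exprV_powR.
  rewrite h3 in h2; rewrite /c /kernel (_ : D * _ * _ * _ =
    ((d x y `^ e)^-1 * (B `^ e * kernel_ratio ^+ `|(m - k)%R|)) *
      (D / fine (nu (dball d x (d x y))))); last ring.
  by rewrite [leLHS]mulrC; apply: ler_pM h2 h1; rewrite ?invr_ge0 ?(ltW n0) ?(ltW (weight_gt0 _)).
apply: (@le_trans _ _ (\esum_(k in [set: int]) (overlap%:R * c k)%:E)%E).
  apply: le_esum => k _; rewrite EFinM; apply: le_trans (esum_net_le _ _ _); last by rewrite lee_fin.
  by apply: le_esum => s Ss; rewrite -EFinM lee_fin; exact: term.
rewrite (_ : (fun k => _) = (fun k => (overlap%:R * (D * B `^ e) * kernel x y)%:E *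
    (kernel_ratio ^+ `|(m - k)%R|)%:E)%E); last first.
  by apply/funext => k; rewrite -EFinM /c; congr EFin; ring.
rewrite esumZl; last 2 first.
- exact: mulr_ge0 (mulr_ge0 (ler0n _ _) (mulr_ge0 (ltW D0) (powR_ge0 _ _))) (ltW k0).
- by move=> k _; rewrite lee_fin exprn_ge0// ltW.
have := esum_geometric_int kernel_ratio01 m.
have C0 : 0 <= overlap%:R * (D * B `^ e) * kernel x y.
  exact: mulr_ge0 (mulr_ge0 (ler0n _ _) (mulr_ge0 (ltW D0) (powR_ge0 _ _))) (ltW k0).
move=> /(lee_wpmul2l (x := (overlap%:R * (D * B `^ e) * kernel x y)%:E)).
rewrite lee_fin => /(_ C0) /le_trans; apply.
by rewrite -EFinM lee_fin mulrAC.
Qed.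

End net_kernel.

(* Used with [M] the p-th root of the mean of [t `^ p], in place of Jensen's
   inequality. *)
Lemma le_powR_split (R : realType) (p t M : R) : 1 <= p -> 0 <= t -> 0 < M ->
  t <= M + t `^ p * M `^ (1 - p).
Proof.
move=> p1 t0 M0; have [tM|Mt] := leP t M.
  by rewrite (le_trans tM)// lerDl mulr_ge0 ?powR_ge0.
have t0' : 0 < t by exact: lt_trans Mt.
apply: (@le_trans _ _ (t `^ p * M `^ (1 - p))); last by rewrite lerDr ltW.
rewrite -[leLHS](powRr1 t0) -{1}(subrKC p 1) powRD; last by apply/implyP => _; rewrite gt_eqF.
rewrite ler_wpM2l ?powR_ge0// -opprB !powRN lef_pV2 ?posrE ?powR_gt0//.
by rewrite ge0_ler_powR ?nnegrE ?subr_ge0 ?(ltW M0) ?(ltW Mt).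
Qed.

Lemma powRD_le (R : realType) (p a b : R) : 0 <= p -> 0 <= a -> 0 <= b ->
  (a + b) `^ p <= 2 `^ p * (a `^ p + b `^ p).
Proof.
move=> p0; wlog ab : a b / a <= b.
  move=> h a0 b0; case: (leP a b) => [/h|/ltW/h]; first exact.
  by rewrite addrC [b `^ p + _]addrC; exact.
move=> a0 b0; apply: (@le_trans _ _ ((2 * b) `^ p)).
  by apply: ge0_ler_powR; rewrite ?nnegrE ?addr_ge0 ?mulr_ge0//; lra.
by rewrite powRM// ler_wpM2l ?powR_ge0// lerDr powR_ge0.
Qed.

(** * Means and oscillations over a set of finite measure *)

Section mean_power.
Context d (T : measurableType d) (R : realType) (mu : {measure set T -> \bar R}).
Variables (A : set T) (f : T -> R) (p : R).
Hypothesis mA : measurable A.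
Hypothesis A0 : (0 < mu A)%E.
Hypothesis Aoo : (mu A < +oo)%E.
Hypothesis mf : measurable_fun setT f.
Hypothesis p1 : 1 <= p.

Let muA := fine (mu A).

Let muAE : mu A = muA%:E.
Proof. by rewrite fineK// ge0_fin_numE// ltW. Qed.

Let muA0 : 0 < muA.
Proof. by rewrite -lte_fin -muAE. Qed.

Lemma measurable_abs_powR (c : R) :
  measurable_fun setT (fun x => (`|f x - c| `^ p)%:E).
Proof.
apply/measurable_EFinP; apply: (measurableT_comp (measurable_powR _)).
by apply: measurableT_comp => //; exact: measurable_funB.
Qed.

Lemma integrable_cst_finite (c : R) : mu.-integrable A (EFin \o cst c).
Proof.
apply/integrableP; split; first exact/measurable_EFinP.
by rewrite (eq_integral (cst `|c|%:E))// integral_cst// muAE -EFinM ltry.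
Qed.

Lemma integrable_Lp : (\int[mu]_(x in A) (`|f x| `^ p)%:E < +oo)%E ->
  mu.-integrable A (EFin \o f).
Proof.
move=> foo.
have mfA : measurable_fun A (EFin \o f) by apply/measurable_EFinP; exact: measurable_funTS.
apply/integrableP; split => //.
apply: (@le_lt_trans _ _ (\int[mu]_(x in A) (1 + (`|f x| `^ p)%:E))%E).
  apply: ge0_le_integral => //.
  - by apply: measurableT_comp.
  - by apply: emeasurable_funD => //; apply/measurable_EFinP; apply: measurable_funTS;
      apply: (measurableT_comp (measurable_powR _)); exact: measurableT_comp.
  move=> x _ /=; rewrite -EFinD lee_fin.
  by have := le_powR_split p1 (normr_ge0 (f x)) ltr01; rewrite powR1 mulr1.
rewrite ge0_integralD//; last first.
  by apply/measurable_EFinP; apply: measurable_funTS;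
      apply: (measurableT_comp (measurable_powR _)); exact: measurableT_comp.
by rewrite lte_add_pinfty// (eq_integral (cst 1%E))// integral_cst// mul1e.
Qed.

Lemma mean_powR_le (c : R) : mu.-integrable A (EFin \o f) ->
  ((`|(\int[mu]_(x in A) f x) / muA - c| `^ p)%:E <=
    (2 `^ p / muA)%:E * \int[mu]_(x in A) (`|f x - c| `^ p)%:E)%E.
Proof.
move=> intf; have p0 : 0 < p by exact: lt_le_trans p1.
have intc := integrable_cst_finite c.
have intd : mu.-integrable A (EFin \o (fun x => f x - c)).
  exact: (integrableB mA intf intc).
have -> : (\int[mu]_(x in A) f x) / muA - c = (\int[mu]_(x in A) (f x - c)) / muA.
  by rewrite RintegralB// Rintegral_cst// mulrBl mulfK// gt_eqF.
set I := (\int[mu]_(x in A) (`|f x - c| `^ p)%:E)%E.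
have I0 : (0 <= I)%E by apply: integral_ge0 => x _; rewrite lee_fin powR_ge0.
have c0 : 0 < 2 `^ p / muA by rewrite divr_gt0// powR_gt0.
have [Ioo|] := ltP I +oo%E; last first.
  by rewrite leye_eq => /eqP ->; rewrite gt0_muley// leey.
have IE : I = (fine I)%:E by rewrite fineK// ge0_fin_numE.
have iI : mu.-integrable A (EFin \o (fun x => `|f x - c| `^ p)).
  apply/integrableP; split.
    by apply: measurable_funTS; exact: measurable_abs_powR.
  by under eq_integral do rewrite /= ger0_norm ?powR_ge0//.
(* One inequality for each threshold [M]; with J the mean of |f - c|^p, the choice M = J^(1/p) below
   makes both terms equal to M, whence the factor 2^p. *)
have bM M : 0 < M -> `|(\int[mu]_(x in A) (f x - c)) / muA| <=
    M + M `^ (1 - p) * (fine I / muA).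
  move=> M0; rewrite normrM [X in _ * X]ger0_norm ?invr_ge0 ?(ltW muA0)//.
  rewrite mulrA -[X in X + _ / _](mulfK (lt0r_neq0 muA0)) -mulrDl ler_pM2r ?invr_gt0//.
  apply: le_trans (le_normr_Rintegral mA intd) _.
  have -> : M * muA + M `^ (1 - p) * fine I =
      \int[mu]_(x in A) (M + M `^ (1 - p) * `|f x - c| `^ p).
    rewrite RintegralD//.
    - by rewrite Rintegral_cst// RintegralZl.
    - exact: integrable_cst_finite.
    exact: (integrableZl mA (M `^ (1 - p)) iI).
  apply: le_Rintegral => //.
  - exact: (integrable_abse intd).
  - exact: (integrableD mA (integrable_cst_finite M) (integrableZl mA (M `^ (1 - p)) iI)).
  by move=> x _; rewrite mulrC; exact: le_powR_split.
set b := `|_| in bM *; have b0 : 0 <= b by exact: normr_ge0.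
rewrite IE -EFinM lee_fin -mulrA [_^-1 * _]mulrC.
set J := fine I / muA in bM *.
have J0 : 0 <= J by rewrite divr_ge0 ?fine_ge0// ltW.
(* When J = 0 the optimal threshold is not positive, and [M] is sent to 0 instead. *)
move: J0; rewrite le_eqVlt => /predU1P[J0|J0].
  have -> : b = 0.
    apply/eqP; rewrite eq_le b0 andbT; apply/ler_addgt0Pr => M M0.
    by have := bM M M0; rewrite -J0 mulr0 addr0 add0r.
  by rewrite powR0 ?gt_eqF// mulr_ge0 ?powR_ge0// -J0.
pose M := J `^ p^-1; have M0 : 0 < M by rewrite powR_gt0.
have JE : J = M `^ p by rewrite -powRrM mulVf ?gt_eqF// powRr1// ltW.
have := bM M M0; rewrite {1}JE -powRD; last by apply/implyP => _; rewrite gt_eqF.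
rewrite subrK powRr1 ?(ltW M0)// => bMM.
rewrite JE -powRM ?(ltW M0)//; apply: ge0_ler_powR; rewrite ?nnegrE ?(ltW p0) ?mulr_ge0 ?(ltW M0)//.
lra.
Qed.

(** The restriction of [mu] to [A] is finite, so the measurability part of Tonelli's theorem applies
    to it. *)
Lemma measurable_oscillation :
  measurable_fun setT (fun x => \int[mu]_(y in A) (`|f y - f x| `^ p)%:E)%E.
Proof.
pose m2 := mfrestr mA Aoo.
pose g (xy : T * T) : \bar R := (\1_A xy.2 * `|f xy.2 - f xy.1| `^ p)%:E.
have mg : measurable_fun setT g.
  apply/measurable_EFinP; apply: measurable_funM.
    by apply: measurableT_comp => //; exact: measurable_indic.
  apply: (measurableT_comp (measurable_powR _)); apply: measurableT_comp => //.
  by apply: measurable_funB; apply: measurableT_comp.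
have g0 xy : (0 <= g xy)%E by rewrite lee_fin mulr_ge0// powR_ge0.
have := @measurable_fun_fubini_tonelli_F _ _ T T R m2 g mg g0.
apply: eq_measurable_fun => x _; rewrite /fubini_F /=.
transitivity (\int[m2]_(y in A) (`|f y - f x| `^ p)%:E)%E.
  rewrite [RHS]integral_mkcond; apply: eq_integral => y _.
  rewrite /g /= patchE indicE; case: ifP => _; rewrite ?mul1r ?mul0r//.
by apply: eq_measure_integral => B mB BA; rewrite /= /mfrestr /mrestr (setIidl BA).
Qed.

End mean_power.

Lemma integral_indicl d (T : measurableType d) (R : realType)
    (mu : {measure set T -> \bar R}) (D : set T) (g : T -> \bar R) :
  (\int[mu]_x ((\1_D x)%:E * g x) = \int[mu]_(x in D) g x)%E.
Proof.
rewrite [RHS]integral_mkcond; apply: eq_integral => x _.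
by rewrite patchE indicE; case: ifP => _; rewrite ?mul1e ?mul0e.
Qed.

(** * Energies carried by the net balls *)

Section net_energy.
Context {R : realType} {Z : completeMetricType R}.
Variable nu : {outer_measure set Z -> \bar R}.
Variable Cnu : R.
Hypothesis hnu : metric_measure_space nu.
Hypothesis dnu : doubling nu Cnu.
Variables (alpha lam : R) (S : int -> set Z).
Hypothesis alpha1 : 1 < alpha.
Hypothesis lam2 : 2 <= lam.
Hypothesis hS : forall n : int, maximal_separated (alpha ^ (- n)) (S n).

Local Notation nuc := (nu : {measure set (caratheodory_type nu) -> \bar R}).
Local Notation T := (caratheodory_type nu).
Local Notation D := (nball alpha lam).
Local Notation n := (nvol nu alpha lam).
Local Notation N := (overlap Cnu lam).
Local Notation "\nsum_ ( k , s ) F" := (\esum_(k in [set: int]) \esum_(s in S k) F)%E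
  (at level 36, F at level 36, k, s at level 50).

Let mD k s : measurable (D k s : set T).
Proof. exact: measurable_nball. Qed.

Let n0 k s : 0 < n k s. Proof. exact: nvol_gt0. Qed.

Let cS k : countable (S k).
Proof. exact: (countable_net hnu dnu alpha1 hS). Qed.

Let nuD k s : nuc (D k s) = (n k s)%:E. Proof. exact: nballE. Qed.

Let cint : countable [set: int]. Proof. exact: countableP. Qed.

Section nsum.
Variable F : int -> Z -> T -> \bar R.
Hypothesis F0 : forall k s x, (0 <= F k s x)%E.
Hypothesis mF : forall k s, measurable_fun setT (F k s).

Lemma measurable_nsum : measurable_fun setT (fun x => \nsum_(k, s) F k s x).
Proof.
apply: measurable_esum => //; first by move=> k x _; apply: esum_ge0 => s _.
by move=> k _; exact: measurable_esum.
Qed.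

Lemma integral_nsum :
  (\int[nuc]_x (\nsum_(k, s) F k s x) = \nsum_(k, s) \int[nuc]_x F k s x)%E.
Proof.
rewrite integral_esum//; last 2 first.
- by move=> k x _; apply: esum_ge0 => s _.
- by move=> k _; exact: measurable_esum.
by apply: eq_esum => k _; rewrite integral_esum.
Qed.

End nsum.

Section smoothing.
Variable A : int -> T -> \bar R.
Hypothesis A0 : forall k x, (0 <= A k x)%E.
Hypothesis mA : forall k, measurable_fun setT (A k).

(** With [A] the family of weighted jumps, this majorizes the Besov integrand of the error T_n f - f
    up to a constant. As a countable sum over balls it is measurable in each variable and integrates
    term by term. *)
Definition smoothing_kernel (y x : T) : \bar R :=
  \nsum_(k, s) ((\1_(D k s) y)%:E * ((\1_(D k s) x)%:E * ((n k s)^-1%:E * (A k x + A k y))))%E.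

Let mterm k s y : measurable_fun setT
  (fun x : T => (\1_(D k s) x)%:E * ((n k s)^-1%:E * (A k x + A k y)))%E.
Proof.
apply: emeasurable_funM.
  by apply/measurable_EFinP; exact: measurable_indic.
by apply: measurable_funeM; apply: emeasurable_funD.
Qed.

Let term0 k s y x : (0 <= (\1_(D k s) x)%:E * ((n k s)^-1%:E * (A k x + A k y)))%E.
Proof.
by rewrite mule_ge0 ?lee_fin// mule_ge0 ?lee_fin ?invr_ge0 ?(ltW (n0 _ _))// adde_ge0.
Qed.

Lemma smoothing_kernel_ge0 y x : (0 <= smoothing_kernel y x)%E.
Proof.
by apply: esum_ge0 => k _; apply: esum_ge0 => s _; rewrite mule_ge0 ?lee_fin.
Qed.

Lemma measurable_smoothing_kernel y : measurable_fun setT (smoothing_kernel y).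
Proof.
apply: measurable_nsum => [k s x|k s]; first by rewrite mule_ge0 ?lee_fin.
by apply: measurable_funeM; exact: mterm.
Qed.

Lemma smoothing_kernel_ge k s y x : S k s -> D k s x -> D k s y ->
  ((n k s)^-1%:E * (A k x + A k y) <= smoothing_kernel y x)%E.
Proof.
move=> Ss Dx Dy; apply: esum_ge; exists [set k]; first by split.
rewrite fsbig_set1; apply: esum_ge; exists [set s]; first by split => // _ ->.
by rewrite fsbig_set1 !indicE !mem_set// !mul1e.
Qed.

Lemma integral_smoothing_kernel y :
  (\int[nuc]_x smoothing_kernel y x = \nsum_(k, s)
    ((\1_(D k s) y)%:E * ((n k s)^-1%:E * (\int[nuc]_(x in D k s) A k x) + A k y)))%E.
Proof.
rewrite /smoothing_kernel integral_nsum//.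
- apply: eq_esum => k _; apply: eq_esum => s _.
  rewrite ge0_integralZl ?lee_fin//; congr (_ * _)%E.
  rewrite integral_indicl ge0_integralZl//; last 3 first.
  + by apply: emeasurable_funD => //; exact: measurable_funTS.
  + by move=> x _; rewrite adde_ge0.
  + by rewrite lee_fin invr_ge0 ltW.
  rewrite ge0_integralD//; last exact: measurable_funTS.
  have -> : (\int[nuc]_(x in D k s) A k y = A k y * (n k s)%:E)%E.
    by rewrite -nuD; exact: integral_cst.
  rewrite ge0_muleDr//; last 2 first.
  + exact: integral_ge0.
  + by rewrite mule_ge0// lee_fin ltW.
  by rewrite muleCA -EFinM mulVf ?mule1// gt_eqF.
- by move=> k s x; rewrite mule_ge0 ?lee_fin.
- by move=> k s; apply: measurable_funeM; exact: mterm.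
Qed.

Lemma measurable_integral_smoothing_kernel :
  measurable_fun setT (fun y : T => \int[nuc]_x smoothing_kernel y x)%E.
Proof.
have I0 k s : (0 <= \int[nuc]_(x in D k s) A k x)%E by apply: integral_ge0.
have : measurable_fun setT (fun y : T => \nsum_(k, s)
    ((\1_(D k s) y)%:E * ((n k s)^-1%:E * (\int[nuc]_(x in D k s) A k x) + A k y)))%E.
  apply: measurable_nsum => [k s y|k s].
    rewrite mule_ge0 ?lee_fin// adde_ge0// mule_ge0//.
    by rewrite lee_fin invr_ge0 ltW.
  apply: emeasurable_funM.
    by apply/measurable_EFinP; exact: measurable_indic.
  by apply: emeasurable_funD => //; exact: measurable_cst.
by apply: eq_measurable_fun => y _; rewrite integral_smoothing_kernel.
Qed.

(** After integration in both variables, [A k x] and [A k y] each leave the integral of [A k] over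
    the ball, whence the 2; summing over the balls of a level costs the overlap. *)
Lemma integral2_smoothing_kernel :
  (\int[nuc]_y \int[nuc]_x smoothing_kernel y x <=
   (2 * N%:R)%:E * \esum_(k in [set: int]) \int[nuc]_x A k x)%E.
Proof.
under eq_integral do rewrite integral_smoothing_kernel.
have I0 k s : (0 <= \int[nuc]_(x in D k s) A k x)%E by apply: integral_ge0.
rewrite integral_nsum; last 2 first.
- move=> k s y; rewrite mule_ge0 ?lee_fin// adde_ge0// mule_ge0//.
  by rewrite lee_fin invr_ge0 ltW.
- move=> k s; apply: emeasurable_funM.
    by apply/measurable_EFinP; exact: measurable_indic.
  by apply: emeasurable_funD => //; exact: measurable_cst.
have -> : (\nsum_(k, s) \int[nuc]_y ((\1_(D k s) y)%:E *
      ((n k s)^-1%:E * (\int[nuc]_(x in D k s) A k x) + A k y)) =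
    \nsum_(k, s) (2%:E * \int[nuc]_x ((\1_(D k s) x)%:E * A k x)))%E.
  apply: eq_esum => k _; apply: eq_esum => s _; rewrite !integral_indicl.
  have J0 : (0 <= (n k s)^-1%:E * \int[nuc]_(x in D k s) A k x)%E.
    by rewrite mule_ge0// lee_fin invr_ge0 ltW.
  rewrite ge0_integralD//; last exact: measurable_funTS.
  have -> : (\int[nuc]_(y in D k s) ((n k s)^-1%:E * \int[nuc]_(x in D k s) A k x) =
     ((n k s)^-1%:E * \int[nuc]_(x in D k s) A k x) * (n k s)%:E)%E.
    by rewrite -nuD; exact: integral_cst.
  rewrite muleAC -EFinM mulVf ?mul1e ?gt_eqF//.
  by rewrite -[in LHS](mul1e (integral _ _ _)) -ge0_muleDl ?lee_fin// -EFinD.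
have IA0 k : (0 <= \int[nuc]_x A k x)%E by exact: integral_ge0.
have NA0 k : (0 <= N%:R%:E * \int[nuc]_x A k x)%E by rewrite mule_ge0 ?lee_fin.
rewrite EFinM -muleA -!esumZl//.
apply: le_esum => k _; rewrite esumZl//; last first.
  by move=> s _; apply: integral_ge0 => x _; rewrite mule_ge0 ?lee_fin.
rewrite lee_wpmul2l ?lee_fin// -integral_esum//; last 2 first.
- by move=> s x _; rewrite mule_ge0 ?lee_fin.
- move=> s _; apply: emeasurable_funM => //.
  by apply/measurable_EFinP; exact: measurable_indic.
rewrite -ge0_integralZl ?lee_fin ?ler0n//; apply: le_lower_integral => x _.
  by apply: esum_ge0 => s _; rewrite mule_ge0 ?lee_fin.
exact: (esum_net_le hnu dnu alpha1 lam2 hS).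
Qed.

End smoothing.

Lemma nsumZl (F : int -> Z -> \bar R) (c : R) : 0 <= c ->
  (forall k s, 0 <= F k s)%E ->
  (\nsum_(k, s) (c%:E * F k s) = c%:E * \nsum_(k, s) F k s)%E.
Proof.
move=> c0 F0; rewrite -esumZl//; last by move=> k _; exact: esum_ge0.
by apply: eq_esum => k _; rewrite esumZl.
Qed.

Section oscillation.
Variable d : Z -> Z -> R.
Variables (K1 K2 e : R).
Hypothesis K1gt0 : 0 < K1.
Hypothesis K2gt0 : 0 < K2.
Hypothesis d_ge : forall x y, mdist x y <= K1 * d x y.
Hypothesis d_le : forall x y, d x y <= K2 * mdist x y.
Hypothesis e0 : 0 < e.
Variable p : R.
Hypothesis p1 : 1 <= p.
Variable f : T -> R.
Hypothesis mf : measurable_fun setT f.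

Local Notation w := (weight alpha e).

Definition oscillation k s (x : T) : \bar R :=
  (\int[nuc]_(y in D k s) (`|f y - f x| `^ p)%:E)%E.

Lemma oscillation_ge0 k s x : (0 <= oscillation k s x)%E.
Proof. by apply: integral_ge0 => y _; rewrite lee_fin powR_ge0. Qed.

Lemma measurable_oscillation_net k s : measurable_fun setT (oscillation k s).
Proof.
by apply: measurable_oscillation => //; rewrite nuD ?ltry ?lte_fin.
Qed.

Definition level_energy (k : int) : \bar R :=
  (\esum_(s in S k) ((w k / n k s)%:E * \int[nuc]_(x in D k s) oscillation k s x))%E.

Let wn0 k s : 0 <= w k / n k s.
Proof. by rewrite divr_ge0 ?powR_ge0// ltW. Qed.

Lemma level_energy_ge0 k : (0 <= level_energy k)%E.
Proof.
apply: esum_ge0 => s _; rewrite mule_ge0 ?lee_fin//.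
by apply: integral_ge0 => x _; exact: oscillation_ge0.
Qed.

Definition besov_integral (u : T -> R) : \bar R :=
  (\int[nuc]_y \int[nuc]_x
      (`|u x - u y| `^ p / d x y `^ e / fine (nu (dball d x (d x y))))%:E)%E.

Lemma besov_integrandE (u : T -> R) (x y : T) :
  `|u x - u y| `^ p / d x y `^ e / fine (nu (dball d x (d x y))) =
  `|u x - u y| `^ p * kernel nu d e x y.
Proof. by rewrite /kernel mulrA. Qed.

(** The summand 1 makes the constant invertible. *)
Definition energy_cst := kernel_lb_cst Cnu alpha lam K1 K2 e + 1.

Lemma kernel_lb_cst_ge0 : 0 <= kernel_lb_cst Cnu alpha lam K1 K2 e.
Proof.
rewrite mulr_ge0 ?two_sided_sum_ge0 ?kernel_ratio01//.
by rewrite mulr_ge0// mulr_ge0 ?powR_ge0// ltW// dbl_gt0.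
Qed.

Lemma energy_cst_gt0 : 0 < energy_cst.
Proof. by rewrite ltr_wpDl ?kernel_lb_cst_ge0. Qed.

(** A measurable substitute for the Besov integrand of [f]: bounded by it up to a constant through
    [kernel_lb], and bounding it through [kernel_ub]. *)
Definition oscillation_kernel (y x : T) : \bar R := (\nsum_(k, s)
  ((\1_(D k s) y)%:E * ((\1_(D k s) x)%:E *
     ((w k / n k s)%:E * (`|f x - f y| `^ p)%:E))))%E.

Let g (y x : T) : \bar R := (`|f x - f y| `^ p)%:E.

Let g0 y x : (0 <= g y x)%E. Proof. by rewrite lee_fin powR_ge0. Qed.

Let mg y : measurable_fun setT (g y).
Proof. exact: measurable_abs_powR. Qed.

Let t0 k s y x : (0 <= (\1_(D k s) x)%:E * ((w k / n k s)%:E * g y x))%E.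
Proof.
apply: mule_ge0; first by rewrite lee_fin.
by apply: mule_ge0 => //; rewrite lee_fin.
Qed.

Let tt0 k s y x :
  (0 <= (\1_(D k s) y)%:E * ((\1_(D k s) x)%:E * ((w k / n k s)%:E * g y x)))%E.
Proof. by apply: mule_ge0 => //; rewrite lee_fin. Qed.

Let mt k s y : measurable_fun setT
  (fun x : T => (\1_(D k s) x)%:E * ((w k / n k s)%:E * g y x))%E.
Proof.
apply: emeasurable_funM; last by apply: measurable_funeM; exact: mg.
by apply/measurable_EFinP; exact: measurable_indic.
Qed.

Lemma oscillation_kernel_ge0 y x : (0 <= oscillation_kernel y x)%E.
Proof. by apply: esum_ge0 => k _; apply: esum_ge0 => s _; exact: tt0. Qed.

Lemma measurable_oscillation_kernel y : measurable_fun setT (oscillation_kernel y).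
Proof.
apply: measurable_nsum => [k s x|k s]; first exact: tt0.
by apply: measurable_funeM; exact: mt.
Qed.

Lemma oscillation_kernel_ge k s y x : S k s -> D k s x -> D k s y ->
  ((w k / n k s)%:E * (`|f x - f y| `^ p)%:E <= oscillation_kernel y x)%E.
Proof.
move=> Ss Dx Dy; apply: esum_ge; exists [set k]; first by split.
rewrite fsbig_set1; apply: esum_ge; exists [set s]; first by split => // _ ->.
by rewrite fsbig_set1 !indicE !mem_set// !mul1e.
Qed.

Let intG y : (\int[nuc]_x oscillation_kernel y x =
  \nsum_(k, s) ((\1_(D k s) y)%:E * ((w k / n k s)%:E * oscillation k s y)))%E.
Proof.
rewrite integral_nsum; last 2 first.
- by move=> k s x; exact: tt0.
- by move=> k s; apply: measurable_funeM; exact: mt.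
apply: eq_esum => k _; apply: eq_esum => s _.
rewrite ge0_integralZl ?lee_fin//; last 2 first.
- exact: mt.
- by move=> x _; exact: t0.
congr (_ * _)%E; rewrite integral_indicl ge0_integralZl ?lee_fin//.
by apply: measurable_funTS; exact: mg.
Qed.

Let u0 k s y : (0 <= (\1_(D k s) y)%:E * ((w k / n k s)%:E * oscillation k s y))%E.
Proof. by rewrite mule_ge0 ?lee_fin// mule_ge0 ?lee_fin// oscillation_ge0. Qed.

Let mu' k s : measurable_fun setT (fun y : T =>
  (\1_(D k s) y)%:E * ((w k / n k s)%:E * oscillation k s y))%E.
Proof.
apply: emeasurable_funM; last by apply: measurable_funeM; exact: measurable_oscillation_net.
by apply/measurable_EFinP; exact: measurable_indic.
Qed.

Lemma measurable_integral_oscillation_kernel :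
  measurable_fun setT (fun y : T => \int[nuc]_x oscillation_kernel y x)%E.
Proof.
have : measurable_fun setT (fun y : T =>
  \nsum_(k, s) ((\1_(D k s) y)%:E * ((w k / n k s)%:E * oscillation k s y)))%E.
  exact: measurable_nsum.
by apply: eq_measurable_fun => y _; rewrite intG.
Qed.

Lemma integral2_oscillation_kernel :
  (\int[nuc]_y \int[nuc]_x oscillation_kernel y x =
   \esum_(k in [set: int]) level_energy k)%E.
Proof.
under [LHS]eq_integral do rewrite intG.
rewrite integral_nsum//; apply: eq_esum => k _; apply: eq_esum => s _.
rewrite integral_indicl ge0_integralZl ?lee_fin//.
  by apply: measurable_funTS; exact: measurable_oscillation_net.
by move=> x _; exact: oscillation_ge0.
Qed.

Lemma level_energy_le :
  (\esum_(k in [set: int]) level_energy k <= energy_cst%:E * besov_integral f)%E.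
Proof.
rewrite -integral2_oscillation_kernel.
have C0 := energy_cst_gt0; set C := energy_cst in C0 *.
have C0' : 0 <= C^-1 by rewrite invr_ge0 ltW.
(* The constant is moved to the side of the measurable kernel, where it can be taken under the
   integrals; the Besov side only enters as a lower integral. *)
rewrite -[leLHS]mul1e -(mulfV (lt0r_neq0 C0)) EFinM -muleA lee_wpmul2l ?lee_fin ?(ltW C0)//.
have G0 := oscillation_kernel_ge0.
rewrite -ge0_integralZl ?lee_fin//; last 2 first.
- exact: measurable_integral_oscillation_kernel.
- by move=> y _; exact: integral_ge0.
apply: le_lower_integral => y _.
  by rewrite mule_ge0 ?lee_fin//; exact: integral_ge0.
rewrite -ge0_integralZl ?lee_fin//; last exact: measurable_oscillation_kernel.
apply: le_lower_integral => x _; first by rewrite mule_ge0 ?lee_fin.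
rewrite besov_integrandE.
have -> : oscillation_kernel y x = (g y x * \nsum_(k, s)
    (w k / n k s * (\1_(D k s) x * \1_(D k s) y))%:E)%E.
  rewrite -nsumZl ?powR_ge0//; last first.
    by move=> k s; rewrite lee_fin mulr_ge0// mulr_ge0.
  apply: eq_esum => k _; apply: eq_esum => s _.
  by rewrite /g -!EFinM; congr EFin; ring.
have [xy|xy] := pselect (x = y).
  rewrite /g xy subrr normr0 powR0 ?mul0e ?mule0 ?mul0r//.
  by rewrite gt_eqF// (lt_le_trans _ p1).
have k0 := kernel_gt0 hnu K1gt0 K2gt0 d_ge d_le e xy.
apply: (@le_trans _ _ (C^-1%:E * (g y x * (C * kernel nu d e x y)%:E)))%E.
  rewrite lee_wpmul2l ?lee_fin// lee_wpmul2l//.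
  apply: le_trans (kernel_lb hnu dnu alpha1 lam2 hS K1gt0 K2gt0 d_ge d_le e0 xy) _.
  by rewrite lee_fin ler_wpM2r ?(ltW k0)// lerDl.
rewrite /g -!EFinM lee_fin le_eqVlt; apply/orP; left; apply/eqP.
by field; rewrite gt_eqF.
Qed.

End oscillation.

End net_energy.

(** * Traces and their increments *)

Section trace.
Context {R : realType} {Z : completeMetricType R}.
Variable nu : {outer_measure set Z -> \bar R}.
Variable Cnu : R.
Hypothesis hnu : metric_measure_space nu.
Hypothesis dnu : doubling nu Cnu.
Variables (alpha : R) (S : int -> set Z).
Hypothesis alpha1 : 1 < alpha.
Hypothesis hS : forall n : int, maximal_separated (alpha ^ (- n)) (S n).
Variables (Cpsi : R) (psi : @vertex R Z -> Z -> R).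
Hypothesis hpsi : lipschitz_partition alpha S Cpsi psi.

Implicit Types (s x y z : Z) (k : int).

Lemma psi_itv k s z : S k s -> 0 <= psi (s, k) z <= 1.
Proof. by move=> Ss; have [h _ _ _] := hpsi k; exact: h. Qed.

Lemma psi_supp k s z : S k s -> psi (s, k) z != 0 -> mdist s z < 2 * alpha ^ (- k).
Proof.
move=> Ss sz; have [_ _ h _] := hpsi k.
by have := h (s, k) Ss erefl _ (@subset_closure _ [set z | psi (s, k) z != 0] z sz); rewrite mem_ball.
Qed.

Lemma psi_lip k s x y : S k s ->
  `|psi (s, k) x - psi (s, k) y| <= `|Cpsi| * alpha ^ k * mdist x y.
Proof.
move=> Ss; have [_ _ _ h] := hpsi k; apply: le_trans (h (s, k) Ss erefl x y) _.
by rewrite ler_wpM2r ?mdist_ge0// ler_wpM2r ?ler_norm// ltW// scale_gt0.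
Qed.

Definition near_net k x : set Z := [set s | S k s /\ mdist x s <= 2 * alpha ^ (- k)].

Definition near_card := packing_number Cnu 2.

Lemma near_net_bounded k x : card_bounded near_card (near_net k x).
Proof. exact: (net_bounded hnu dnu alpha1 hS). Qed.

Definition near_fset k x : {fset Z} := fset_set (near_net k x).

Lemma mem_near_fset k x s : (s \in near_fset k x) = (s \in near_net k x).
Proof. by rewrite in_fset_set//; exact: card_bounded_finite (@near_net_bounded k x). Qed.

Lemma card_near_fset k x : (#|` near_fset k x| <= near_card)%N.
Proof. by apply: (@near_net_bounded k x) => s /=; rewrite mem_near_fset => /set_mem. Qed.

Lemma near_fset_net k x s : s \in near_fset k x -> S k s.
Proof. by rewrite mem_near_fset => /set_mem[]. Qed.

Lemma psi_near k s x : S k s -> psi (s, k) x != 0 -> s \in near_fset k x.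
Proof.
move=> Ss /(psi_supp Ss) h; rewrite mem_near_fset mem_set//; split => //.
by rewrite metric_sym ltW.
Qed.

(** The finite set is left free, provided it covers the support, so that values at two different
    points can be summed over a common set. *)
Lemma fsum_net (b : @vertex R Z -> R) k (F : {fset Z}) :
  (forall s, s \in F -> S k s) -> (forall s, S k s -> b (s, k) != 0 -> s \in F) ->
  \sum_(v \in [set v | vertices S v /\ v.2 = k]) b v = \sum_(s <- F) b (s, k).
Proof.
move=> FS hF.
rewrite -(fsbig_widen ((fun s => (s, k)) @` [set` F])); last 2 first.
- by move=> _ [s sF <-]; split => //=; exact: FS.
- move=> [s j] [[/= Ss jk] /= sF]; subst j; apply: contrapT => /eqP b0.
  by apply: sF; exists s => //=; exact: hF.
rewrite fsbig_image//; last by move=> s s' _ _ [].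
by rewrite -fsbig_seq.
Qed.

Lemma sum_psi k z (F : {fset Z}) :
  (forall s, s \in F -> S k s) -> (forall s, S k s -> psi (s, k) z != 0 -> s \in F) ->
  \sum_(s <- F) psi (s, k) z = 1.
Proof. by move=> h1 h2; have [_ hs _ _] := hpsi k; rewrite -(hs z) (@fsum_net (psi ^~ z) k F). Qed.

Variable u : @pt R Z -> R.

Local Notation a s k := (u (vpt (s, k))).
Local Notation tr := (vertex_trace S psi).

Lemma traceE k z (F : {fset Z}) :
  (forall s, s \in F -> S k s) -> (forall s, S k s -> psi (s, k) z != 0 -> s \in F) ->
  tr k u z = \sum_(s <- F) a s k * psi (s, k) z.
Proof.
move=> h1 h2; rewrite /vertex_trace (@fsum_net (fun v => u (vpt v) * psi v z) k F)// => s Ss h; apply: h2 => //.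
by apply: contra h => /eqP ->; rewrite mulr0.
Qed.

(* The values of a trace at [z] are averages of the values at the vertices. *)
Lemma trace_dist_le k z (c M : R) : 0 <= M ->
  (forall s, S k s -> psi (s, k) z != 0 -> `|a s k - c| <= M) ->
  `|tr k u z - c| <= M.
Proof.
move=> M0 h; have h1 s : s \in near_fset k z -> S k s by exact: near_fset_net.
have h2 s : S k s -> psi (s, k) z != 0 -> s \in near_fset k z by exact: psi_near.
rewrite (traceE h1)// -[X in _ - X](mulr1) -(sum_psi h1 h2) mulr_sumr -sumrB.
apply: le_trans (ler_norm_sum _ _ _) _.
rewrite -[leRHS]mulr1 -(sum_psi h1 h2) mulr_sumr.
rewrite big_seq [leRHS]big_seq; apply: ler_sum => s /h1 Ss.
have /andP[p0 _] := psi_itv z Ss.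
rewrite -mulrBl normrM (ger0_norm p0).
have [->|pz] := eqVneq (psi (s, k) z) 0; first by rewrite !mulr0.
by rewrite ler_wpM2r// h.
Qed.

Lemma continuous_psi k s : S k s -> continuous (psi (s, k)).
Proof.
move=> Ss x; apply/cvgrPdist_lt => e e0.
pose C := `|Cpsi| * alpha ^ k + 1.
have C0 : 0 < C by rewrite ltr_wpDl// mulr_ge0// ltW// scale_gt0.
near=> y; apply: le_lt_trans (psi_lip x y Ss) _.
apply: (@le_lt_trans _ _ (C * mdist x y)).
  by rewrite ler_wpM2r ?mdist_ge0// lerDl.
rewrite mulrC -ltr_pdivlMr// -mem_ball.
by near: y; apply: nbhsx_ballx; rewrite divr_gt0.
Unshelve. all: by end_near. Qed.

(** On the ball of radius alpha^(-k) at [x] the sum runs over a fixed finite set: the net points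
    within 3 alpha^(-k), that is, this radius plus the radius 2 alpha^(-k) of the supports. *)
Lemma continuous_trace k : continuous (tr k u).
Proof.
move=> x.
have fF : finite_set [set s | S k s /\ mdist x s <= 3 * alpha ^ (- k)].
  by apply: card_bounded_finite; apply: (net_bounded hnu dnu alpha1 hS).
pose F := fset_set [set s | S k s /\ mdist x s <= 3 * alpha ^ (- k)].
have FS s : s \in F -> S k s by rewrite in_fset_set// => /set_mem[].
have trF y : ball x (alpha ^ (- k)) y ->
    tr k u y = \sum_(s <- F) a s k * psi (s, k) y.
  rewrite mem_ball => xy; apply: traceE => // s Ss /(psi_supp Ss) sy.
  rewrite in_fset_set// mem_set//; split => //.
  by have := metric_triangle x y s; rewrite (metric_sym y s); lra.
have h : (\sum_(s <- F) a s k * psi (s, k) y) @[y --> x] --> tr k u x.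
  rewrite trF; last by apply: ballxx; exact: scale_gt0.
  have : forall s, s \in (F : seq Z) -> S k s by [].
  elim: (F : seq Z) => [|s r ih] rS.
    rewrite big_nil; under eq_fun do rewrite big_nil.
    exact: cvg_cst.
  rewrite big_cons; under eq_fun do rewrite big_cons.
  apply: cvgD; last by apply: ih => t tr'; apply: rS; rewrite inE tr' orbT.
  apply: cvgM; first exact: cvg_cst.
  by apply: continuous_psi; apply: rS; rewrite mem_head.
apply: cvg_trans h; apply: near_eq_cvg; near=> y; rewrite trF//.
by near: y; apply: nbhsx_ballx; exact: scale_gt0.
Unshelve. all: by end_near. Qed.

Lemma measurable_trace k : nu_measurable nu (tr k u).
Proof.
apply: (measurability _ (RGenOpens.measurableE R)) => _ [_ [a [b ->] <-]].
rewrite setTI; apply: (measurable_open hnu).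
by have /continuousP := @continuous_trace k; apply; exact: interval_open.
Qed.

(** The square counts the pairs of vertices of levels k + 1 and k close to one of two points; the
    other factor covers both cases of the minimum in the variation of a product of two psi's. The
    sign of [Cpsi] is not prescribed, hence the absolute value. *)
Definition increment_cst : R := (2 * near_card)%:R ^+ 2 * (1 + 2 * `|Cpsi| * alpha).

(** Since both levels carry partitions of unity, the increment at z is the sum of (a_s - a_s')
    psi_s(z) psi_s'(z) over pairs. In the difference between [x] and [y], a pair contributes only if
    its product is nonzero at one of the points, and then its jump is at most Mx or My. *)
Lemma trace_increment k x y (Mx My : R) : 0 <= Mx -> 0 <= My ->
  (forall s s', S (k + 1) s -> S k s' -> psi (s, k + 1) x != 0 -> psi (s', k) x != 0 ->
     `|a s (k + 1) - a s' k| <= Mx) ->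
  (forall s s', S (k + 1) s -> S k s' -> psi (s, k + 1) y != 0 -> psi (s', k) y != 0 ->
     `|a s (k + 1) - a s' k| <= My) ->
  `|(tr (k + 1) u x - tr k u x) - (tr (k + 1) u y - tr k u y)| <=
    increment_cst * Num.min 1 (alpha ^ k * mdist x y) * (Mx + My).
Proof.
move=> Mx0 My0 hx hy.
pose F := (near_fset (k + 1) x `|` near_fset (k + 1) y)%fset.
pose F' := (near_fset k x `|` near_fset k y)%fset.
have FS s : s \in F -> S (k + 1) s by rewrite inE => /orP[] /near_fset_net.
have F'S s : s \in F' -> S k s by rewrite inE => /orP[] /near_fset_net.
have Fx s : S (k + 1) s -> psi (s, k + 1) x != 0 -> s \in F.
  by move=> h /(psi_near h); rewrite inE => ->.
have Fy s : S (k + 1) s -> psi (s, k + 1) y != 0 -> s \in F.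
  by move=> h /(psi_near h); rewrite inE orbC => ->.
have F'x s : S k s -> psi (s, k) x != 0 -> s \in F'.
  by move=> h /(psi_near h); rewrite inE => ->.
have F'y s : S k s -> psi (s, k) y != 0 -> s \in F'.
  by move=> h /(psi_near h); rewrite inE orbC => ->.
have cF : (#|` F| <= 2 * near_card)%N.
  apply: leq_trans (leq_card_fsetU _ _) _; rewrite mul2n -addnn.
  by apply: leq_add; exact: card_near_fset.
have cF' : (#|` F'| <= 2 * near_card)%N.
  apply: leq_trans (leq_card_fsetU _ _) _; rewrite mul2n -addnn.
  by apply: leq_add; exact: card_near_fset.
pose b s s' z := psi (s, k + 1) z * psi (s', k) z.
have dE z : (forall s, S (k + 1) s -> psi (s, k + 1) z != 0 -> s \in F) ->
    (forall s, S k s -> psi (s, k) z != 0 -> s \in F') ->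
    tr (k + 1) u z - tr k u z =
    \sum_(s <- F) \sum_(s' <- F') (a s (k + 1) - a s' k) * b s s' z.
  move=> h1 h2; rewrite (traceE FS h1) (traceE F'S h2).
  rewrite -[X in X - _]mulr1 -(sum_psi F'S h2) mulr_suml.
  rewrite -[X in _ - X]mul1r -(sum_psi FS h1) mulr_suml -sumrB.
  apply: eq_bigr => s _; rewrite !mulr_sumr -sumrB; apply: eq_bigr => s' _.
  by rewrite /b; ring.
rewrite (dE x Fx F'x) (dE y Fy F'y) -sumrB.
set m := Num.min _ _; have m0 : 0 <= m.
  by rewrite le_min ler01 mulr_ge0 ?mdist_ge0// ltW// scale_gt0.
have al := alpha_gt0 alpha1.
pose K := (1 + 2 * `|Cpsi| * alpha) * m * (Mx + My).
have K0 : 0 <= K.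
  by rewrite !mulr_ge0 ?addr_ge0// !mulr_ge0// (ltW al).
have term s s' : s \in F -> s' \in F' ->
    `|(a s (k + 1) - a s' k) * b s s' x - (a s (k + 1) - a s' k) * b s s' y| <= K.
  move=> /FS Ss /F'S Ss'.
  have [/andP[px0 px1] /andP[py0 py1]] := (psi_itv x Ss, psi_itv y Ss).
  have [/andP[qx0 qx1] /andP[qy0 qy1]] := (psi_itv x Ss', psi_itv y Ss').
  have bdiff : `|b s s' x - b s s' y| <= (1 + 2 * `|Cpsi| * alpha) * m.
    have mt0 := mdist_ge0 x y; have ak := scale_gt0 alpha1 k.
    have C0 : 0 <= `|Cpsi| * alpha by rewrite mulr_ge0 ?(ltW al).
    have [m1|m1] := leP 1 (alpha ^ k * mdist x y).
      have -> : m = 1 by rewrite /m min_l.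
      apply: (@le_trans _ _ 1); last by rewrite mulr1; lra.
      by rewrite /b ler_norml; nra.
    have -> : m = alpha ^ k * mdist x y by rewrite /m min_r// ltW.
    have h1 := psi_lip x y Ss; have h2 := psi_lip x y Ss'.
    have E : alpha ^ (k + 1) = alpha * alpha ^ k by rewrite scaleD// mulrC expr1z.
    rewrite E in h1.
    have -> : b s s' x - b s s' y = (psi (s, k + 1) x - psi (s, k + 1) y) * psi (s', k) x
        + psi (s, k + 1) y * (psi (s', k) x - psi (s', k) y) by rewrite /b; ring.
    apply: le_trans (ler_normD _ _) _; rewrite !normrM (ger0_norm qx0) (ger0_norm py0).
    have g1 : `|psi (s, k + 1) x - psi (s, k + 1) y| * psi (s', k) x <=
        `|Cpsi| * (alpha * alpha ^ k) * mdist x y by apply: le_trans h1; rewrite ler_piMr.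
    have g2 : psi (s, k + 1) y * `|psi (s', k) x - psi (s', k) y| <=
        `|Cpsi| * alpha ^ k * mdist x y by apply: le_trans h2; rewrite ler_piMl.
    have akt : 0 <= alpha ^ k * mdist x y by rewrite mulr_ge0// ltW.
    have g3 : `|Cpsi| * alpha ^ k * mdist x y <= `|Cpsi| * (alpha * alpha ^ k) * mdist x y.
      rewrite -!mulrA ler_wpM2l// ler_peMl//; exact: ltW.
    have := lerD g1 (le_trans g2 g3) => /le_trans; apply.
    have -> : `|Cpsi| * (alpha * alpha ^ k) * mdist x y + `|Cpsi| * (alpha * alpha ^ k) * mdist x y =
      2 * `|Cpsi| * alpha * (alpha ^ k * mdist x y) by ring.
    by rewrite ler_wpM2r// lerDr.
  rewrite -mulrBr normrM.
  have [b0|b0] := eqVneq (b s s' x) 0; last first.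
    move: b0; rewrite mulf_eq0 negb_or => /andP[h1 h2].
    rewrite [leLHS]mulrC; apply: ler_pM => //.
    by apply: le_trans (hx _ _ Ss Ss' h1 h2) _; rewrite lerDl.
  have [b1|b1] := eqVneq (b s s' y) 0; last first.
    move: b1; rewrite mulf_eq0 negb_or => /andP[h1 h2].
    rewrite [leLHS]mulrC; apply: ler_pM => //.
    by apply: le_trans (hy _ _ Ss Ss' h1 h2) _; rewrite lerDr.
  by rewrite b0 b1 subrr normr0 mulr0.
apply: (@le_trans _ _ (\sum_(s <- F) \sum_(s' <- F') K)).
  apply: le_trans (ler_norm_sum _ _ _) _.
  rewrite big_seq [leRHS]big_seq; apply: ler_sum => s sF.
  rewrite -sumrB; apply: le_trans (ler_norm_sum _ _ _) _.
  by rewrite big_seq [leRHS]big_seq; apply: ler_sum => s' sF'; exact: term.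
rewrite !big_const_seq !iter_addr_0 !count_predT -mulrnA -[leLHS]mulr_natl.
have -> : increment_cst * m * (Mx + My) = (2 * near_card)%:R ^+ 2 * K.
  by rewrite /K !mulrA.
by rewrite ler_wpM2r// expr2 -natrM ler_nat leq_mul.
Qed.

End trace.

(** * Auxiliary facts on roots, sums and integrals *)

Lemma abs_le_root (R : realType) (p a : R) (X : \bar R) : 0 < p ->
  ((`|a| `^ p)%:E <= X)%E -> X \is a fin_num -> `|a| <= fine X `^ p^-1.
Proof.
move=> p0 h fX; rewrite -(fineK fX) lee_fin in h.
rewrite -[leLHS](@powRr1 _ `|a|)// -(mulfV (lt0r_neq0 p0)) powRrM.
by rewrite ge0_ler_powR// ?nnegrE ?powR_ge0 ?invr_ge0 ?(ltW p0)// (le_trans _ h) ?powR_ge0.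
Qed.

Lemma root_powR (R : realType) (p b : R) : 0 < p -> 0 <= b -> (b `^ p^-1) `^ p = b.
Proof. by move=> p0 b0; rewrite -powRrM mulVf ?gt_eqF// powRr1. Qed.

Lemma exchange_esum (R : realType) (I J : choiceType) (A : set I) (B : set J)
    (a : I -> J -> \bar R) : (forall i j, 0 <= a i j)%E ->
  (\esum_(i in A) \esum_(j in B) a i j = \esum_(j in B) \esum_(i in A) a i j)%E.
Proof.
move=> a0; rewrite (@esum_esum _ _ _ A (fun=> B))// (@esum_esum _ _ _ B (fun=> A))//.
have -> : A `*`` (fun=> B) = (fun ji => (ji.2, ji.1)) @` (B `*`` (fun=> A)).
  apply/seteqP; split=> [[i j] [/= Ai Bj]|_ [[j i] [/= Bj Ai] <-]] //.
  by exists (j, i).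
by rewrite esum_image// => -[j i] [j' i'] _ _ [-> ->].
Qed.

Lemma esum_subset (R : realType) (I : choiceType) (A B : set I) (a : I -> \bar R) :
  A `<=` B -> (\esum_(i in A) a i <= \esum_(i in B) a i)%E.
Proof.
move=> AB; apply: ge_ereal_sup => _ [X [fX XA] <-]; apply: esum_ge.
by exists X => //; split => //; exact: subset_trans AB.
Qed.

Lemma esum_shift (R : realType) (n : int) (a : int -> \bar R) :
  (\esum_(i in [set: nat]) a (n + i%:Z)%R = \esum_(k in [set k | (n <= k)%R]) a k)%E.
Proof.
have -> : [set k | n <= k] = (fun i : nat => n + i%:Z) @` setT.
  apply/seteqP; split=> [k/= nk|_ [i _ <-]/=]; last by rewrite lerDl.
  by exists `|k - n|%N => //; rewrite gez0_abs ?subr_ge0// subrKC.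
by rewrite esum_image// => i j _ _ /addrI[].
Qed.

Lemma esum_ge_nat (R : realType) (k : nat) (a : int -> \bar R) :
  (forall j, 0 <= a j)%E ->
  (\esum_(j in [set j | (k%:Z <= j)%R]) a j = \sum_(k <= i <oo) a i%:Z)%E.
Proof.
move=> a0; rewrite -(esum_shift k%:Z a) -nneseries_esumT//.
rewrite -(@nneseries_addn _ (fun i => a i%:Z) k)//.
by apply: eq_eseriesr => i _; rewrite -PoszD addnC.
Qed.

(** Only the majorant is measurable: [f] is compared with [g] plus the function equal to +oo on [N],
    whose integral is zero. *)
Lemma le_lower_integral_null d (T : measurableType d) (R : realType)
    (mu : {measure set T -> \bar R}) (N : set T) (f g : T -> \bar R) :
  measurable N -> mu N = 0%E -> measurable_fun setT g ->
  (forall x, 0 <= f x)%E -> (forall x, 0 <= g x)%E ->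
  (forall x, ~ N x -> f x <= g x)%E ->
  (\int[mu]_x f x <= \int[mu]_x g x)%E.
Proof.
move=> mN N0 mg f0 g0 fg.
apply: (@le_trans _ _ (\int[mu]_x (g x + (\1_N x)%:E * +oo))%E).
  apply: le_lower_integral => // x _; rewrite indicE.
  have [Nx|Nx] := pselect (N x); first by rewrite mem_set// mul1e addey ?leey// -ltNye (lt_le_trans _ (g0 x)).
  by rewrite memNset// mul0e adde0 fg.
rewrite ge0_integralD//; last first.
  by apply: emeasurable_funM => //; apply/measurable_EFinP; exact: measurable_indic.
have I0 : (\int[mu]_x ((\1_N x)%:E * +oo) = 0)%E.
  rewrite (integral_indicl mu N (cst +oo%E)) integral_cst//.
  by rewrite [X in (_ * X)%E]N0 mule0.
by rewrite [X in (_ + X)%E]I0 adde0.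
Qed.

Lemma poweR_root_le (R : realType) (p c : R) (x y : \bar R) : 0 < p -> 0 <= c ->
  (0 <= x)%E -> (0 <= y)%E -> (x <= c%:E * y)%E ->
  (x `^ p^-1 <= (c `^ p^-1)%:E * y `^ p^-1)%E.
Proof.
move=> p0 c0 x0 y0 h; rewrite -poweR_EFin -poweRM ?lee_fin//.
have cy0 : (0 <= c%:E * y)%E by rewrite mule_ge0 ?lee_fin.
by apply: gt0_ler_poweR; rewrite ?invr_ge0 ?(ltW p0)// in_itv/= ?x0 ?cy0 leey.
Qed.

Lemma poweR_cvg0 (R : realType) (q : R) (u : nat -> \bar R) : 0 < q ->
  (forall k, 0 <= u k)%E -> u k @[k --> \oo] --> 0%E ->
  (u k `^ q)%E @[k --> \oo] --> 0%E.
Proof.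
move=> q0 u0 cu; have [finu cu0] := (fine_cvgP _ _).1 cu.
apply/fine_cvgP; split; first by near=> k; apply: fin_num_poweR; near: k.
apply/cvgrPdist_lt => eps eps0.
have d0 : 0 < eps `^ q^-1 by rewrite powR_gt0.
move/cvgrPdist_lt: cu0 => /(_ _ d0) cu0.
near=> k; rewrite sub0r normrN /= fine_poweR ger0_norm ?powR_ge0//.
have : `|0 - fine (u k)| < eps `^ q^-1 by near: k.
rewrite sub0r normrN ger0_norm ?fine_ge0// => h.
rewrite -[ltRHS](root_powR q0 (ltW eps0)).
by apply: gt0_ltr_powR; rewrite ?nnegrE ?fine_ge0 ?powR_ge0.
Unshelve. all: by end_near. Qed.

Lemma Lp_integral_add d (T : measurableType d) (R : realType)
    (mu : {measure set T -> \bar R}) (A : set T) (u v : T -> R) (p : R) : 0 <= p ->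
  measurable A -> measurable_fun setT u -> measurable_fun setT v ->
  (\int[mu]_(x in A) (`|u x + v x| `^ p)%:E <=
   (2 `^ p)%:E * (\int[mu]_(x in A) (`|u x| `^ p)%:E + \int[mu]_(x in A) (`|v x| `^ p)%:E))%E.
Proof.
move=> p0 mA mu' mv.
have m0 (g : T -> R) : measurable_fun setT g ->
    measurable_fun A (fun x => (`|g x| `^ p)%:E).
  move=> mg; apply: measurable_funTS; apply/measurable_EFinP.
  by apply: (measurableT_comp (measurable_powR _)); exact: measurableT_comp.
have g0 (g : T -> R) x : (0 <= (`|g x| `^ p)%:E)%E by rewrite lee_fin powR_ge0.
rewrite -ge0_integralD; [|by []|by move=> x _; exact: g0|exact: m0|by move=> x _; exact: g0|exact: m0].
rewrite -ge0_integralZl; [|by []| |by move=> x _; rewrite adde_ge0|by rewrite lee_fin powR_ge0]; last first.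
  by apply: emeasurable_funD; exact: m0.
apply: le_lower_integral => x _; first by rewrite lee_fin powR_ge0.
rewrite -EFinD -EFinM lee_fin; apply: le_trans (powRD_le p0 (normr_ge0 (u x)) (normr_ge0 (v x))).
by rewrite ge0_ler_powR ?nnegrE ?addr_ge0// ler_normD.
Qed.

Lemma Lp_norm_integral (R : realType) (Z : completeMetricType R)
    (nu : {outer_measure set Z -> \bar R}) (p : R) (u : Z -> R) :
  Lp_norm nu p u =
  ((\int[nu : {measure set (caratheodory_type nu) -> \bar R}]_x (`|u x| `^ p)%:E) `^ p^-1)%E.
Proof. by rewrite /Lp_norm unlock. Qed.

Lemma subset_lower_integral d (T : measurableType d) (R : realType)
    (mu : {measure set T -> \bar R}) (A B : set T) (g : T -> \bar R) :
  A `<=` B -> (forall x, 0 <= g x)%E ->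
  (\int[mu]_(x in A) g x <= \int[mu]_(x in B) g x)%E.
Proof.
move=> AB g0; rewrite integral_mkcond [leRHS]integral_mkcond.
apply: le_lower_integral => x _; rewrite patchE; first by case: ifP.
rewrite patchE; have [Ax|Ax] := pselect (A x).
  by rewrite !mem_set//; exact: AB.
by rewrite memNset//; case: ifP.
Qed.

Lemma powRV (R : realType) (x q : R) : 0 <= x -> x^-1 `^ q = x `^ (- q).
Proof. by move=> x0; rewrite -powR_inv1// -powRrM mulN1r. Qed.

(** * Decay across scales *)

Section decay.
Context {R : realType}.
Variables (alpha p beta : R).
Hypothesis alpha1 : 1 < alpha.
Hypothesis p1 : 1 <= p.
Hypothesis hbeta : 0 < beta < p.

Let p0 : 0 < p. Proof. exact: lt_le_trans p1. Qed.
Let al : 0 < alpha. Proof. exact: alpha_gt0. Qed.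
Local Notation theta := (1 - beta / p).

Lemma theta01 : 0 < theta < 1.
Proof.
have /andP[b0 bp] := hbeta.
by rewrite subr_gt0 ltr_pdivrMr// mul1r bp/= gtrBl divr_gt0.
Qed.

Definition decay_exponent : R := Num.min theta (1 - theta).

(** Half of the exponent is used, so that the decay between scales is the square of r^|m - k|: one
    factor pays for the weights of [tail_jump], the other makes the increments summable. *)
Definition decay_ratio : R := alpha `^ (- (decay_exponent / 2)).

Lemma decay_exponent_gt0 : 0 < decay_exponent.
Proof. by have /andP[h1 h2] := theta01; rewrite lt_min h1 subr_gt0. Qed.

Lemma decay_ratio01 : 0 < decay_ratio < 1.
Proof. by apply: kernel_ratio01; rewrite // divr_gt0// decay_exponent_gt0. Qed.

Lemma weight_root (k : int) : weight alpha (p - beta) k `^ (- p^-1) = alpha `^ (- (k%:~R * theta)).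
Proof. by rewrite /weight -powRrM; congr (_ `^ _); field; rewrite gt_eqF. Qed.

(* Both [theta] and [1 - theta] being positive, the factor decays on both sides
   of the scale [m] of the pair of points. *)
Lemma min_weight_decay (m k : int) (t : R) : 0 <= t -> t <= alpha ^ (- m) ->
  Num.min 1 (alpha ^ k * t) * weight alpha (p - beta) k `^ (- p^-1) <=
  (decay_ratio ^+ `|(m - k)%R|) ^+ 2 * weight alpha (p - beta) m `^ (- p^-1).
Proof.
move=> t0 tm; rewrite !weight_root.
have -> : (decay_ratio ^+ `|(m - k)%R|) ^+ 2 =
    alpha `^ (- (decay_exponent * `|m%:~R - k%:~R|)).
  rewrite -exprM -powR_mulrn ?powR_ge0// /decay_ratio -powRrM; congr (_ `^ _).
  by rewrite natrM natr_absz intr_norm intrD mulrNz; field.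
have aN0 : alpha != 0 by rewrite gt_eqF.
have h1 : decay_exponent <= theta by rewrite ge_min lexx.
have h2 : decay_exponent <= 1 - theta by rewrite ge_min lexx orbT.
rewrite -powRD ?aN0 ?implybT//.
have [mk|km] := leP m k.
  apply: (@le_trans _ _ (alpha `^ (- (k%:~R * theta)))).
    by rewrite ler_piMl ?powR_ge0// ge_min lexx.
  rewrite ler_powR ?(ltW alpha1)// distrC ger0_norm ?subr_ge0 ?ler_int//.
  have d0 : 0 <= (k%:~R - m%:~R : R) by rewrite subr_ge0 ler_int.
  have := ler_wpM2r d0 h1; move: (k%:~R : R) (m%:~R : R) => K M; lra.
apply: (@le_trans _ _ (alpha ^ (k - m) * alpha `^ (- (k%:~R * theta)))).
  rewrite ler_wpM2r ?powR_ge0// ge_min; apply/orP; right.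
  by rewrite (scaleD alpha1) ler_wpM2l// ltW// scale_gt0.
rewrite -powR_intmul ?(ltW al)// -powRD ?aN0 ?implybT//.
rewrite ler_powR ?(ltW alpha1)// ger0_norm ?subr_ge0 ?ler_int ?(ltW km)//.
have d0 : 0 <= (m%:~R - k%:~R : R) by rewrite subr_ge0 ler_int ltW.
rewrite intrD mulrNz.
have := ler_wpM2r d0 h2; move: (k%:~R : R) (m%:~R : R) => K M; lra.
Qed.

End decay.

Section iterated_integral.
Context d (T : measurableType d) (R : realType) (mu : {measure set T -> \bar R}).
Variables (F G : T -> T -> \bar R) (a b : R).
Hypothesis a0 : 0 <= a.
Hypothesis b0 : 0 <= b.
Hypothesis F0 : forall y x, (0 <= F y x)%E.
Hypothesis G0 : forall y x, (0 <= G y x)%E.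
Hypothesis mF : forall y, measurable_fun setT (F y).
Hypothesis mG : forall y, measurable_fun setT (G y).
Hypothesis mIF : measurable_fun setT (fun y => \int[mu]_x F y x)%E.
Hypothesis mIG : measurable_fun setT (fun y => \int[mu]_x G y x)%E.

Local Notation H := (fun y x => a%:E * F y x + b%:E * G y x)%E.

Let ge0_comb u v : (0 <= u -> 0 <= v -> 0 <= a%:E * u + b%:E * v)%E.
Proof. by move=> u0 v0; rewrite adde_ge0// mule_ge0 ?lee_fin. Qed.

Let measurable_comb (u v : T -> \bar R) : measurable_fun setT u -> measurable_fun setT v ->
  measurable_fun setT (fun x => a%:E * u x + b%:E * v x)%E.
Proof. by move=> mu' mv; apply: emeasurable_funD; exact: measurable_funeM. Qed.

Let integral_comb (u v : T -> \bar R) : (forall x, 0 <= u x)%E -> (forall x, 0 <= v x)%E ->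
  measurable_fun setT u -> measurable_fun setT v ->
  (\int[mu]_x (a%:E * u x + b%:E * v x) =
   a%:E * (\int[mu]_x u x) + b%:E * (\int[mu]_x v x))%E.
Proof.
move=> u0 v0 mu' mv; rewrite ge0_integralD//.
- by rewrite !ge0_integralZl.
- by move=> x _; rewrite mule_ge0 ?lee_fin.
- exact: measurable_funeM.
- by move=> x _; rewrite mule_ge0 ?lee_fin.
- exact: measurable_funeM.
Qed.

Lemma measurable_combination y : measurable_fun setT (H y).
Proof. exact: measurable_comb. Qed.

Lemma measurable_integral_combination :
  measurable_fun setT (fun y => \int[mu]_x H y x)%E.
Proof.
have := measurable_comb mIF mIG; apply: eq_measurable_fun => y _.
by rewrite integral_comb.
Qed.

Lemma integral2_combination : (\int[mu]_y \int[mu]_x H y x =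
  a%:E * (\int[mu]_y \int[mu]_x F y x) + b%:E * (\int[mu]_y \int[mu]_x G y x))%E.
Proof.
rewrite -integral_comb//; first by apply: eq_integral => y _; rewrite integral_comb.
- by move=> y; exact: integral_ge0.
- by move=> y; exact: integral_ge0.
Qed.

End iterated_integral.

(** * Besov estimates for the traces of the Poisson extension *)

Section besov_trace.
Context {R : realType} {Z : completeMetricType R}.
Variable nu : {outer_measure set Z -> \bar R}.
Variable Cnu : R.
Hypothesis hnu : metric_measure_space nu.
Hypothesis dnu : doubling nu Cnu.
Variables (alpha tau : R) (S : int -> set Z).
Hypothesis alpha1 : 1 < alpha.
Hypothesis htau : Num.max 3 (alpha / (alpha - 1)) < tau.
Hypothesis hS : forall n : int, maximal_separated (alpha ^ (- n)) (S n).
Variables (p beta : R).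
Hypothesis p1 : 1 <= p.
Hypothesis hbeta : 0 < beta < p.
Variables (Cpsi : R) (psi : @vertex R Z -> Z -> R).
Hypothesis hpsi : lipschitz_partition alpha S Cpsi psi.

Local Notation nuc := (nu : {measure set (caratheodory_type nu) -> \bar R}).
Local Notation T := (caratheodory_type nu).
Local Notation vertex := (@vertex R Z).
Local Notation vb := (vball alpha tau).
Local Notation edge := (edge alpha tau S).
Local Notation desc := (descending alpha tau S).
Local Notation lam := (3 * tau).
Local Notation D := (nball alpha lam).
Local Notation nv := (nvol nu alpha lam).
Local Notation e := (p - beta).
Local Notation w := (weight alpha e).

Let tau0 : 0 < tau. Proof. by have := tau_gt3 htau; lra. Qed.

Let lam2 : 2 <= lam. Proof. by have := tau_gt3 htau; lra. Qed.

Let p0 : 0 < p. Proof. exact: lt_le_trans p1. Qed.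

Let al : 0 < alpha. Proof. exact: alpha_gt0. Qed.

Let nv0 k s : 0 < nv k s. Proof. exact: nvol_gt0. Qed.

Let w0 k : 0 < w k. Proof. exact: weight_gt0. Qed.

Let e0 : 0 < e. Proof. by rewrite subr_gt0; case/andP: hbeta. Qed.

Definition level_edges (k : int) : set (vertex * vertex) :=
  [set i | [/\ edge i.1 i.2, i.1.2 = k + 1 & i.2.2 = k]].

Definition children k (s : Z) : set Z := [set s' | edge (s', k + 1) (s, k)].

Let pair k (j : Z * Z) : vertex * vertex := ((j.2, k + 1), (j.1, k)).

Lemma level_edges_image k : level_edges k = pair k @` (S k `*`` children k).
Proof.
apply/seteqP; split=> [[[s' m'] [s m]] [/= h E E']|_ [[s s'] [/= Ss h] <-]].
  by subst m m'; exists (s, s') => //; split => //=; case: h.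
by split.
Qed.

Lemma esum_level_edges k (a : vertex * vertex -> \bar R) :
  (forall i, 0 <= a i)%E ->
  (\esum_(i in level_edges k) a i =
   \esum_(s in S k) \esum_(s' in children k s) a ((s', (k + 1)%R), (s, k)))%E.
Proof.
move=> a0; rewrite level_edges_image esum_image; last by move=> [s s'] [t t'] _ _ [-> ->].
by rewrite esum_esum.
Qed.

Lemma countable_level_edges k : countable (level_edges k).
Proof.
have cS m : countable (S m) by exact: (countable_net hnu dnu alpha1 hS).
rewrite level_edges_image; apply: sub_countable (card_image_le _ _) _.
apply: sub_countable (countableX (cS k) (cS (k + 1))).
by apply: subset_card_le => -[s s'] [/= Ss [Ss' _ _ _ _]].
Qed.

Definition child_card := packing_number Cnu (tau * (1 + alpha)).

Lemma children_bounded k s : card_bounded child_card (children k s).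
Proof.
apply: card_bounded_sub (@net_bounded _ _ _ _ hnu dnu alpha S alpha1 hS (k + 1) s _ _).
  move=> s' h; split; first by case: h.
  by rewrite metric_sym; have := edge_mdist alpha1 htau h.
by rewrite mulr_ge0 ?addr_ge0 ?(ltW tau0) ?(ltW al).
Qed.

Lemma esum_descending n (a : vertex * vertex -> \bar R) : (forall i, 0 <= a i)%E ->
  (\esum_(i in descending alpha tau S n) a i =
   \esum_(k in [set k | (n <= k)%R]) \esum_(i in level_edges k) a i)%E.
Proof.
move=> a0; rewrite esum_esum//.
have -> : [set k | n <= k] `*`` level_edges =
    (fun i => (i.2.2, i)) @` descending alpha tau S n.
  apply/seteqP; split=> [[k i] [/= nk [h E E']]|_ [i [h E ni] <-]] //.
  by subst k; exists i.
by rewrite esum_image// => i j _ _ [].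
Qed.

(** The two vertex balls meet, and both lie in the ball dilated by 3 at the lower vertex. *)
Lemma edge_mass_le k s s' : edge (s', k + 1) (s, k) ->
  edge_mass alpha tau nu ((s', k + 1), (s, k)) <= 2 * nv k s.
Proof.
move=> h; rewrite -lee_fin -(edge_massE alpha1 htau hnu)/=.
rewrite (_ : 2 * nv k s = nv k s + nv k s); last by ring.
rewrite EFinD -!(nballE hnu alpha1 lam2).
case: h => _ _ _ _ [z []]; rewrite /vball !mem_ball/= => vz sz.
have a0 := scale_gt0 alpha1 (- k).
have ta : tau * alpha ^ (- (k + 1)) <= tau * alpha ^ (- k).
  by rewrite ler_pM2l// [leRHS](scaleS alpha1) ler_peMl ?(ltW alpha1)// ltW// scale_gt0.
have ta0 : 0 < tau * alpha ^ (- k) by rewrite mulr_gt0.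
have := metric_triangle s z s'; rewrite (metric_sym z s') => ?.
apply: leeD; apply: le_outer_measure; apply: subset_mball; rewrite ?mdistxx; lra.
Qed.

Section vertex_function.
Variable u : @pt R Z -> R.

Local Notation E := (edge_energy alpha tau nu p beta u).
Local Notation r := (decay_ratio alpha p beta).
Local Notation W := (two_sided_sum r).
Local Notation tr k := (vertex_trace S psi k u).
Local Notation Ci := (increment_cst Cnu alpha Cpsi).

Lemma edge_energy_ge0 i : 0 <= E i.
Proof. by rewrite /edge_energy !mulr_ge0 ?powR_ge0 ?edge_mass_ge0. Qed.

(** The jumps of level [k] as a function on [Z]: each edge is spread over the ball of its lower
    vertex, so that the integral is controlled by the edge energies. *)
Definition jump (k : int) (x : T) : \bar R :=
  (\esum_(i in level_edges k)
    ((\1_(vb i.2) x)%:E * (`|u (vpt i.1) - u (vpt i.2)| `^ p)%:E))%E.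

Lemma jump_ge0 k x : (0 <= jump k x)%E.
Proof. by apply: esum_ge0 => i _; rewrite -EFinM lee_fin mulr_ge0// powR_ge0. Qed.

Let mvb v : measurable (vb v : set T). Proof. exact: measurable_mball. Qed.

Let mt (i : vertex * vertex) : measurable_fun setT
   (fun x : T => (\1_(vb i.2) x)%:E * (`|u (vpt i.1) - u (vpt i.2)| `^ p)%:E)%E.
Proof.
apply: emeasurable_funM => //.
by apply/measurable_EFinP; exact: measurable_indic.
Qed.

Lemma measurable_jump k : measurable_fun setT (jump k).
Proof.
apply: measurable_esum => //; exact: countable_level_edges.
Qed.

Lemma integral_jump_le k :
  ((w k)%:E * \int[nuc]_x jump k x <=
   \esum_(i in level_edges k) (edge_energy alpha tau nu p beta u i)%:E)%E.
Proof.
rewrite integral_esum//; last exact: countable_level_edges.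
rewrite -esumZl ?powR_ge0//; last first.
  by move=> i _; apply: integral_ge0 => x _; rewrite -EFinM lee_fin mulr_ge0// powR_ge0.
apply: le_esum => i [_ _ ik].
rewrite integral_indicl.
have -> : (\int[nuc]_(x in vb i.2) (`|u (vpt i.1) - u (vpt i.2)| `^ p)%:E =
    (`|u (vpt i.1) - u (vpt i.2)| `^ p)%:E * nu (vb i.2))%E.
  exact: (integral_cst nuc (mvb i.2)).
rewrite muleA /edge_energy ik [_ * k%:~R]mulrC -/(w k) EFinM.
rewrite -(edge_massE alpha1 htau hnu) EFinM lee_wpmul2l ?leeDr//.
by rewrite -EFinM lee_fin mulr_ge0 ?powR_ge0.
Qed.

(** As tau > 2, a point in the supports of both partition functions lies in both vertex balls; it
    thus witnesses that the vertices are joined by an edge counted at [x]. *)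
Lemma jump_ge k s s' (x : T) : S (k + 1) s -> S k s' ->
  mdist s x < 2 * alpha ^ (- (k + 1)) -> mdist s' x < 2 * alpha ^ (- k) ->
  ((`|u (vpt (s, k + 1)) - u (vpt (s', k))| `^ p)%:E <= jump k x)%E.
Proof.
move=> Ss Ss' sx s'x; have t2 : 2 <= tau by have := tau_gt3 htau; lra.
have vb1 : vb (s, k + 1) x.
  by rewrite /vball mem_ball/=; apply: lt_le_trans sx _; rewrite ler_pM2r ?scale_gt0.
have vb2 : vb (s', k) x.
  by rewrite /vball mem_ball/=; apply: lt_le_trans s'x _; rewrite ler_pM2r ?scale_gt0.
have h : edge (s, k + 1) (s', k).
  split => //=; last by exists x.
  - by move=> [_ /eqP]; rewrite -subr_eq0 addrAC subrr add0r.
  - by rewrite addrAC subrr add0r.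
apply: esum_ge; exists [set ((s, k + 1), (s', k))]; first by split => // _ ->.
by rewrite fsbig_set1 /= indicE mem_set// mul1e.
Qed.

(** A bound at scale [m] bounds every jump of level k >= n at the price of r^(-|m - k|), while for
    fixed k the weights remain summable over m. *)
Definition tail_jump (n m : int) (x : T) : \bar R :=
  (\esum_(k in [set k | (n <= k)%R]) ((r ^+ `|(m - k)%R| * w k)%:E * jump k x))%E.

Let r0 : 0 < r. Proof. by case/andP: (decay_ratio01 alpha1 p1 hbeta). Qed.
Let r1 : r < 1. Proof. by case/andP: (decay_ratio01 alpha1 p1 hbeta). Qed.
Let rw0 m k : 0 < r ^+ `|(m - k)%R| * w k.
Proof. by rewrite mulr_gt0 ?exprn_gt0. Qed.

Let term0 m k (x : T) : (0 <= (r ^+ `|(m - k)%R| * w k)%:E * jump k x)%E.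
Proof. by rewrite mule_ge0 ?jump_ge0// lee_fin ltW. Qed.

Lemma tail_jump_ge0 n m x : (0 <= tail_jump n m x)%E.
Proof. by apply: esum_ge0 => k _. Qed.

Let mterm m k : measurable_fun setT (fun x : T => (r ^+ `|(m - k)%R| * w k)%:E * jump k x)%E.
Proof. by apply: measurable_funeM; exact: measurable_jump. Qed.

Lemma measurable_tail_jump n m : measurable_fun setT (tail_jump n m).
Proof. by apply: measurable_esum => //; exact: countableP. Qed.

Lemma sum_integral_tail_jump n :
  (\esum_(m in [set: int]) \int[nuc]_x tail_jump n m x <=
   W%:E * \esum_(i in descending alpha tau S n) (E i)%:E)%E.
Proof.
have E0 i : (0 <= (E i)%:E)%E by rewrite lee_fin edge_energy_ge0.
rewrite esum_descending//.
have -> : (\esum_(m in [set: int]) \int[nuc]_x tail_jump n m x =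
    \esum_(m in [set: int]) \esum_(k in [set k | (n <= k)%R])
      (r ^+ `|(m - k)%R|)%:E * ((w k)%:E * \int[nuc]_x jump k x))%E.
  apply: eq_esum => m _; rewrite integral_esum//; last exact: countableP.
  apply: eq_esum => k _; rewrite ge0_integralZl//; last 3 first.
  - exact: measurable_jump.
  - by move=> x _; exact: jump_ge0.
  - by rewrite lee_fin ltW.
  by rewrite EFinM muleA.
have J0 k : (0 <= (w k)%:E * \int[nuc]_x jump k x)%E.
  by rewrite mule_ge0 ?lee_fin ?(ltW (w0 _))// integral_ge0// => x _; exact: jump_ge0.
have W0 : 0 <= W by apply: two_sided_sum_ge0; exact: decay_ratio01.
rewrite exchange_esum; last by move=> m k; rewrite mule_ge0// lee_fin exprn_ge0// ltW.
rewrite -esumZl//; last by move=> k _; exact: esum_ge0.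
apply: le_esum => k _.
apply: (@le_trans _ _ (W%:E * ((w k)%:E * \int[nuc]_x jump k x))%E); last first.
  rewrite lee_wpmul2l ?lee_fin//.
  exact: integral_jump_le.
(* [esumZl] takes a real factor. If the integral is infinite, so is the right-hand side, since W >
   0. *)
have [cf|] := boolP (((w k)%:E * \int[nuc]_x jump k x)%E \is a fin_num); last first.
  rewrite ge0_fin_numE// -leNgt leye_eq => /eqP ->.
  rewrite gt0_muley ?leey// lte_fin mulr_gt0// invr_gt0 subr_gt0.
  exact: r1.
rewrite -(fineK cf); under eq_esum do rewrite muleC.
rewrite esumZl ?fine_ge0//; last by move=> m _; rewrite lee_fin exprn_ge0// ltW.
rewrite muleC lee_wpmul2r ?lee_fin ?fine_ge0//.
apply: le_trans (esum_geometric_int (decay_ratio01 alpha1 p1 hbeta) k).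
by apply: le_esum => m _; rewrite -abszN opprB.
Qed.

(* The summand [1] keeps the constant positive, so that the bounds below are
   [+oo] when the jumps are not summable. *)
Definition error_cst := 2 * Ci * W + 1.

Lemma increment_cst_ge0 : 0 <= Ci.
Proof.
by rewrite mulr_ge0 ?exprn_ge0// addr_ge0// !mulr_ge0// ltW// alpha_gt0.
Qed.

Lemma error_cst_gt0 : 0 < error_cst.
Proof.
rewrite ltr_wpDl// mulr_ge0 ?two_sided_sum_ge0//; first by rewrite mulr_ge0// increment_cst_ge0.
exact: decay_ratio01.
Qed.

(** The bound on the tail gives jumps of size at most (a / (r^j w_k))^(1/p) with j = |m - k|; the
    factor r^(2 j) of [min_weight_decay] absorbs the loss r^(-j) and leaves r^j. *)
Lemma trace_increment_decay n m k (x y : T) (a : R) : n <= k -> 0 <= a ->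
  mdist (x : Z) y <= alpha ^ (- m) ->
  (tail_jump n m x <= a%:E)%E -> (tail_jump n m y <= a%:E)%E ->
  `|(tr (k + 1) x - tr k x) - (tr (k + 1) y - tr k y)| <=
  2 * Ci * (a / w m) `^ p^-1 * r ^+ `|(m - k)%R|.
Proof.
move=> nk a0 xy ax ay; set j := `|(m - k)%R|%N.
have q0 : 0 < r ^+ j by rewrite exprn_gt0.
have q1 : r ^+ j <= 1 by rewrite exprn_ile1// ltW.
pose M := (a / (r ^+ j * w k)) `^ p^-1.
have M0 : 0 <= M by exact: powR_ge0.
have step (z : T) : (tail_jump n m z <= a%:E)%E -> forall s s', S (k + 1) s -> S k s' ->
    psi (s, k + 1) z != 0 -> psi (s', k) z != 0 ->
    `|u (vpt (s, k + 1)) - u (vpt (s', k))| <= M.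
  move=> az s s' Ss Ss' /(psi_supp hpsi Ss) sz /(psi_supp hpsi Ss') s'z.
  apply: (@abs_le_root _ p _ (a / (r ^+ j * w k))%:E) => //.
  apply: le_trans (jump_ge Ss Ss' sz s'z) _.
  rewrite EFinM lee_pdivlMr ?rw0// muleC; apply: le_trans az.
  apply: esum_ge; exists [set k]; first by split => // _ ->.
  by rewrite fsbig_set1.
have := trace_increment hnu dnu alpha1 hS hpsi M0 M0 (step x ax) (step y ay).
move/le_trans; apply.
have C0 := increment_cst_ge0.
have min0 : 0 <= Num.min 1 (alpha ^ k * mdist (x : Z) y).
  by rewrite le_min ler01 mulr_ge0 ?mdist_ge0// ltW// scale_gt0.
(* The loss r^(-j/p) is weakened to r^(-j), as p >= 1 and r^j <= 1. *)
have ME : M <= a `^ p^-1 * ((r ^+ j)^-1 * w k `^ (- p^-1)).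
  rewrite /M powRM ?invr_ge0 ?(ltW (rw0 _ _))// ler_wpM2l ?powR_ge0//.
  rewrite invfM powRM ?invr_ge0 ?(ltW q0) ?(ltW (w0 _))//.
  rewrite (powRV _ (ltW (w0 k))).
  rewrite ler_wpM2r ?powR_ge0//.
  rewrite -[leRHS]powRr1 ?invr_ge0 ?(ltW q0)// ler_powR ?invr_ge1 ?unitfE ?gt_eqF//.
  by rewrite invf_le1.
apply: (@le_trans _ _ (Ci * Num.min 1 (alpha ^ k * mdist (x : Z) y) *
    (2 * (a `^ p^-1 * ((r ^+ j)^-1 * w k `^ (- p^-1)))))).
  apply: ler_wpM2l; first by apply: mulr_ge0.
  by move: ME; set Y := a `^ _ * _; lra.
have D := min_weight_decay beta alpha1 p1 k (mdist_ge0 (x : Z) y) xy.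
rewrite -/j in D.
have -> : (a / w m) `^ p^-1 = a `^ p^-1 * w m `^ (- p^-1).
  rewrite powRM ?invr_ge0 ?(ltW (w0 _))//.
  by rewrite (powRV _ (ltW (w0 m))).
have -> : 2 * Ci * (a `^ p^-1 * w m `^ (- p^-1)) * r ^+ j =
   2 * Ci * a `^ p^-1 * (r ^+ j)^-1 * ((r ^+ j) ^+ 2 * w m `^ (- p^-1)).
  by field; rewrite gt_eqF.
have -> : Ci * Num.min 1 (alpha ^ k * mdist (x : Z) y) *
    (2 * (a `^ p^-1 * ((r ^+ j)^-1 * w k `^ (- p^-1)))) =
   2 * Ci * a `^ p^-1 * (r ^+ j)^-1 *
    (Num.min 1 (alpha ^ k * mdist (x : Z) y) * w k `^ (- p^-1)) by ring.
apply: ler_wpM2l D; apply: mulr_ge0; last by rewrite invr_ge0 ltW.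
by apply: mulr_ge0; rewrite ?powR_ge0// mulr_ge0.
Qed.

Lemma trace_difference n m (x y : T) (a : R) (K : nat) : 0 <= a ->
  mdist (x : Z) y <= alpha ^ (- m) ->
  (tail_jump n m x <= a%:E)%E -> (tail_jump n m y <= a%:E)%E ->
  `|(tr (n + K%:Z) x - tr n x) - (tr (n + K%:Z) y - tr n y)| <=
  error_cst * (a / w m) `^ p^-1.
Proof.
move=> a0 xy ax ay.
apply: (@le_trans _ _ (\sum_(i < K) 2 * Ci * (a / w m) `^ p^-1 *
    r ^+ `|(m - (n + i%:Z))%R|)); last first.
  apply: (@le_trans _ _ (2 * Ci * W * (a / w m) `^ p^-1)); last first.
    by rewrite ler_wpM2r ?powR_ge0// lerDl.
  rewrite -mulr_sumr [leRHS]mulrAC ler_wpM2l//.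
    by rewrite mulr_ge0 ?powR_ge0// mulr_ge0// increment_cst_ge0.
  by apply: sum_geometric_int; exact: decay_ratio01.
elim: K => [|K ih]; first by rewrite addr0 !subrr normr0 big_ord0.
rewrite big_ord_recr /=.
have nK : n <= n + K%:Z by rewrite lerDl.
have h := trace_increment_decay nK a0 xy ax ay.
have -> : n + K.+1%:Z = n + K%:Z + 1 by rewrite -addrA -PoszD addn1.
rewrite (_ : _ - _ - _ = (tr (n + K%:Z) x - tr n x - (tr (n + K%:Z) y - tr n y)) +
  (tr (n + K%:Z + 1) x - tr (n + K%:Z) x - (tr (n + K%:Z + 1) y - tr (n + K%:Z) y))); last by ring.
apply: le_trans (ler_normD _ _) _; exact: lerD.
Qed.

(** The bound on T_(n+K) - T_n is uniform in K and passes to the limit. An infinite tail makes the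
    right-hand side infinite, its coefficient being positive. *)
Lemma trace_error_le n m (x y : T) (fx fy : R) :
  mdist (x : Z) y <= alpha ^ (- m) ->
  tr (n + K%:Z) x @[K --> \oo] --> fx -> tr (n + K%:Z) y @[K --> \oo] --> fy ->
  ((`|(tr n x - fx) - (tr n y - fy)| `^ p)%:E <=
   (error_cst `^ p / w m)%:E * (tail_jump n m x + tail_jump n m y))%E.
Proof.
move=> xy cx cy; have C0 := error_cst_gt0.
have X0 := tail_jump_ge0 n m x; have Y0 := tail_jump_ge0 n m y.
have Ep : 0 < error_cst `^ p by rewrite powR_gt0.
have [cf|] := boolP ((tail_jump n m x + tail_jump n m y)%E \is a fin_num); last first.
  by rewrite ge0_fin_numE ?adde_ge0// -leNgt leye_eq => /eqP ->;
    rewrite gt0_muley ?leey// lte_fin divr_gt0.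
set a := fine (tail_jump n m x + tail_jump n m y)%E.
have aE : (tail_jump n m x + tail_jump n m y)%E = a%:E by rewrite fineK.
have a0 : 0 <= a by rewrite fine_ge0// adde_ge0.
have h K : `|(tr (n + K%:Z) x - tr n x) - (tr (n + K%:Z) y - tr n y)| <=
    error_cst * (a / w m) `^ p^-1.
  by apply: trace_difference => //; rewrite -aE ?leeDl ?leeDr.
have lim : `|(fx - tr n x) - (fy - tr n y)| <= error_cst * (a / w m) `^ p^-1.
  have c : `|(tr (n + K%:Z) x - tr n x) - (tr (n + K%:Z) y - tr n y)| @[K --> \oo] -->
      `|(fx - tr n x) - (fy - tr n y)|.
    by apply: cvg_norm; apply: cvgB; apply: cvgB => //; exact: cvg_cst.
  rewrite -(cvg_lim _ c)//; apply: limr_le; first by apply/cvg_ex; eexists; exact: c.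
  exact: nearW.
rewrite aE -EFinM lee_fin.
rewrite (_ : _ - _ - _ = - ((fx - tr n x) - (fy - tr n y))); last by ring.
rewrite normrN; apply: (@le_trans _ _ ((error_cst * (a / w m) `^ p^-1) `^ p)).
  by rewrite ge0_ler_powR ?nnegrE ?(ltW p0)// mulr_ge0 ?powR_ge0// ltW.
rewrite powRM ?powR_ge0 ?(ltW C0)// root_powR ?divr_ge0 ?(ltW (w0 _))//.
by rewrite mulrA mulrAC.
Qed.

End vertex_function.

Section poisson_trace.
Variable f : T -> R.
Hypothesis mf : measurable_fun setT f.
Hypothesis hf : forall (z : Z) (r : R), 0 < r ->
  (\int[nuc]_(x in (ball z r : set T)) (`|f x| `^ p)%:E < +oo)%E.

Local Notation Pf := (poisson alpha tau S nu f).
Local Notation osc := (oscillation alpha lam p f).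
Local Notation E := (edge_energy alpha tau nu p beta Pf).
Local Notation J := (level_energy alpha lam S e p f).
Local Notation tail := (tail_jump Pf).
Local Notation tr k := (vertex_trace S psi k Pf).

(** A vertex is no interior point of an edge and determines its label, so [xget] has only the mean
    to choose. *)
Lemma poisson_vpt v : vertices S v -> Pf (vpt v) = mean nu (vb v) f.
Proof.
move=> Vv; rewrite /poisson; case: xgetP => [r _ [[w [Vw E ->]]|[w [w' [t [e t01 E _]]]]]|].
- suff -> : w = v by [].
  by have := congr1 (fun g => g v) E; rewrite /vpt eqxx; case: eqP => //= _ /eqP; rewrite oner_eq0.
- by exfalso; exact: (vpt_ept Vv e t01 E).
by move=> /(_ (mean nu (vb v) f))[]; left; exists v.
Qed.

(** The worst case is a vertex of level k + 1 above (s, k): its center is within 2 tau alpha^(-k) of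
    [s] and the ball of [s] has radius 3 tau alpha^(-k), in all 5 alpha times tau alpha^(-(k +
    1)). *)
Definition mean_cst := 2 `^ p * dbl Cnu (5 * alpha).

Lemma mean_cst_gt0 : 0 < mean_cst.
Proof. by rewrite mulr_gt0 ?powR_gt0// dbl_gt0. Qed.

Lemma vball_vol v : nu (vb v) = (vol nu v.1 (tau * alpha ^ (- v.2)))%:E.
Proof. by rewrite /vball -volE// mulr_gt0// scale_gt0. Qed.

Lemma poisson_sub_le v k s x : vertices S v ->
  mdist s v.1 + tau * alpha ^ (- v.2) <= lam * alpha ^ (- k) ->
  mdist v.1 s + lam * alpha ^ (- k) <= 5 * alpha * (tau * alpha ^ (- v.2)) ->
  ((`|Pf (vpt v) - f x| `^ p)%:E <= (mean_cst / nv k s)%:E * osc k s x)%E.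
Proof.
move=> Vv h1 h2; rewrite poisson_vpt// /mean.
have rv : 0 < tau * alpha ^ (- v.2) by rewrite mulr_gt0// scale_gt0.
have rD : 0 < lam * alpha ^ (- k) by rewrite mulr_gt0 ?scale_gt0// mulr_gt0.
have v0 := vol_gt0 hnu v.1 rv.
have mV : nu.-cara.-measurable (vb v) by exact: measurable_mball.
have fV : fine (nu (vb v)) = vol nu v.1 (tau * alpha ^ (- v.2)) by rewrite vball_vol.
have Voo : (nuc (vb v) < +oo)%E by rewrite [X in (X < _)%E]vball_vol ltry.
have V0 : (0 < nuc (vb v))%E by rewrite [X in (_ < X)%E]vball_vol lte_fin.
have intf : nuc.-integrable (vb v : set T) (EFin \o f).
  have := @integrable_Lp _ T R nuc (vb v) f p mV Voo mf p1.
  by apply; exact: hf.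
apply: le_trans (mean_powR_le mV V0 Voo mf p1 (f x) intf) _.
have O0 : (0 <= \int[nuc]_(y in (vb v : set T)) (`|f y - f x| `^ p)%:E)%E.
  by apply: integral_ge0 => y _; rewrite lee_fin powR_ge0.
apply: (@le_trans _ _ ((mean_cst / nv k s)%:E * \int[nuc]_(y in (vb v : set T)) (`|f y - f x| `^ p)%:E))%E.
  rewrite lee_wpmul2r// lee_fin [fine _]fV /mean_cst -mulrA ler_wpM2l ?powR_ge0//.
  rewrite ler_pdivlMr// mulrC ler_pdivrMr//; exact: (vol_le_dbl hnu dnu).
rewrite lee_wpmul2l ?lee_fin ?divr_ge0 ?(ltW mean_cst_gt0) ?(ltW (nv0 _ _))//.
apply: ge0_subset_integral => //.
- exact: measurable_mball.
- by apply: measurable_funTS; exact: measurable_abs_powR.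
- exact: subset_mball.
Qed.

Lemma poisson_self_le k s x : S k s ->
  ((`|Pf (vpt (s, k)) - f x| `^ p)%:E <= (mean_cst / nv k s)%:E * osc k s x)%E.
Proof.
move=> Ss; apply: poisson_sub_le => //=; rewrite mdistxx add0r.
  by rewrite ler_pM2r ?scale_gt0//; have := tau0; lra.
rewrite mulrA ler_pM2r ?scale_gt0// -mulrA mulrA ler_pM2r//.
by have := alpha1; lra.
Qed.

Lemma poisson_child_le v k s x : edge v (s, k) -> v.2 = k + 1 ->
  ((`|Pf (vpt v) - f x| `^ p)%:E <= (mean_cst / nv k s)%:E * osc k s x)%E.
Proof.
move=> [Vv Ss _ _ [z []]]; rewrite /vball !mem_ball/= => vz sz vk.
have vs : mdist v.1 s <= tau * alpha ^ (- v.2) + tau * alpha ^ (- k).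
  apply: le_trans (metric_triangle _ z _) _; rewrite (metric_sym z).
  exact: lerD (ltW vz) (ltW sz).
have E : alpha ^ (- k) = alpha * alpha ^ (- v.2) by rewrite vk (scaleS alpha1).
have a0 := scale_gt0 alpha1 (- v.2).
have ta : tau * alpha ^ (- v.2) <= tau * alpha ^ (- k).
  by rewrite ler_pM2l// E ler_peMl// ltW.
apply: poisson_sub_le => //.
  rewrite metric_sym; apply: le_trans (lerD vs (lexx _)) _; lra.
rewrite (_ : 5 * alpha * _ = 5 * (tau * alpha ^ (- k))); last by rewrite E; ring.
apply: le_trans (lerD vs (lexx _)) _; lra.
Qed.

(** A measurable majorant of |T_k f - f|^p up to a constant, whose integral times the weight is
    exactly the energy of level [k]. *)
Definition deviation k x : \bar R :=
  (\esum_(s in S k) ((\1_(D k s) x)%:E * ((nv k s)^-1%:E * osc k s x)))%E.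

Let dev0 k s x : (0 <= (\1_(D k s) x)%:E * ((nv k s)^-1%:E * osc k s x))%E.
Proof.
rewrite mule_ge0 ?lee_fin// mule_ge0 ?oscillation_ge0// lee_fin invr_ge0.
exact: ltW.
Qed.

Lemma deviation_ge0 k x : (0 <= deviation k x)%E.
Proof. by apply: esum_ge0 => s _. Qed.

Let mdev k s : measurable_fun setT
  (fun x : T => (\1_(D k s) x)%:E * ((nv k s)^-1%:E * osc k s x))%E.
Proof.
apply: emeasurable_funM.
  by apply/measurable_EFinP; apply: measurable_indic; exact: measurable_nball.
by apply: measurable_funeM; apply: (measurable_oscillation_net hnu alpha1 lam2).
Qed.

Lemma measurable_deviation k : measurable_fun setT (deviation k : T -> \bar R).
Proof.
apply: measurable_esum => //.
exact: (countable_net hnu dnu alpha1 hS).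
Qed.

Lemma integral_deviation k :
  ((weight alpha e k)%:E * \int[nuc]_x deviation k x =
   level_energy alpha lam S e p f k)%E.
Proof.
rewrite integral_esum//; last exact: (countable_net hnu dnu alpha1 hS).
rewrite -esumZl ?(ltW (w0 k))//; last by move=> s _; exact: integral_ge0.
apply: eq_esum => s _; rewrite integral_indicl ge0_integralZl//; last 4 first.
- exact: measurable_nball.
- by apply: measurable_funTS; apply: (measurable_oscillation_net hnu alpha1 lam2).
- by move=> x _; exact: oscillation_ge0.
- by rewrite lee_fin invr_ge0 ltW.
by rewrite muleA -EFinM.
Qed.

Lemma trace_deviation k x :
  ((`|tr k x - f x| `^ p)%:E <= mean_cst%:E * deviation k x)%E.
Proof.
have C0 := mean_cst_gt0; have d0 := deviation_ge0 k x.
have X0 : (0 <= mean_cst%:E * deviation k x)%E by rewrite mule_ge0// lee_fin ltW.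
have [fX|] := boolP ((mean_cst%:E * deviation k x)%E \is a fin_num); last first.
  by rewrite ge0_fin_numE// -leNgt leye_eq => /eqP ->; rewrite leey.
rewrite -(fineK fX) lee_fin -[leRHS](root_powR p0) ?fine_ge0//.
rewrite ge0_ler_powR ?nnegrE ?powR_ge0 ?(ltW p0)//.
apply: (trace_dist_le hnu dnu alpha1 hS hpsi); first exact: powR_ge0.
move=> s Ss /(psi_supp hpsi Ss) sx; apply: abs_le_root => //.
apply: le_trans (poisson_self_le x Ss) _.
rewrite EFinM -muleA lee_wpmul2l ?lee_fin ?(ltW C0)//.
apply: esum_ge; exists [set s]; first by split => // _ ->.
rewrite fsbig_set1 indicE mem_set ?mul1e// /nball mem_ball.
by apply: lt_le_trans sx _; rewrite ler_pM2r ?scale_gt0.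
Qed.

(** 2^p and one 2 come from inserting f(x) between the two means, the other 2 from the bound on
    [edge_mass]. *)
Definition edge_cst := 2 `^ p * 2 * 2 * mean_cst.

Lemma edge_cst_gt0 : 0 < edge_cst.
Proof. by rewrite mulr_gt0 ?mean_cst_gt0// !mulr_gt0 ?powR_gt0. Qed.

Let IO0 k s : (0 <= \int[nuc]_(x in D k s) osc k s x)%E.
Proof. by apply: integral_ge0 => x _; exact: oscillation_ge0. Qed.

Lemma edge_energy_le k s s' : edge (s', k + 1) (s, k) ->
  ((E ((s', k + 1), (s, k)))%:E <=
   edge_cst%:E * ((w k / nv k s)%:E * \int[nuc]_(x in D k s) osc k s x))%E.
Proof.
move=> h; have [Vv Vs _ _ _] := h.
have C0 : 0 < mean_cst by exact: mean_cst_gt0.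
set b := `|Pf (vpt (s', k + 1)) - Pf (vpt (s, k))| `^ p.
set I := (\int[nuc]_(x in D k s) osc k s x)%E.
have key : ((b * nv k s)%:E <= (2 `^ p * 2 * (mean_cst / nv k s))%:E * I)%E.
  (* The jump does not depend on [x]; integrating it over the ball averages the intermediate value
     f(x). *)
  have -> : (b * nv k s)%:E = (\int[nuc]_(x in D k s) b%:E)%E.
    rewrite EFinM -(nballE hnu alpha1 lam2 k s); apply/esym.
    rewrite -[nu _]/(nuc (D k s)); apply: (integral_cst nuc); exact: measurable_nball.
  rewrite /I -ge0_integralZl//; last 4 first.
  - exact: measurable_nball.
  - by apply: measurable_funTS; apply: (measurable_oscillation_net hnu alpha1 lam2).
  - by move=> x _; exact: oscillation_ge0.
  - by rewrite lee_fin mulr_ge0 ?divr_ge0 ?(ltW C0) ?(ltW (nv0 _ _))// mulr_ge0 ?powR_ge0.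
  apply: le_lower_integral => x _; first by rewrite lee_fin powR_ge0.
  have h1 := poisson_child_le x h erefl.
  have h2 := poisson_self_le x Vs.
  have O0 : (0 <= osc k s x)%E by exact: oscillation_ge0.
  apply: (@le_trans _ _ ((2 `^ p)%:E * ((`|Pf (vpt (s', (k + 1)%R)) - f x| `^ p)%:E +
     (`|Pf (vpt (s, k)) - f x| `^ p)%:E)))%E.
    rewrite -EFinD -EFinM lee_fin; apply: le_trans (powRD_le (ltW p0) _ _) => //.
    rewrite ge0_ler_powR ?nnegrE ?addr_ge0 ?(ltW p0)//.
    rewrite (_ : Pf _ - Pf _ = (Pf (vpt (s', k + 1)) - f x) - (Pf (vpt (s, k)) - f x)); last by ring.
    exact: ler_normB.
  rewrite -mulrA [X in (_ <= X * _)%E]EFinM -muleA lee_wpmul2l ?lee_fin ?powR_ge0//.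
  rewrite mulr_natl mulr2n EFinD ge0_muleDl ?lee_fin ?divr_ge0 ?(ltW C0) ?(ltW (nv0 _ _))//.
  exact: leeD h1 h2.
rewrite /edge_energy /= -/b.
have -> : alpha `^ (e * k%:~R) = w k by rewrite /weight mulrC.
apply: (@le_trans _ _ ((w k * 2)%:E * (b * nv k s)%:E)%E).
  rewrite -EFinM lee_fin -!mulrA ler_wpM2l ?(ltW (w0 k))//.
  rewrite mulrCA ler_wpM2l ?powR_ge0//; exact: edge_mass_le.
apply: (@le_trans _ _ ((w k * 2)%:E * ((2 `^ p * 2 * (mean_cst / nv k s))%:E * I))%E).
  by rewrite lee_wpmul2l// lee_fin mulr_ge0// ltW.
rewrite !muleA -!EFinM le_eqVlt; apply/orP; left; apply/eqP; congr (EFin _ * _)%E.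
by rewrite /edge_cst; ring.
Qed.

Lemma level_edges_energy k :
  (\esum_(i in level_edges k) (E i)%:E <=
   (child_card%:R * edge_cst)%:E * level_energy alpha lam S e p f k)%E.
Proof.
rewrite esum_level_edges; last by move=> i; rewrite lee_fin edge_energy_ge0.
have C0 := edge_cst_gt0.
have t0 s : (0 <= (w k / nv k s)%:E * \int[nuc]_(x in D k s) osc k s x)%E.
  by rewrite mule_ge0 // lee_fin divr_ge0 ?(ltW (w0 k)) ?(ltW (nv0 _ _)).
have C1 : 0 <= child_card%:R * edge_cst by apply: mulr_ge0 => //; exact: ltW.
rewrite /level_energy -esumZl//; apply: le_esum => s Ss.
rewrite EFinM -muleA.
have [cf|] := boolP ((edge_cst%:E * ((w k / nv k s)%:E * \int[nuc]_(x in D k s) osc k s x))%E \is a fin_num); last first.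
  have X0 : (0 <= edge_cst%:E * ((w k / nv k s)%:E * \int[nuc]_(x in D k s) osc k s x))%E.
    by rewrite mule_ge0// lee_fin ltW.
  rewrite ge0_fin_numE// -leNgt leye_eq => /eqP Xoo.
  (* As for the overlap, 0 * +oo must be excluded: a zero bound means that there are no children. *)
  rewrite Xoo; have [N0|N0] := posnP child_card; last first.
    by rewrite gt0_muley ?lte_fin ?ltr0n// leey.
  rewrite (_ : children k s = set0) ?esum_set0 ?N0 ?mul0e// -subset0 => s' hs'.
  suff : (#|` [fset s']%fset| <= child_card)%N by rewrite cardfs1 N0.
  by apply: (@children_bounded k s) => t /=; rewrite inE => /eqP ->.
rewrite -(fineK cf) -EFinM; apply: esum_card_bounded.
- by apply: fine_ge0; rewrite mule_ge0// lee_fin ltW.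
- exact: children_bounded.
by move=> s' hs'; rewrite fineK//; exact: edge_energy_le.
Qed.

Lemma integral_trace_error k :
  ((w k)%:E * \int[nuc]_x (`|tr k x - f x| `^ p)%:E <= mean_cst%:E * J k)%E.
Proof.
have C0 : 0 < mean_cst by exact: mean_cst_gt0.
rewrite -(integral_deviation k) muleCA.
rewrite lee_wpmul2l ?lee_fin ?(ltW (w0 _))//.
rewrite -ge0_integralZl//; last 3 first.
- exact: measurable_deviation.
- by move=> x _; exact: deviation_ge0.
- by rewrite lee_fin ltW.
apply: le_lower_integral => x _; first by rewrite lee_fin powR_ge0.
exact: trace_deviation.
Qed.

Lemma sum_edge_energy_le n :
  (\esum_(i in desc n) (E i)%:E <=
   (child_card%:R * edge_cst)%:E *
     \esum_(k in [set k | (n <= k)%R]) J k)%E.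
Proof.
rewrite esum_descending; last by move=> i; rewrite lee_fin edge_energy_ge0.
rewrite -esumZl; last 2 first.
- by apply: mulr_ge0 => //; exact/ltW/edge_cst_gt0.
- by move=> k _; exact: level_energy_ge0.
by apply: le_esum => k _; exact: level_edges_energy.
Qed.

Section finite_level_energy.

Hypothesis hJ : (\esum_(k in [set: int]) J k < +oo)%E.

Lemma level_energy_lty k : (J k < +oo)%E.
Proof.
apply: le_lt_trans hJ; apply: esum_ge; exists [set k]; first by split.
by rewrite fsbig_set1.
Qed.

(** The weights being at least w_n from level n on, the summability of the level energies makes the
    sum of the deviations integrable. Where this sum is finite, its terms, hence |T_k f - f|, tend
    to 0. *)
Lemma trace_cvg_null n : exists N : set T, [/\ measurable N, nuc N = 0%E
  & forall x, ~ N x -> tr (n + K%:Z) x @[K --> \oo] --> f x].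
Proof.
pose Phi (x : T) := (\esum_(i in [set: nat]) deviation (n + i%:Z)%R x)%E.
have d0 k x : (0 <= deviation k x)%E by exact: deviation_ge0.
have md k : measurable_fun setT (deviation k : T -> \bar R).
  exact: measurable_deviation.
have Phi0 x : (0 <= Phi x)%E by exact: esum_ge0.
have mPhi : measurable_fun setT Phi by apply: measurable_esum => //; exact: countableP.
have iPhi : (\int[nuc]_x Phi x < +oo)%E.
  have h : ((w n)%:E * \int[nuc]_x Phi x <= \esum_(k in [set: int]) J k)%E.
    rewrite integral_esum//; last exact: countableP.
    rewrite -esumZl ?(ltW (w0 _))//; last by move=> i _; exact: integral_ge0.
    apply: le_trans (esum_subset J (subsetT [set k | n <= k])).
    rewrite -esum_shift; apply: le_esum => i _.
    rewrite -integral_deviation.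
    rewrite lee_wpmul2r ?integral_ge0// lee_fin ler_powR ?(ltW alpha1)//.
    by rewrite ler_wpM2r ?(ltW e0)// ler_int lerDl.
  have I0 : (0 <= \int[nuc]_x Phi x)%E by exact: integral_ge0.
  move: I0 (le_lt_trans h hJ).
  case: (\int[nuc]_x Phi x)%E => [s _ _|_|//]; first exact: ltry.
  by rewrite gt0_muley ?lte_fin// ltxx.
have : nuc.-integrable setT Phi.
  apply/integrableP; split => //.
  by under eq_integral do rewrite gee0_abs//.
move=> /(integrable_ae measurableT) [N [mN N0 hN]].
exists N; split => // x Nx.
have fPhi : Phi x \is a fin_num.
  by apply: contrapT => h; apply: Nx; apply: hN => /= /(_ I).
have : (\sum_(0 <= i <oo) deviation (n + i%:Z)%R x < +oo)%E.
  by rewrite ge0_fin_numE// in fPhi; rewrite nneseries_esumT.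
move=> /nneseries_tail_cvg/(_ (fun _ _ => d0 _ _)) tl.
have C0 : 0 < mean_cst by exact: mean_cst_gt0.
apply/cvgrPdist_le => eps eps0.
have [finK tl0] := (fine_cvgP _ _).1 tl.
have d1 : 0 < eps `^ p / mean_cst by rewrite divr_gt0// powR_gt0.
move/cvgrPdist_lt: tl0 => /(_ _ d1) tl0.
near=> K; rewrite distrC.
have fK : (\sum_(K <= i <oo) deviation (n + i%:Z)%R x)%E \is a fin_num by near: K.
have sK : `|0 - fine (\sum_(K <= i <oo) deviation (n + i%:Z)%R x)%E| < eps `^ p / mean_cst by near: K.
have t0 : (0 <= \sum_(K <= i <oo) deviation (n + i%:Z)%R x)%E by exact: nneseries_ge0.
have dK : (deviation (n + K%:Z)%R x <= \sum_(K <= i <oo) deviation (n + i%:Z)%R x)%E.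
  have := @nneseries_lim_ge _ (fun i => deviation (n + i%:Z) x) xpredT K K.+1 (fun _ _ _ => d0 _ _).
  by rewrite big_nat1.
have h : ((`|tr (n + K%:Z)%R x - f x| `^ p)%:E <= (eps `^ p)%:E)%E.
  apply: le_trans (trace_deviation _ x) _.
  apply: le_trans (lee_wpmul2l _ dK) _; first by rewrite lee_fin ltW.
  rewrite -(fineK fK) -EFinM lee_fin mulrC -ler_pdivlMr//.
  by rewrite ltW// (le_lt_trans _ sK)// sub0r normrN ler_norm.
rewrite lee_fin in h; rewrite leNgt; apply/negP => lt.
move: h; rewrite leNgt => /negP; apply; apply: gt0_ltr_powR => //.
by rewrite nnegrE ltW.
Unshelve. all: by end_near. Qed.

End finite_level_energy.

Variable d : Z -> Z -> R.
Variables K1 K2 : R.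
Hypothesis K1gt0 : 0 < K1.
Hypothesis K2gt0 : 0 < K2.
Hypothesis d_ge : forall x y, mdist x y <= K1 * d x y.
Hypothesis d_le : forall x y, d x y <= K2 * mdist x y.

Local Notation Cub := (kernel_ub_cst Cnu alpha lam K1 K2 e).
Local Notation Ec := (energy_cst Cnu alpha lam K1 K2 e).
Local Notation cc := (child_card%:R * edge_cst).
Local Notation W := (two_sided_sum (decay_ratio alpha p beta)).
Local Notation B := (@besov_integral R Z nu d e p).
Local Notation sm n := (@smoothing_kernel _ _ nu alpha lam S (tail n)).
Local Notation os := (oscillation_kernel alpha lam S e p f).

Let Cub0 : 0 < Cub. Proof. exact: kernel_ub_cst_gt0. Qed.

Let tail0 n k x : (0 <= tail n k x)%E.
Proof. exact: tail_jump_ge0. Qed.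
Let mtail n k : measurable_fun setT (tail n k).
Proof. exact: measurable_tail_jump. Qed.

(** In order: the kernel bound, the two variables, the overlap of the balls, and the sum over the
    scales m. *)
Definition kernel_cst := Cub * 2 * (overlap Cnu lam)%:R * W.

Lemma kernel_cst_ge0 : 0 <= kernel_cst.
Proof.
apply: mulr_ge0; last by apply: two_sided_sum_ge0; exact: decay_ratio01.
by rewrite mulr_ge0// mulr_ge0// ltW.
Qed.

(** Used with b = 0 for the error T_n f - f, and with b = 2^p for T_n f itself, where the last term
    accounts for f. *)
Lemma besov_dominate (v : T -> R) n (N : set T) (a b : R) : 0 <= a -> 0 <= b ->
  measurable N -> nuc N = 0%E ->
  (forall x y m, ~ N x -> ~ N y -> mdist (x : Z) y < alpha ^ (- m) ->
    ((`|v x - v y| `^ p)%:E <=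
      (a / w m)%:E * (tail n m x + tail n m y) + b%:E * (`|f x - f y| `^ p)%:E)%E) ->
  (B v <= (a * kernel_cst)%:E * (\esum_(i in desc n) (E i)%:E) +
    (b * Cub)%:E * \esum_(k in [set: int]) J k)%E.
Proof.
move=> a0 b0 mN N0 hv.
pose G (y x : T) := ((Cub * a)%:E * sm n y x + (Cub * b)%:E * os y x)%E.
have Ca0 : 0 <= Cub * a by rewrite mulr_ge0// ltW.
have Cb0 : 0 <= Cub * b by rewrite mulr_ge0// ltW.
have S0 y x : (0 <= sm n y x)%E by exact: smoothing_kernel_ge0.
have O0 y x : (0 <= os y x)%E by exact: (oscillation_kernel_ge0 hnu).
have mSm y : measurable_fun setT (sm n y).
  exact: (measurable_smoothing_kernel hnu dnu alpha1 lam2 hS).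
have mOs y : measurable_fun setT (os y).
  exact: (measurable_oscillation_kernel hnu dnu alpha1 lam2 hS).
have mIS : measurable_fun setT (fun y => \int[nuc]_x sm n y x)%E.
  exact: (measurable_integral_smoothing_kernel hnu dnu alpha1 lam2 hS).
have mIO : measurable_fun setT (fun y => \int[nuc]_x os y x)%E.
  exact: (measurable_integral_oscillation_kernel hnu dnu alpha1 lam2 hS).
have G0 y x : (0 <= G y x)%E by rewrite adde_ge0 ?mule_ge0 ?lee_fin.
have k0 (x y : T) : 0 <= kernel nu d e x y.
  rewrite mulr_ge0 ?invr_ge0 ?powR_ge0 ?fine_ge0//.
have key x y : ~ N x -> ~ N y ->
    ((`|v x - v y| `^ p / d x y `^ e / fine (nu (dball d x (d x y))))%:E <= G y x)%E.
  move=> Nx Ny; rewrite besov_integrandE.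
  have [xy|xy] := pselect (x = y).
    by rewrite xy subrr normr0 powR0 ?gt_eqF// mul0r.
  have [m [s [Ss Dx Dy xym kub]]] := kernel_ub hnu dnu alpha1 lam2 hS K1gt0 K2gt0 d_ge d_le e0 xy.
  have n0 : 0 < nvol nu alpha lam m s by exact: nvol_gt0.
  apply: (@le_trans _ _ ((Cub * w m / nvol nu alpha lam m s)%:E * (`|v x - v y| `^ p)%:E)%E).
    by rewrite -EFinM lee_fin mulrC ler_wpM2r// powR_ge0.
  have Kn0 : 0 <= Cub * w m / nvol nu alpha lam m s.
    by rewrite divr_ge0 ?(ltW n0)// mulr_ge0 ?(ltW Cub0) ?(ltW (w0 _)).
  apply: le_trans (lee_wpmul2l _ (hv x y m Nx Ny xym)) _; first by rewrite lee_fin.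
  have P0 : (0 <= (`|f x - f y| `^ p)%:E)%E by rewrite lee_fin powR_ge0.
  have T0 : (0 <= tail n m x + tail n m y)%E by rewrite adde_ge0.
  rewrite ge0_muleDr; last 2 first.
  - by apply: mule_ge0 => //; rewrite lee_fin divr_ge0// ltW.
  - by apply: mule_ge0.
  have hs := smoothing_kernel_ge (tail n) Ss Dx Dy.
  have ho := oscillation_kernel_ge e p f Ss Dx Dy.
  apply: leeD.
    apply: le_trans (lee_wpmul2l _ hs); last by rewrite lee_fin.
    rewrite !muleA -!EFinM le_eqVlt; apply/orP; left; apply/eqP; congr (EFin _ * _)%E.
    by field; rewrite !gt_eqF.
  apply: le_trans (lee_wpmul2l _ ho); last by rewrite lee_fin.
  rewrite !muleA -!EFinM le_eqVlt; apply/orP; left; apply/eqP; congr (EFin _).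
  by ring.
have v0 x y : (0 <= (`|v x - v y| `^ p / d x y `^ e / fine (nu (dball d x (d x y))))%:E)%E.
  by rewrite besov_integrandE lee_fin mulr_ge0// powR_ge0.
apply: (@le_trans _ _ (\int[nuc]_y \int[nuc]_x G y x)%E).
  (* The null set is discarded first in the outer variable, then in the inner one. *)
  rewrite /besov_integral; apply: (le_lower_integral_null mN N0) => [|y|y|y Ny].
  - exact: (measurable_integral_combination Ca0 Cb0 S0 O0 mSm mOs mIS mIO).
  - exact: integral_ge0.
  - exact: integral_ge0.
  - apply: (le_lower_integral_null mN N0) => // [|x Nx]; last exact: key.
    exact: (measurable_combination _ _ mSm mOs).
rewrite (integral2_combination Ca0 Cb0 S0 O0 mSm mOs mIS mIO).
rewrite (integral2_oscillation_kernel hnu dnu alpha1 lam2 hS e p mf).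
apply: leeD; last by rewrite mulrC.
have h1 := integral2_smoothing_kernel hnu dnu alpha1 lam2 hS (tail0 n) (mtail n).
have h2 := sum_integral_tail_jump Pf n.
apply: le_trans (lee_wpmul2l _ h1) _; first by rewrite lee_fin.
have N2 : 0 <= 2 * (overlap Cnu lam)%:R :> R by rewrite mulr_ge0.
rewrite muleA; apply: le_trans (lee_wpmul2l _ h2) _.
  by rewrite -EFinM lee_fin mulr_ge0.
rewrite muleA -!EFinM le_eqVlt; apply/orP; left; apply/eqP; congr (EFin _ * _)%E.
by rewrite /kernel_cst; ring.
Qed.

Let mtr n : measurable_fun setT (tr n : T -> R).
Proof. exact: (measurable_trace hnu dnu alpha1 hS hpsi). Qed.

Let J0 k : (0 <= J k)%E. Proof. exact: level_energy_ge0. Qed.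

Let sJ : (\esum_(k in [set: int]) J k <= Ec%:E * B f)%E.
Proof. exact: (level_energy_le hnu dnu alpha1 lam2 hS). Qed.

Hypothesis Bf : (B f < +oo)%E.

Let B0 v : (0 <= B v)%E.
Proof.
apply: integral_ge0 => y _; apply: integral_ge0 => x _.
by rewrite lee_fin !mulr_ge0 ?invr_ge0 ?powR_ge0 ?fine_ge0.
Qed.

Let Ec0 : 0 < Ec. Proof. exact: energy_cst_gt0. Qed.

Let hJ : (\esum_(k in [set: int]) J k < +oo)%E.
Proof.
apply: le_lt_trans sJ _; move: (B0 f) Bf; case: (B f) => // b _ _.
by rewrite -EFinM ltry.
Qed.

Let Kc0 : 0 <= kernel_cst. Proof. exact: kernel_cst_ge0. Qed.

Let cc0 : 0 <= cc.
Proof. by apply: mulr_ge0 => //; exact/ltW/edge_cst_gt0. Qed.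

Lemma trace_error_dominated n : exists N : set T, [/\ measurable N, nuc N = 0%E
  & forall x y m, ~ N x -> ~ N y -> mdist (x : Z) y < alpha ^ (- m) ->
    ((`|(tr n x - f x) - (tr n y - f y)| `^ p)%:E <=
      (error_cst `^ p / w m)%:E * (tail n m x + tail n m y))%E].
Proof.
have [N [mN N0 hN]] := trace_cvg_null hJ n.
exists N; split => // x y m Nx Ny xy.
apply: (trace_error_le (ltW xy)); exact: hN.
Qed.

Lemma besov_error_le n :
  (B (fun x => (tr n x - f x)%R) <= (error_cst `^ p * kernel_cst)%:E * \esum_(i in desc n) (E i)%:E)%E.
Proof.
have [N [mN N0 hN]] := trace_error_dominated n.
have := besov_dominate
  (v := fun x => tr n x - f x) (n := n) (powR_ge0 error_cst p) (lexx 0) mN N0.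
rewrite !mul0r mul0e adde0; apply => x y m Nx Ny xy.
by rewrite mul0e adde0; exact: hN.
Qed.

Definition trace_cst := 2 `^ p * error_cst `^ p * kernel_cst * (cc * Ec) + 2 `^ p * Cub * Ec.

Lemma trace_cst_ge0 : 0 <= trace_cst.
Proof.
apply: addr_ge0; last by apply: mulr_ge0 (ltW Ec0); apply: mulr_ge0 (ltW Cub0); rewrite powR_ge0.
apply: mulr_ge0; last exact: mulr_ge0 cc0 (ltW Ec0).
by apply: mulr_ge0 Kc0; rewrite mulr_ge0 ?powR_ge0.
Qed.

Lemma besov_trace_le n : (B (tr n) <= trace_cst%:E * B f)%E.
Proof.
have [N [mN N0 hN]] := trace_error_dominated n.
have aQ : 0 <= 2 `^ p * error_cst `^ p by rewrite mulr_ge0 ?powR_ge0.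
have := besov_dominate
  (v := tr n) (n := n) aQ (powR_ge0 2 p) mN N0.
move=> /(_ _)/le_trans; apply.
  move=> x y m Nx Ny xy.
  (* The triangle inequality is applied to the integrand rather than to the seminorm, because only
     the majorants of the integrand are known to be measurable. *)
  apply: (@le_trans _ _ ((2 `^ p)%:E *
      ((`|(tr n x - f x) - (tr n y - f y)| `^ p)%:E + (`|f x - f y| `^ p)%:E))%E).
    rewrite -EFinD -EFinM lee_fin; apply: le_trans (powRD_le (ltW p0) _ _) => //.
    rewrite ge0_ler_powR ?nnegrE ?addr_ge0 ?(ltW p0)//.
    rewrite (_ : tr n x - tr n y = ((tr n x - f x) - (tr n y - f y)) + (f x - f y)); last by ring.
    exact: ler_normD.
  have T0 : (0 <= tail n m x + tail n m y)%E by rewrite adde_ge0 ?tail_jump_ge0.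
  rewrite ge0_muleDr ?lee_fin ?powR_ge0//; apply: leeD => //.
  rewrite -mulrA EFinM -muleA lee_wpmul2l ?lee_fin ?powR_ge0//.
  exact: hN.
have sub := esum_subset J (subsetT [set k | n <= k]).
have h1 := sum_edge_energy_le n.
have h2 : (\esum_(i in desc n) (E i)%:E <= (cc * Ec)%:E * B f)%E.
  apply: le_trans h1 _; rewrite [(cc * Ec)%:E]EFinM -muleA; apply: lee_wpmul2l; first by rewrite lee_fin.
  exact: le_trans sub sJ.
have Kcp : 0 <= 2 `^ p * error_cst `^ p * kernel_cst by rewrite mulr_ge0.
apply: le_trans (leeD (lee_wpmul2l _ h2) (lee_wpmul2l _ sJ)) _.
- by rewrite lee_fin.
- by rewrite lee_fin mulr_ge0 ?powR_ge0 ?(ltW Cub0).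
rewrite !muleA -!EFinM -ge0_muleDl ?lee_fin.
- by rewrite -EFinD.
- by apply: mulr_ge0 => //; apply: mulr_ge0 => //; exact: ltW.
by apply: mulr_ge0; [apply: mulr_ge0; [exact: powR_ge0|exact: ltW]|exact: ltW].
Qed.

Let sJn : (\sum_(0 <= i <oo) J i%:Z < +oo)%E.
Proof.
rewrite nneseries_esumT//; apply: le_lt_trans hJ.
apply: le_trans (esum_subset J (subsetT [set k | 0 <= k])).
by rewrite -(@esum_shift _ 0); apply: le_esum => i _; rewrite add0r.
Qed.

Lemma besov_error_cvg : B (fun x => (tr k%:Z x - f x)%R) @[k --> \oo] --> 0%E.
Proof.
pose c := error_cst `^ p * kernel_cst * cc.
have c0 : 0 <= c by rewrite mulr_ge0// mulr_ge0 ?powR_ge0.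
apply: (@squeeze_cvge _ _ _ _ (cst 0%E) _ (fun k => c%:E * \sum_(k <= i <oo) J i%:Z)%E).
- near=> k; rewrite B0/=; apply: le_trans (besov_error_le _) _.
  have h1 := sum_edge_energy_le k%:Z.
  apply: le_trans (lee_wpmul2l _ h1) _; first by rewrite lee_fin mulr_ge0 ?powR_ge0.
  rewrite muleA -EFinM -/c; apply: lee_wpmul2l; first by rewrite lee_fin.
  by rewrite (esum_ge_nat k J0).
- exact: cvg_cst.
rewrite -[X in _ --> X](mule0 c%:E); apply: cvgeZl => //.
exact: nneseries_tail_cvg.
Unshelve. all: by end_near. Qed.

Lemma Lp_error_cvg : (\int[nuc]_x (`|tr k%:Z x - f x| `^ p)%:E)%E @[k --> \oo] --> 0%E.
Proof.
have C0 : 0 < mean_cst by exact: mean_cst_gt0.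
have I0 k : (0 <= \int[nuc]_x (`|tr k x - f x| `^ p)%:E)%E.
  by apply: integral_ge0 => x _; rewrite lee_fin powR_ge0.
apply: (@squeeze_cvge _ _ _ _ (cst 0%E) _ (fun k => mean_cst%:E * J k%:Z)%E).
- near=> k; rewrite I0/=.
  apply: le_trans (integral_trace_error k%:Z).
  (* The weight w_k is at least 1 for k >= 0, so that the weighted estimate bounds the plain
     integral. *)
  rewrite -[leLHS]mul1e lee_wpmul2r// lee_fin /weight -[leLHS](powRr0 alpha).
  have k0 : 0 <= k%:Z%:~R * e by rewrite mulr_ge0 ?ler0z ?(ltW e0).
  by rewrite ler_powR ?(ltW alpha1).
- exact: cvg_cst.
rewrite -[X in _ --> X](mule0 mean_cst%:E); apply: cvgeZl => //.
apply: (@squeeze_cvge _ _ _ _ (cst 0%E) _ (fun k => \sum_(k <= i <oo) J i%:Z)%E).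
- near=> k; rewrite J0/=.
  have := @nneseries_lim_ge _ (fun i => J i%:Z) xpredT k k.+1 (fun _ _ _ => J0 _).
  by rewrite big_nat1.
- exact: cvg_cst.
exact: nneseries_tail_cvg.
Unshelve. all: by end_near. Qed.

(** The error is p-integrable on all of [Z], whether or not f is; hence T_n f is p-integrable on the
    same measurable sets as f. *)
Lemma Lp_error_lty n : (\int[nuc]_x (`|tr n x - f x| `^ p)%:E < +oo)%E.
Proof.
have h := integral_trace_error n.
have I0 : (0 <= \int[nuc]_x (`|tr n x - f x| `^ p)%:E)%E.
  by apply: integral_ge0 => x _; rewrite lee_fin powR_ge0.
have Joo : (mean_cst%:E * J n < +oo)%E.
  have := level_energy_lty hJ n; move: (J0 n); case: (J n) => // j _ _.
  by rewrite -EFinM ltry.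
move: I0 (le_lt_trans h Joo); case: (integral _ _ _) => [r _ _|_|//]; first exact: ltry.
by rewrite gt0_muley ?lte_fin// ltxx.
Qed.

Lemma trace_Lp_lty n (A : set T) : measurable A ->
  (\int[nuc]_(x in A) (`|f x| `^ p)%:E < +oo)%E ->
  (\int[nuc]_(x in A) (`|tr n x| `^ p)%:E < +oo)%E.
Proof.
move=> mA fA.
have E1 : (\int[nuc]_(x in A) (`|tr n x| `^ p)%:E =
    \int[nuc]_(x in A) (`|(tr n x - f x) + f x| `^ p)%:E)%E.
  by apply: eq_integral => x _; rewrite subrK.
have md : measurable_fun setT (fun x : T => tr n x - f x) by exact: measurable_funB.
rewrite E1; apply: le_lt_trans (Lp_integral_add nuc (ltW p0) mA md mf) _.
have h : (\int[nuc]_(x in A) (`|tr n x - f x| `^ p)%:E < +oo)%E.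
  apply: le_lt_trans (Lp_error_lty n); apply: subset_lower_integral; first exact: subsetT.
  by move=> x; rewrite lee_fin powR_ge0.
have := lte_add_pinfty h fA.
have : (0 <= \int[nuc]_(x in A) (`|tr n x - f x| `^ p)%:E + \int[nuc]_(x in A) (`|f x| `^ p)%:E)%E.
  by apply: adde_ge0; apply: integral_ge0 => x _; rewrite lee_fin powR_ge0.
case: (_ + _)%E => // s _ _; by rewrite -EFinM ltry.
Qed.

End poisson_trace.

End besov_trace.

(** * Proof of the theorem *)

Unset Implicit Arguments.

Theorem proposition6p9 (R : realType) (alpha tau : R)
    (halpha : 1 < alpha) (htau : Num.max 3 (alpha / (alpha - 1)) < tau) :
  exists n0 : int,
  forall (Cpsi : R -> R) (Cnu beta p : R), 1 <= p -> 0 < beta < p ->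
  exists C : R,
  forall (Z : completeMetricType R) (nu : {outer_measure set Z -> \bar R})
    (S : int -> set Z) (psi : Z * int -> Z -> R),
  metric_measure_space nu -> doubling nu Cnu ->
  (forall n : int, maximal_separated (alpha ^ (- n)) (S n)) ->
  lipschitz_partition alpha S (Cpsi Cnu) psi ->
  let theta : R := 1 - beta / p in
  let d := boundary_dist alpha tau S in
  forall f : Z -> R, in_besov nu d theta p f ->
  let Pf := poisson alpha tau S nu f in
  let g := edge_gradient alpha tau S Pf in
  let T n := vertex_trace S psi n Pf in
  [/\ forall n : int,
        (besov_seminorm nu d theta p (T n \- f)%R
         <= C%:E * filling_Lp_norm alpha tau S nu beta p
                     (filling_ge alpha tau S (n - n0)) g)%E,
      forall n : int,
        (besov_seminorm nu d theta p (T n) <= C%:E * besov_seminorm nu d theta p f)%E,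
      (forall n : int, in_besov nu d theta p (T n)) /\
      besov_seminorm nu d theta p (T k%:Z \- f)%R @[k --> \oo] --> 0%E
    & in_check_besov nu d theta p f ->
      (forall n : int, in_check_besov nu d theta p (T n)) /\
      check_besov_norm nu d theta p (T k%:Z \- f)%R @[k --> \oo] --> 0%E].
Proof.
have alpha1 := halpha.
exists 0 => Cpsi Cnu beta p p1 hbeta; have /andP[beta0 betap] := hbeta.
have p0 : 0 < p by exact: lt_le_trans p1.
(* All constants are formed before the space, the measure and the nets are introduced, which is the
   uniformity claimed for [C]. *)
pose K1 := mdist_cst alpha tau; pose K2 := bridge_cst alpha * alpha.
have K1gt0 : 0 < K1 by exact: mdist_cst_gt0.
have K2gt0 : 0 < K2 by rewrite mulr_gt0 ?bridge_cst_gt0 ?alpha_gt0.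
pose C0 := error_cst Cnu alpha p beta (Cpsi Cnu) `^ p *
  kernel_cst Cnu alpha tau p beta K1 K2.
pose C1 := C0 * alpha `^ (p + beta).
pose C2 := trace_cst Cnu alpha tau p beta (Cpsi Cnu) K1 K2.
have C2ge0 : 0 <= C2 by exact: trace_cst_ge0.
have C0ge0 : 0 <= C0.
  by rewrite mulr_ge0 ?powR_ge0//; exact: kernel_cst_ge0.
have C1ge0 : 0 <= C1 by rewrite mulr_ge0 ?powR_ge0.
(* The sum dominates both constants, so that one [C] serves the two inequalities. *)
exists (C1 `^ p^-1 + C2 `^ p^-1) => Z nu S psi hnu dnu hS hpsi theta d f [mf hf hB] Pf g T.
have d_ge x y : mdist x y <= K1 * d x y by exact: boundary_dist_ge.
have d_le x y : d x y <= K2 * mdist x y by exact: boundary_dist_le.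
have pth : p * theta = p - beta by rewrite /theta; field; rewrite gt_eqF.
pose nuc := (nu : {measure set (caratheodory_type nu) -> \bar R}).
pose B := @besov_integral R Z nu d (p - beta) p.
have BE u : besov_seminorm nu d theta p u = (B u `^ p^-1)%E.
  by rewrite /B -pth.
have B0 u : (0 <= B u)%E.
  apply: integral_ge0 => y _; apply: integral_ge0 => x _.
  by rewrite lee_fin !mulr_ge0 ?invr_ge0 ?powR_ge0 ?fine_ge0.
have pV0 : p^-1 != 0 by rewrite invr_eq0 gt_eqF.
have Bf : (B f < +oo)%E by move: hB; rewrite BE => /lty_poweRy; exact.
have mT k : nu_measurable nu (T k) by exact: (measurable_trace hnu dnu alpha1 hS hpsi).
have hfb (z : Z) (r : R) : 0 < r ->
    (\int[nuc]_(x in (ball z r : set (caratheodory_type nu))) (`|f x| `^ p)%:E < +oo)%E.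
  move=> r0; apply: le_lt_trans (hf z (K2 * r) (mulr_gt0 K2gt0 r0)).
  apply: subset_lower_integral => [y|x]; last by rewrite lee_fin powR_ge0.
  rewrite mem_ball => zy; apply: le_lt_trans (d_le z y) _.
  by rewrite ltr_pM2l.
have S1 n : (besov_seminorm nu d theta p (T n \- f)%R
    <= (C1 `^ p^-1)%:E * filling_Lp_norm alpha tau S nu beta p (filling_ge alpha tau S n) g)%E.
  (* Positivity of an integral against a set function is not automatic; it is read off from the
     lower bound by the edge energies. *)
  have I0 : (0 <= \int[filling_measure_beta (alpha := alpha) (tau := tau) (S := S) nu beta]_(x in (filling_ge alpha tau S n : set (borel_pt alpha tau S))) (`|g x| `^ p)%:E)%E.
    have a0 : 0 < alpha `^ (p + beta) by rewrite powR_gt0// alpha_gt0.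
    rewrite -(pmule_rge0 _ (_ : (0 < (alpha `^ (p + beta))%:E)%E)) ?lte_fin//.
    apply: le_trans (edge_energy_le_filling alpha1 htau hS hnu p1 beta0 Pf n).
    by apply: esum_ge0 => i _; rewrite lee_fin edge_energy_ge0.
  rewrite BE; apply: (poweR_root_le p0 C1ge0 (B0 _) I0).
  apply: le_trans (besov_error_le hnu dnu alpha1 htau hS p1 hbeta hpsi mf hfb K1gt0 K2gt0 d_ge d_le Bf n) _.
  rewrite -/C0 [C1%:E](EFinM C0) -muleA; apply: lee_wpmul2l; first by rewrite lee_fin.
  exact: (edge_energy_le_filling alpha1 htau hS hnu p1 beta0).
have S2 n : (besov_seminorm nu d theta p (T n)
    <= (C2 `^ p^-1)%:E * besov_seminorm nu d theta p f)%E.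
  rewrite !BE; apply: poweR_root_le => //.
  exact: (besov_trace_le hnu dnu alpha1 htau hS p1 hbeta hpsi mf hfb K1gt0 K2gt0 d_ge d_le Bf n).
have S3 : besov_seminorm nu d theta p (T k%:Z \- f)%R @[k --> \oo] --> 0%E.
  under eq_cvg do rewrite BE.
  apply: poweR_cvg0 => //; first by rewrite invr_gt0.
  exact: (besov_error_cvg hnu dnu alpha1 htau hS p1 hbeta hpsi mf hfb K1gt0 K2gt0 d_ge d_le Bf).
have S4 n : in_besov nu d theta p (T n).
  split; first exact: mT.
    move=> z r r0; apply: le_lt_trans (_ : (_ <= \int[nuc]_(x in (ball z (K1 * r) : set (caratheodory_type nu))) (`|T n x| `^ p)%:E)%E) _.
      apply: subset_lower_integral => [y zy|x]; last by rewrite lee_fin powR_ge0.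
      by rewrite mem_ball (le_lt_trans (d_ge z y))// ltr_pM2l.
    apply: (trace_Lp_lty hnu dnu alpha1 htau hS p1 hbeta hpsi mf hfb K1gt0 K2gt0 d_ge d_le Bf).
      exact: (measurable_mball hnu).
    by apply: hfb; exact: mulr_gt0.
  apply: le_lt_trans (S2 n) _; move: hB (poweR_ge0 (B f) p^-1); rewrite BE.
  by case: (B f `^ p^-1)%E => // b _ _; rewrite -EFinM ltry.
split.
- move=> n; rewrite subr0; apply: le_trans (S1 n) _.
  by rewrite lee_wpmul2r ?poweR_ge0// lee_fin lerDl powR_ge0.
- move=> n; apply: le_trans (S2 n) _.
  by rewrite lee_wpmul2r ?BE ?poweR_ge0// lee_fin lerDr powR_ge0.
- split; [exact: S4|exact: S3].
move=> [[_ fLp] _]; split.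
  move=> n; split; last exact: S4.
  split; first exact: mT.
  rewrite Lp_norm_integral in fLp; rewrite Lp_norm_integral; apply: poweR_lty.
  apply: (trace_Lp_lty hnu dnu alpha1 htau hS p1 hbeta hpsi mf hfb K1gt0 K2gt0 d_ge d_le Bf).
    exact: measurableT.
  exact: (lty_poweRy pV0 fLp).
rewrite -[X in _ --> X]adde0; apply: cvgeD; [by []| |exact: S3].
under eq_cvg do rewrite Lp_norm_integral.
apply: poweR_cvg0 => [|k|]; first by rewrite invr_gt0.
  by apply: integral_ge0 => x _; rewrite lee_fin powR_ge0.
exact: (Lp_error_cvg hnu dnu alpha1 htau hS p1 hbeta hpsi mf hfb K1gt0 K2gt0 d_ge d_le Bf).
Qed.
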